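(* Let $G\in\mathcal{A}$ be a graph that is not a disjoint union of cliques, and let $T$ be any interesting set of $G$. Then $C(T)$ contains a special even pair of $G$, i.e. there is a special even pair $\{a,b\}$ of $G$ with $a,b\in C(T)$.
   Context: Graphs are finite and simple; ''$G$ contains $F$'' means as an induced subgraph. The length of a path is its number of edges; a path (or cycle) is chordless if it is an induced path (cycle). A hole is a chordless cycle with at least four vertices; it is odd if it has an odd number of vertices. An antihole is the complement of a hole, and its length is its number of vertices. A prism is a graph consisting of two vertex-disjoint triangles together with three vertex-disjoint paths between them (each joining a vertex of one triangle to a vertex of the other), with no edges other than those of the two triangles and of the three paths. $\mathcal{A}$ is the class of graphs that contain no odd hole, no antihole of length at least $5$, and no prism. For $G=(V,E)$ and $T\subseteq V$, a vertex of $V\setminus T$ is $T$-complete if it is adjacent to all vertices of $T$; $C(T)$ is the set of all $T$-complete vertices of $V\setminus T$. A non-empty set $T\subseteq V$ is interesting if $\overline{G}[T]$ is connected ($\overline{G}$ being the complement of $G$) and $G[C(T)]$ is not a clique (the empty set is regarded as a clique). An even pair of $G$ is a pair $\{x,y\}$ of non-adjacent (distinct) vertices such that every chordless path between $x$ and $y$ has even length. An $(a,b)$-snake is a graph consisting of four vertex-disjoint chordless paths $S_1=a\cdots a'$, $S_2=b\cdots b'$, $S_3=c\cdots c'$, $S_4=d\cdots d'$, where $S_1,S_2$ may have length $0$ (so $a=a'$, resp. $b=b'$, is allowed) but $S_3,S_4$ have length at least $1$, and whose edge-set is $E(S_1)\cup E(S_2)\cup E(S_3)\cup E(S_4)\cup\{a'c,a'd,cd,b'c',b'd',c'd'\}$.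 The snake is proper if at least one of $S_1,S_2$ has length at least $1$. An even pair $\{a,b\}$ of $G$ is special if $G$ contains no proper $(a,b)$-snake (as an induced subgraph with these end-vertices $a,b$). *)

(* Defs.v *)
From mathcomp Require Import all_boot.

Set Implicit Arguments.
Unset Strict Implicit.
Unset Printing Implicit Defensive.

Section Graphs.

(* A simple graph on V is a symmetric irreflexive relation; both properties are
   hypotheses of the main statement and play no role in the definitions. *)
Variables (V : finType) (e : rel V).

Definition compl_graph : rel V := [rel u v | (u != v) && ~~ e u v].

Definition clique (A : {set V}) : Prop :=
  {in A &, forall u v, u != v -> e u v}.

Definition disjoint_union_of_cliques : Prop :=
  exists P : {set {set V}},
    [/\ partition P [set: V],
        (forall A, A \in P -> clique A) &
        (forall A B, A \in P -> B \in P -> A != B ->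
           forall u v, u \in A -> v \in B -> ~~ e u v)].

Definition connected_in (A : {set V}) : Prop :=
  {in A &, forall u v,
     connect [rel x y | [&& x \in A, y \in A & e x y]] u v}.

(* The vertices listed in s are distinct, and f is exactly the adjacency
   relation of the subgraph they induce. *)
Definition induces (s : seq V) (f : rel V) : Prop :=
  uniq s /\ {in s &, e =2 f}.

Definition path_edge (s : seq V) : rel V :=
  [rel u v | ((u, v) \in zip s (behead s)) || ((v, u) \in zip s (behead s))].

Definition cycle_edge (s : seq V) : rel V :=
  [rel u v | (v == next s u) || (u == next s v)].

Definition triangle_edge (x y z : V) : rel V :=
  [rel u v | [&& u \in [:: x; y; z], v \in [:: x; y; z] & u != v]].

(* A path is given by its first vertex x and the list p of the others, so that
   its last vertex is last x p and its length is size p. *)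
Definition chordless_path (x : V) (p : seq V) : Prop :=
  induces (x :: p) (path_edge (x :: p)).

Definition hole (s : seq V) : Prop :=
  4 <= size s /\ induces s (cycle_edge s).

Definition contains_odd_hole : Prop :=
  exists s : seq V, hole s /\ odd (size s).

(* Each path ai :: pi runs from ai in the first triangle to last ai pi in the
   second; pi is non-empty because the triangles are disjoint. *)
Definition contains_prism : Prop :=
  exists (a1 a2 a3 : V) (p1 p2 p3 : seq V),
    [/\ 1 <= size p1, 1 <= size p2, 1 <= size p3 &
        induces ((a1 :: p1) ++ (a2 :: p2) ++ (a3 :: p3))
          [rel u v |
            [|| path_edge (a1 :: p1) u v,
                path_edge (a2 :: p2) u v,
                path_edge (a3 :: p3) u v,
                triangle_edge a1 a2 a3 u v |
                triangle_edge (last a1 p1) (last a2 p2) (last a3 p3) u v]]].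

Definition complete_vertices (T : {set V}) : {set V} :=
  [set v | (v \notin T) && [forall t in T, e v t]].

Definition even_pair (x y : V) : Prop :=
  [/\ x != y, ~~ e x y &
      forall p : seq V,
        chordless_path x p -> last x p = y -> ~~ odd (size p)].

(* The paths are S1 = a :: s1, S2 = b :: s2, S3 = c :: s3, S4 = d :: s4; the six
   edges outside the paths form the triangles a'cd and b'c'd'. *)
Definition contains_proper_snake (a b : V) : Prop :=
  exists (c d : V) (s1 s2 s3 s4 : seq V),
    [/\ 1 <= size s3, 1 <= size s4,
        (1 <= size s1) || (1 <= size s2) &
        induces ((a :: s1) ++ (b :: s2) ++ (c :: s3) ++ (d :: s4))
          [rel u v |
            [|| path_edge (a :: s1) u v,
                path_edge (b :: s2) u v,
                path_edge (c :: s3) u v,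
                path_edge (d :: s4) u v,
                triangle_edge (last a s1) c d u v |
                triangle_edge (last b s2) (last c s3) (last d s4) u v]]].

Definition special_even_pair (a b : V) : Prop :=
  even_pair a b /\ ~ contains_proper_snake a b.

End Graphs.

Definition contains_long_antihole (V : finType) (e : rel V) : Prop :=
  exists s : seq V, hole (compl_graph e) s /\ 5 <= size s.

Definition class_A (V : finType) (e : rel V) : Prop :=
  [/\ ~ contains_odd_hole e, ~ contains_long_antihole e & ~ contains_prism e].

Definition interesting (V : finType) (e : rel V) (T : {set V}) : Prop :=
  [/\ T != set0, connected_in (compl_graph e) T &
      ~ clique e (complete_vertices e T)].

(* Main.v *)
Require Import Defs.
From mathcomp Require Import all_boot zify.
From Stdlib Require Import Classical.

Set Implicit Arguments.
Unset Strict Implicit.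
Unset Printing Implicit Defensive.

(* Choose an anticonnected T whose set C(T) of complete vertices is not a clique, enlarging it
   as long as possible. If no chordless path joins two vertices of C(T) through non-complete vertices,
   the long chordless paths between vertices of C(T) stay in C(T), and induction applies to the
   graph induced on C(T). Otherwise let R be the interior of a shortest such path, with ends r1 and
   r2, and let A and B be the complete vertices whose only neighbour on R is r1, respectively r2.
   The relation saying that a chordless path of odd length from u to B has v in A as its second vertex is a
   strict order on A, and likewise on B; maximal elements a of A and b of B form an even pair,
   and a proper (a,b)-snake would produce an odd hole, an antihole, a prism or a shorter R.
   The parity arguments rest on the Roussel-Rubio lemma: for anticonnected T, a chordless path of length >= 2
   whose only T-complete vertices are its ends has even length. *)

(** Two tools give nearly every contradiction. The first is counting modulo 2: cut a path or a hole
    at its T-complete vertices; by Roussel-Rubio every piece of length at least 2 is even, so the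
    length has the parity of the number of edges with both ends T-complete. The second is a hat: a
    vertex whose only neighbours on a hole are the two ends u, v of an edge of it. A walk from a hat
    that avoids the neighbours of u and v cannot come next to the rest of the hole, for this would
    produce an odd hole or a prism. The path R serves to supply such walks. The obstacle is that a
    chordless path from A to B may meet A or B again on its way; one that does not has even length
    ([odd_attach]). Maximality of T makes A and B cliques, so such a meeting occurs only next to an
    end of the path, and the choice of maximal ends rules it out. Since the induction passes to
    C(T), statements are relative to a vertex set [X], while odd holes, antiholes and prisms are
    excluded from the whole graph. *)

Lemma has_first (T : Type) (a : pred T) s : has a s ->
  exists s1 z s2, [/\ s = s1 ++ z :: s2, a z & ~~ has a s1].
Proof.
elim: s => [|x s IH] //=; case: (boolP (a x)) => [ax _|nax /= /IH [s1 [z [s2 [-> az ns]]]]].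
  by exists [::], x, s.
by exists (x :: s1), z, s2; rewrite /= (negbTE nax).
Qed.

Lemma has_last (T : Type) (a : pred T) s : has a s ->
  exists s1 z s2, [/\ s = s1 ++ z :: s2, a z & ~~ has a s2].
Proof.
rewrite -has_rev => /has_first[s1 [z [s2 [E az ns]]]].
exists (rev s2), z, (rev s1); rewrite has_rev; split=> //.
by rewrite -(revK s) E rev_cat rev_cons -cats1 -catA.
Qed.

(** * Chordless paths and holes as lists *)

Section InducedPaths.

Variables (V : finType) (g : rel V).
Hypotheses (g_sym : symmetric g) (g_irr : irreflexive g).

Implicit Types (x y z u v : V) (s p : seq V).

Definition anti (x y : V) := (x != y) && ~~ g x y.

Lemma anti_sym : symmetric anti.
Proof. by move=> x y; rewrite /anti eq_sym g_sym. Qed.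

Definition anti_seq (s1 s2 : seq V) := allrel anti s1 s2.

Lemma anti_seqC s1 s2 : anti_seq s1 s2 = anti_seq s2 s1.
Proof. by rewrite /anti_seq allrelC; apply: eq_allrel => x y; rewrite anti_sym. Qed.

Lemma anti_seqP s1 s2 :
  reflect (forall x y, x \in s1 -> y \in s2 -> anti x y) (anti_seq s1 s2).
Proof.
apply: (iffP allrelP) => H x y; exact: H.
Qed.

(** Boolean form of [chordless_path] (see [chordless_pathP]). Each vertex is compared with the later
    ones only, so that cutting and gluing become rewriting. *)
Fixpoint ipath (s : seq V) : bool :=
  if s is x :: s' then
    (if s' is y :: s'' then g x y && all (anti x) s'' else true) && ipath s'
  else true.

Lemma ipath_cons x y s :
  ipath (x :: y :: s) = [&& g x y, all (anti x) s & ipath (y :: s)].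
Proof. exact: esym (andbA _ _ _). Qed.

Lemma g_neq x y : g x y -> x != y.
Proof. by move=> gxy; apply/eqP => E; rewrite E g_irr in gxy. Qed.

Lemma ipath_uniq s : ipath s -> uniq s.
Proof.
elim: s => [|x [|y s] IH] //; rewrite ipath_cons => /and3P[gxy /allP ax /IH /= ->].
rewrite andbT inE negb_or g_neq //=.
by apply/negP => /ax; rewrite /anti eqxx.
Qed.

Lemma ipath_behead x s : ipath (x :: s) -> ipath s.
Proof. by case: s => [|y s] //; rewrite ipath_cons => /and3P[]. Qed.

Lemma ipath_cat s1 x y s2 :
  ipath (rcons s1 x ++ y :: s2) =
    [&& ipath (rcons s1 x), ipath (y :: s2), g x y, all (anti x) s2
      & anti_seq s1 (y :: s2)].
Proof.
rewrite /anti_seq; elim: s1 => [|z s1 IH].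
  rewrite allrel0l andbT -[rcons _ _ ++ _]/(x :: y :: s2) ipath_cons.
  rewrite -[ipath (rcons _ _)]/true.
  by move: (g x y) (all _ _) (ipath _) => [] [] [].
rewrite allrel_consl rcons_cons cat_cons.
case: s1 IH => [|w s1] IH.
  rewrite -[rcons [::] x ++ _]/(x :: y :: s2) ipath_cons.
  rewrite (IH : ipath (x :: y :: s2) = _) allrel0l -[ipath (rcons _ _)]/true.
  rewrite -[rcons _ _]/[:: x] ipath_cons -[ipath [:: _]]/true -[all _ [::]]/true.
  move: (g z x) (g x y) (all _ _) (all _ _) (ipath _) => a b c d f.
  by rewrite !andbT /=; move: a b c d f => [] [] [] [] [].
rewrite !rcons_cons !cat_cons !ipath_cons.
rewrite (IH : ipath (w :: (rcons s1 x ++ y :: s2)) = _) all_cat.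
rewrite -[ipath (rcons (w :: s1) x)]/(ipath (w :: rcons s1 x)).
move: (ipath (w :: rcons s1 x)) (ipath (y :: s2)) (allrel _ _ _) (all (anti z) (rcons s1 x))
   (all (anti z) (y :: s2)) (all (anti x) s2) (g z w) (g x y).
by move=> [] [] [] [] [] [] [] [].
Qed.

Lemma ipath_rev s : ipath (rev s) = ipath s.
Proof.
elim: s => [|x [|y s] IH] //.
rewrite ipath_cons -IH !rev_cons -cats1.
rewrite (ipath_cat _ _ _ [::]) g_sym anti_seqC /anti_seq allrel1l all_rev.
rewrite -[ipath [:: x]]/true -[all _ [::]]/true /=.
by move: (g x y) (all _ _) (ipath _) => [] [] [].
Qed.

Lemma ipath_rev_ends x m y : ipath (y :: rcons (rev m) x) = ipath (x :: rcons m y).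
Proof. by rewrite -ipath_rev rev_cons rev_rcons revK. Qed.

Lemma ipath_catl s1 s2 : ipath (s1 ++ s2) -> ipath s1.
Proof.
case/lastP: s1 => [|s1 x] //; case: s2 => [|y s2]; first by rewrite cats0.
by rewrite ipath_cat => /and5P[].
Qed.

Lemma ipath_catr s1 s2 : ipath (s1 ++ s2) -> ipath s2.
Proof. by elim: s1 => [|x s1 IH] // /ipath_behead/IH. Qed.

Lemma ipath_infix s1 s s2 : ipath (s1 ++ s ++ s2) -> ipath s.
Proof. by move/ipath_catr/ipath_catl. Qed.

(** Vertices on different sides of [z] are never consecutive. *)
Lemma ipath_cat_anti s1 s2 z : ipath (s1 ++ z :: s2) -> anti_seq s1 s2.
Proof.
rewrite -cat_rcons => H; apply/anti_seqP => x y xs ys.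
case/splitPr: ys H => s3 s4.
case/splitPr: xs => s5 s6.
rewrite rcons_cat -catA => /ipath_catr; rewrite rcons_cons.
elim: s6 => [|w s6 _].
  rewrite [rcons _ _]/= [_ ++ _]/= ipath_cons => /and3P[_ /allP H _]; apply: H.
  by rewrite mem_cat inE eqxx orbT.
rewrite rcons_cons !cat_cons ipath_cons => /and3P[_ /allP H _]; apply: H.
by rewrite !mem_cat inE eqxx !orbT.
Qed.

Lemma path_edge_cons x y s u v : path_edge (x :: y :: s) u v =
  [|| (u == x) && (v == y), (v == x) && (u == y) | path_edge (y :: s) u v].
Proof.
rewrite /path_edge /= !inE !xpair_eqE.
by move: (u == x) (v == y) (v == x) (u == y) (_ \in _) (_ \in _) => [] [] [] [] [] [].
Qed.

Lemma path_edge_mem s u v : path_edge s u v -> (u \in s) && (v \in s).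
Proof.
elim: s => [|x [|y s] IH] //; rewrite path_edge_cons.
case/or3P=> [/andP[/eqP-> /eqP->]|/andP[/eqP-> /eqP->]|/IH/andP[us vs]].
- by rewrite !inE !eqxx ?orbT.
- by rewrite !inE !eqxx ?orbT.
by rewrite inE us inE vs !orbT.
Qed.

Lemma path_edge_sym s : symmetric (path_edge s).
Proof. by move=> u v; rewrite /path_edge /= orbC. Qed.

Lemma ipath_path_edge s : ipath s -> {in s &, g =2 path_edge s}.
Proof.
elim: s => [|x [|y s] IH] // ip u v us vs.
  by move: us vs; rewrite !inE => /eqP-> /eqP->; rewrite g_irr.
have /= /andP[xs _] := ipath_uniq ip.
move: ip; rewrite ipath_cons => /and3P[gxy /allP ax ip].
have E w : w \in y :: s -> g x w = path_edge [:: x, y & s] x w.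
  rewrite path_edge_cons eqxx /= => ws.
  have -> : w == x = false by apply: contraNF xs => /eqP<-.
  have -> : path_edge (y :: s) x w = false.
    by apply: contraNF xs => /path_edge_mem/andP[].
  rewrite /= orbF; case: eqVneq ws => [->//|wy]; rewrite inE (negbTE wy) => /ax.
  by case/andP=> _ /negbTE.
move: us vs; rewrite [u \in _]inE [v \in _]inE.
case/predU1P=> [->|us] /predU1P[->|vs].
- rewrite g_irr path_edge_cons eqxx /=.
  have -> : path_edge (y :: s) x x = false.
    by apply: contraNF xs => /path_edge_mem/andP[].
  by have /negbTE-> := g_neq gxy.
- exact: E.
- by rewrite g_sym path_edge_sym E.
rewrite (IH ip) // path_edge_cons.
have -> : u == x = false by apply: contraNF xs => /eqP<-.
by have -> : v == x = false by apply: contraNF xs => /eqP<-.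
Qed.

Lemma chordless_pathP x p : ipath (x :: p) <-> chordless_path g x p.
Proof.
split=> [ip|[us E]].
  by split; [exact: ipath_uniq|exact: ipath_path_edge].
elim: p x us E => [|y s IH] x //= /andP[xs us] E.
rewrite -/(ipath (y :: s)) IH ?andbT //; last first.
  move=> u v us' vs'.
  rewrite (E u v (mem_behead (s := x :: y :: s) us') (mem_behead (s := x :: y :: s) vs')).
  rewrite path_edge_cons.
  have -> : u == x = false by apply: contraNF xs => /eqP<-.
  by have -> : v == x = false by apply: contraNF xs => /eqP<-.
have xm : x \in x :: y :: s by rewrite inE eqxx.
have sm w : w \in y :: s -> w \in x :: y :: s by move=> ws; rewrite inE ws orbT.
apply/andP; split.
  by rewrite (E x y xm (sm _ (mem_head _ _))) path_edge_cons !eqxx.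
apply/allP=> w ws; have xw : x != w.
  by apply: contraNneq xs => ->; rewrite inE ws orbT.
have wm : w \in y :: s by rewrite inE ws orbT.
rewrite /anti xw (E x w xm (sm _ wm)) path_edge_cons eqxx (eq_sym w x) (negbTE xw) /=.
have -> : path_edge (y :: s) x w = false.
  by apply: contraNF xs => /path_edge_mem/andP[].
by rewrite orbF; apply: contraNneq (proj1 (andP us)) => <-.
Qed.

(* Whether u and v are adjacent is left open: u s v is a chordless path or a hole. *)
Definition apath u s v := [&& ipath (u :: s), ipath (rcons s v) & u != v].

(** Expresses the cyclic successor through a list of consecutive pairs, as in [path_edge]; a cycle
    is then a path with one more pair. *)
Lemma next_at_zip y0 y p x z : uniq (y :: p) -> x \in y :: p ->
  (z == next_at x y0 y p) = ((x, z) \in zip (y :: p) (rcons p y0)).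
Proof.
elim: p y => [|w p IH] y /=.
  by move=> _; rewrite !inE xpair_eqE => /eqP->; rewrite eqxx.
case/andP=> yp up; rewrite inE => xp; rewrite inE xpair_eqE.
have notin b q1 : (y, z) \in zip q1 b -> y \in q1.
  elim: q1 b => [|c q1 IH1] [|d b] //=; rewrite !inE xpair_eqE.
  by case/orP=> [/andP[->]//|/IH1->]; rewrite orbT.
case: eqVneq xp => [-> _|xy /= xp]; rewrite ?eqxx /=.
  by rewrite [(y, z) \in _](contraNF (@notin _ _) yp) orbF.
by rewrite IH.
Qed.

Lemma zip_last (y z : V) (q : seq V) :
  zip (y :: q) (rcons q z) = rcons (zip (y :: q) q) (last y q, z).
Proof. by elim: q y => [|w q IH] y //=; rewrite -IH. Qed.

Lemma apath_rev u s v : apath u s v = apath v (rev s) u.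
Proof.
rewrite /apath -[ipath (u :: s)]ipath_rev -[ipath (rcons s v)]ipath_rev.
by rewrite rev_cons rev_rcons [u == v]eq_sym andbCA.
Qed.

Lemma cycle_edge_rcons u s v x y : uniq (u :: rcons s v) ->
  x \in u :: rcons s v -> y \in u :: rcons s v ->
  cycle_edge (u :: rcons s v) x y =
  [|| path_edge (u :: rcons s v) x y, (x == u) && (y == v) | (x == v) && (y == u)].
Proof.
move=> us xs ys; rewrite /cycle_edge [in LHS]/= !next_at_zip //.
rewrite zip_last last_rcons !mem_rcons !inE !xpair_eqE /path_edge /=.
rewrite [(y == v) && (x == u)]andbC.
by move: (_ && _) (_ \in _) (_ && _) (_ \in _) => [] [] [] [].
Qed.

Lemma apath_uniq u s v : apath u s v -> uniq (u :: rcons s v).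
Proof.
case/and3P=> /ipath_uniq /= /andP[us _] /ipath_uniq sv uv.
by rewrite mem_rcons inE negb_or uv us.
Qed.

Lemma path_edge_rcons s x z u v : path_edge (rcons (rcons s x) z) u v =
  [|| (u == x) && (v == z), (v == x) && (u == z) | path_edge (rcons s x) u v].
Proof.
elim: s => [|y s IH]; first exact: path_edge_cons.
case: s IH => [|w s] IH.
  rewrite -[rcons (rcons [:: y] x) z]/[:: y; x; z] -[rcons _ x]/[:: y; x].
  rewrite !path_edge_cons -!/(path_edge [:: _] u v).
  have E t : path_edge [:: t] u v = false by [].
  by rewrite !E; move: (_ && _) (_ && _) (_ && _) (_ && _) => [] [] [] [].
rewrite !rcons_cons !path_edge_cons.
rewrite -!rcons_cons IH rcons_cons.
by move: (_ && _) (_ && _) (_ && _) (_ && _) (path_edge _ _ _) => [] [] [] [] [].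
Qed.

Lemma path_edge_notin s x y : x \notin s -> path_edge s x y = false.
Proof. by apply: contraNF => /path_edge_mem/andP[]. Qed.

Lemma path_edge_ends u s v x y : uniq (u :: rcons s v) -> s != [::] ->
  [/\ {in u :: s &, path_edge (u :: rcons s v) =2 path_edge (u :: s)},
      {in rcons s v &, path_edge (u :: rcons s v) =2 path_edge (rcons s v)} &
      path_edge (u :: rcons s v) u v = false].
Proof.
case: s => [|w s] // us _.
have uns : u \notin rcons (w :: s) v by case/andP: us.
have vns : v \notin u :: w :: s.
  by move: us; rewrite -rcons_cons rcons_uniq => /andP[].
have ins (a b : V) (l : seq V) : a \in l -> b \notin l -> (a == b) = false :> bool.
  by move=> al bl; apply: contraNF bl => /eqP<-.
split=> [a b al bl|a b al bl|].
- rewrite -rcons_cons lastI path_edge_rcons -lastI.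
  by rewrite (ins b v _ bl) // (ins a v _ al) // !andbF.
- by rewrite rcons_cons path_edge_cons (ins a u _ al) // (ins b u _ bl).
rewrite rcons_cons path_edge_cons eqxx /= -rcons_cons path_edge_notin // orbF.
have /negbTE-> : v != w by apply: contraNneq vns => ->; rewrite !inE eqxx orbT.
by have /negbTE-> : v != u by apply: contraNneq vns => ->; rewrite !inE eqxx.
Qed.

(** The overlapping paths [u s] and [s v] decide every pair except [u], [v]; these are not
    consecutive because [s] is non-empty. *)
Lemma apath_edge u s v : apath u s v -> s != [::] -> {in u :: rcons s v &, forall x y, g x y =
  [|| path_edge (u :: rcons s v) x y,
      g u v && (x == u) && (y == v) | g u v && (x == v) && (y == u)]}.
Proof.
move=> ap s0; have uu := apath_uniq ap; have [us sv uv] := and3P ap.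
have [E1 E2 E3] := path_edge_ends u v uu s0.
have uns : u \notin rcons s v by case/andP: uu.
have vns : v \notin u :: s.
  by move: uu; rewrite -rcons_cons rcons_uniq => /andP[].
have ins (a b : V) (l : seq V) : a \in l -> b \notin l -> (a == b) = false :> bool.
  by move=> al bl; apply: contraNF bl => /eqP<-.
have H x y : x \in u :: s -> y \in u :: s -> g x y = 
   [|| path_edge (u :: rcons s v) x y,
      g u v && (x == u) && (y == v) | g u v && (x == v) && (y == u)].
  move=> xs ys; rewrite E1 // -ipath_path_edge //.
  by rewrite (ins x v _ xs) // (ins y v _ ys) // !andbF !orbF.
have split_mem x : x \in u :: rcons s v -> x \in u :: s \/ x = v.
  rewrite -rcons_cons mem_rcons inE => /predU1P[->|]; [by right|by left].
have ev : (v == u) = false by rewrite eq_sym (negbTE uv).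
have L x : x \in u :: s -> x != u -> g x v = path_edge (u :: rcons s v) x v.
  rewrite inE => /predU1P[->|xs] xu; first by rewrite eqxx in xu.
  by rewrite E2 ?mem_rcons ?inE ?xs ?eqxx ?orbT // -ipath_path_edge // mem_rcons inE ?xs ?eqxx ?orbT.
move=> x y /split_mem[xs|->] /split_mem[ys|->].
- exact: H.
- rewrite eqxx ev !andbT !andbF orbF; case: (eqVneq x u) => [->|xu].
    by rewrite E3 andbT.
  by rewrite andbF orbF L.
- rewrite eqxx ev !andbT !andbF /= g_sym path_edge_sym; case: (eqVneq y u) => [->|yu].
    by rewrite E3 andbT.
  by rewrite andbF orbF L.
by rewrite g_irr ev !andbF E2 ?mem_rcons ?inE ?eqxx // -ipath_path_edge ?mem_rcons ?inE ?eqxx ?g_irr.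
Qed.

Lemma hole_apath u s v : apath u s v -> g u v -> 2 <= size s ->
  hole g (u :: rcons s v).
Proof.
move=> ap guv s2; have us := apath_uniq ap.
split; first by rewrite /= size_rcons.
have s0 : s != [::] by case: s s2 {ap us}.
by split=> // x y xs ys; rewrite cycle_edge_rcons // (apath_edge ap s0 xs ys) guv.
Qed.

Lemma apath_ipath u s v : apath u s v -> s != [::] -> ~~ g u v -> ipath (u :: rcons s v).
Proof.
move=> ap s0 guv; apply/chordless_pathP; split; first exact: apath_uniq.
by move=> x y xs ys; rewrite (apath_edge ap s0 xs ys) (negbTE guv) !orbF.
Qed.

(** Lets a hole be opened at any of its edges. *)
Lemma hole_rot n c : hole g c -> hole g (rot n c).
Proof.
case=> sc [uc E]; split; first by rewrite size_rot.
split; first by rewrite rot_uniq.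
move=> x y; rewrite !mem_rot => xc yc.
by rewrite E // /cycle_edge /= !next_rot.
Qed.

Lemma apath_hole u s v : hole g (u :: rcons s v) -> [/\ apath u s v, g u v & 2 <= size s].
Proof.
case; rewrite /= size_rcons => s4 [us E].
have s2 : 2 <= size s by [].
have s0 : s != [::] by case: s s2 {us E s4}.
have [E1 E2 E3] := path_edge_ends u v us s0.
have uv : u != v.
  by move: us; rewrite /= mem_rcons inE negb_or => /andP[/andP[]].
have uns : u \notin rcons s v by case/andP: us.
have vns : v \notin u :: s.
  by move: us; rewrite -rcons_cons rcons_uniq => /andP[].
have ins (a b : V) (l : seq V) : a \in l -> b \notin l -> (a == b) = false :> bool.
  by move=> al bl; apply: contraNF bl => /eqP<-.
have M x : x \in u :: s -> x \in u :: rcons s v.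
  by rewrite !inE mem_rcons inE => /orP[|] -> //; rewrite !orbT.
split=> //; last by rewrite E ?cycle_edge_rcons ?inE ?mem_rcons ?inE ?eqxx ?orbT.
apply/and3P; split=> //.
  apply/chordless_pathP; split.
    by move: us; rewrite -rcons_cons rcons_uniq => /andP[].
  move=> x y xs ys; rewrite E ?M // cycle_edge_rcons ?M // E1 //.
  by rewrite (ins x v _ xs) // (ins y v _ ys) // !andbF !orbF.
case: s {M s4 s2 s0 E1 E3 vns} us E uns E2 => [|w s] us E uns E2; first by [].
apply/chordless_pathP; split; first by case/andP: us.
move=> x y xs ys; have [xu yu] : x \in [:: u, w & rcons s v] /\ y \in [:: u, w & rcons s v].
  by rewrite inE xs orbT inE ys orbT.
rewrite E ?cycle_edge_rcons // E2 //.
by rewrite (ins x u _ xs) // (ins y u _ ys) // !andbF !orbF.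
Qed.

Lemma ipath_head_adj x s z : ipath (x :: s) -> z \in s -> g x z -> exists s', s = z :: s'.
Proof.
case: s => [|y s] //; rewrite ipath_cons inE => /and3P[_ /allP ax _] /predU1P[->|/ax].
  by exists s.
by case/andP=> _ /negbTE->.
Qed.

Lemma ipath_last_adj x s z : ipath (rcons s x) -> z \in s -> g x z -> exists s', s = rcons s' z.
Proof.
rewrite -ipath_rev rev_rcons -mem_rev => ip zs xz.
have [s' E] := ipath_head_adj ip zs xz.
by exists (rev s'); rewrite -(revK s) E rev_cons.
Qed.

(** A common neighbour of both ends would be the first and the last vertex of [s] at once. *)
Lemma ipath_ends x s y z : 2 <= size s -> ipath (x :: s) -> ipath (rcons s y) -> z \in s ->
  ~~ (g x z && g y z).
Proof.
move=> s2 xs sy zs; apply/negP => /andP[xz yz].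
have [s1 E1] := ipath_head_adj xs zs xz; have [s3 E2] := ipath_last_adj sy zs yz.
have := ipath_uniq (ipath_behead xs); case: s3 E2 => [|w s3] E2; first by rewrite E2 in s2.
by rewrite E2; move: E2; rewrite E1 => -[-> _]; rewrite /= mem_rcons inE eqxx.
Qed.

Lemma ipath_consI x y s : ipath (y :: s) -> g x y -> all (anti x) s -> ipath (x :: y :: s).
Proof. by move=> ip gxy a; rewrite ipath_cons gxy a ip. Qed.

Lemma ipath_rcons x y s :
  ipath (rcons (rcons s y) x) = [&& g x y, all (anti x) s & ipath (rcons s y)].
Proof.
by rewrite -ipath_rev !rev_rcons ipath_cons all_rev -rev_rcons ipath_rev.
Qed.

Lemma ipath_ends2 x k1 m k2 y : ipath (x :: k1 :: rcons (rcons m k2) y) =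
  [&& g x k1, all (anti x) (rcons m k2), anti x y, g y k2, all (anti y) (k1 :: m)
    & ipath (k1 :: rcons m k2)].
Proof.
rewrite ipath_cons -!rcons_cons ipath_rcons rcons_cons all_rcons.
by move: (g _ _) (anti x y) (all _ _) => [] [] [].
Qed.

Lemma ipath_rconsI x y s : ipath (rcons s y) -> g x y -> all (anti x) s -> ipath (rcons (rcons s y) x).
Proof.
by move=> ip gxy a; rewrite -ipath_rev !rev_rcons ipath_consI ?all_rev // -rev_rcons ipath_rev.
Qed.

(* Shortcut the walk at the last neighbour of each new vertex. *)
Lemma walk_ipath x p : path g x p ->
  exists p', [/\ ipath (x :: p'), last x p' = last x p & {subset x :: p' <= x :: p}].
Proof.
elim: p x => [|y p IH] x; first by move=> _; exists [::]; split.
move=> /= /andP[gxy /IH[q [ip lq sq]]].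
case: (boolP (x \in y :: q)) => [xq|xq].
  case/splitPr def_q : _ / xq ip => [q1 q2] ip.
  exists q2; split; first exact: ipath_catr ip.
    by rewrite [RHS]/= -lq -[last y q]/(last x (y :: q)) def_q last_cat.
  move=> z; move=> zq; rewrite inE; apply/orP; right; apply: sq; rewrite def_q.
  by rewrite mem_cat zq orbT.
have hq : has (g x) (y :: q) by rewrite /= gxy.
have [q1 [z [q2 [def_q xz nq]]]] := has_last hq.
exists (z :: q2); split.
- apply: ipath_consI => //; first by apply: (@ipath_catr q1); rewrite -def_q.
  apply/allP => w wq; apply/andP; split.
    by apply/eqP => xw; rewrite xw def_q mem_cat inE wq !orbT in xq.
  by apply: contraNN nq => xw; apply/hasP; exists w.
- by rewrite [RHS]/= -lq -[last y q]/(last x (y :: q)) def_q last_cat.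
move=> w; rewrite inE => /predU1P[->|wq]; first by rewrite inE eqxx.
by rewrite inE; apply/orP; right; apply: sq; rewrite def_q mem_cat wq orbT.
Qed.

Lemma walk_rcons_ipath x p y : path g x (rcons p y) -> x != y ->
  exists p', ipath (x :: rcons p' y) /\ {subset p' <= p}.
Proof.
move=> /walk_ipath[q [ip]]; rewrite last_rcons => lq sq xy.
case/lastP: q ip lq sq => [|q w] ip; first by move/eqP; rewrite (negbTE xy).
rewrite last_rcons => wy sq; rewrite wy in ip sq; exists q; split=> // z zq.
have := ipath_uniq ip; rewrite /= rcons_uniq mem_rcons inE negb_or.
case/andP=> /andP[_ xq] /andP[yq _].
have : z \in x :: rcons p y by apply: sq; rewrite !inE mem_rcons inE zq !orbT.
rewrite inE mem_rcons inE => /or3P[/eqP zx|/eqP zy|//].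
  by rewrite -zx zq in xq.
by rewrite -zy zq in yq.
Qed.

Lemma ipath_glue s1 y s2 : ipath (rcons s1 y) -> ipath (y :: s2) -> anti_seq s1 s2 ->
  ipath (rcons s1 y ++ s2).
Proof.
case: s2 => [|z s2]; first by rewrite cats0.
by move=> i1; rewrite ipath_cons ipath_cat i1 => /and3P[-> -> ->] ->.
Qed.

(** The hole is opened at the edge from [x] to the first vertex of [r]. That [x] and [y] are
    non-adjacent follows from chordlessness and non-empty interiors. *)
Lemma hole_two_paths x m y r : ipath (x :: rcons m y) -> ipath (x :: rcons r y) ->
  anti_seq m r -> m != [::] -> r != [::] -> hole g (x :: m ++ y :: rev r).
Proof.
case: r => [|r0 r] // ipm ipr /anti_seqP amr m0 _.
rewrite rev_cons -rcons_cons -rcons_cat.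
have iyr : ipath (y :: rev (r0 :: r)).
  by move/ipath_behead: ipr; rewrite -ipath_rev rev_rcons.
apply: hole_apath.
- apply/and3P; split.
  + rewrite -cat_rcons -cat_cons -rcons_cons; apply: ipath_glue => //.
      by move: iyr; rewrite rev_cons -rcons_cons -cats1 => /ipath_catl.
    move: ipr; rewrite rcons_cons ipath_cons => /and3P[_ /allP ax _].
    apply/anti_seqP => a b; rewrite mem_rev inE => /predU1P[->|am] br.
      by apply: ax; rewrite mem_rcons inE br orbT.
    by apply: amr; rewrite // inE br orbT.
  + rewrite rcons_cat rcons_cons -rev_cons -cat_rcons; apply: ipath_glue => //.
      exact: ipath_behead ipm.
    by apply/anti_seqP => a b am; rewrite mem_rev; apply: amr.
  by move/ipath_uniq: ipr => /= /andP[]; rewrite !inE negb_or => /andP[].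
- by move: ipr; rewrite rcons_cons ipath_cons => /and3P[].
by rewrite size_cat /= addnS ltnS addn_gt0; case: (m) m0.
Qed.

End InducedPaths.

Arguments ipath {V} g s : simpl never.

(** * Sums modulo 2 of edge labels along a path *)

Section EdgeParity.

Variable V : eqType.
Implicit Types (w : V -> V -> bool) (c : pred V).

(** The sum modulo 2 of [w] over the consecutive pairs of [x :: p]. The constant label gives the
    parity of the length, [both c] that of the number of edges with both ends marked. *)
Fixpoint par w (x : V) (p : seq V) : bool :=
  if p is y :: p' then w x y (+) par w y p' else false.

Lemma par_cat w x p1 p2 : par w x (p1 ++ p2) = par w x p1 (+) par w (last x p1) p2.
Proof. by elim: p1 x => [|y p1 IH] x //=; rewrite IH addbA. Qed.

Lemma par_true x p : par (fun _ _ => true) x p = odd (size p).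
Proof. by elim: p x => [|y p IH] x //=; rewrite IH. Qed.

Lemma par_addb w1 w2 x p :
  par (fun a b => w1 a b (+) w2 a b) x p = par w1 x p (+) par w2 x p.
Proof.
elim: p x => [|y p IH] x //=; rewrite IH.
by move: (w1 x y) (w2 x y) (par w1 y p) (par w2 y p) => [] [] [] [].
Qed.

Definition both c := fun x y : V => c x && c y.

Lemma par_both0 c x p : ~~ has c p -> par (both c) x p = false.
Proof.
elim: p x => [|y p IH] x //=; rewrite negb_or => /andP[/negbTE cy /IH->].
by rewrite /both cy andbF.
Qed.

Lemma par_edge w x p : par w x p -> exists l1 u v l2, x :: p = l1 ++ u :: v :: l2 /\ w u v.
Proof.
elim: p x => [|y p IH] x //=; case: (boolP (w x y)) => [wxy _|_ /= /IH[l1 [u [v [l2 [-> wuv]]]]]].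
  by exists [::], x, y, p.
by exists (x :: l1), u, v, l2.
Qed.

(** No marked edge meets the unmarked stretch [p], and being non-empty it separates [x] from [y]. *)
Lemma par_skip c x p y p' : ~~ has c p -> p != [::] -> par (both c) x (p ++ y :: p') = par (both c) y p'.
Proof.
case/lastP: p => [|p z] // np _; rewrite cat_rcons par_cat.
move: np; rewrite has_rcons negb_or => /andP[/negbTE nz np].
by rewrite par_both0 //= /both nz andbF.
Qed.

(** The sum over the path is the sum over the segments between consecutive marked vertices. *)
Lemma par_segments w c x p :
  (forall l x' m y' r, x :: p = l ++ x' :: m ++ y' :: r -> c x' -> c y' ->
     ~~ has c m -> par w x' (rcons m y') = false) ->
  c x -> c (last x p) -> par w x p = false.
Proof.
elim: {p}_.+1 {-2}p x (ltnSn (size p)) => [|n IH] // p x; rewrite ltnS => sp H cx cl.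
case: p sp H cl => [|y p] // sp H cl.
have hc : has c (y :: p) by apply/hasP; exists (last y p); rewrite ?mem_last.
have [m [z [r [E cz nm]]]] := has_first hc.
rewrite E in sp H cl *; rewrite -cat_rcons par_cat last_rcons (H [::] x m z r) //=.
apply: IH => //; first by move: sp; rewrite size_cat /=; lia.
  by move=> l x' m' y' r' E' ? ? ?; apply: (H (x :: m ++ l) x' m' y' r') => //; rewrite E' /= -catA.
by move: cl; rewrite last_cat.
Qed.

End EdgeParity.

(** * The excluded holes, antiholes and prisms *)

Section ClassA.

Variables (V : finType) (e : rel V).
Hypotheses (e_sym : symmetric e) (e_irr : irreflexive e) (GA : class_A e).

Local Notation far := (anti e).
Local Notation cipath := (ipath far).
Local Notation capath := (apath far).
Local Notation ipath := (ipath e).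
Local Notation apath := (apath e).

Lemma apath_even u s v : apath u s v -> e u v -> 2 <= size s -> ~~ odd (size s).
Proof.
move=> ap uv s2; apply/negP => os; case: GA => + _ _; apply.
exists (u :: rcons s v); split; first exact: hole_apath.
by rewrite /= size_rcons /= negbK.
Qed.

Lemma two_paths_parity x m y r : ipath (x :: rcons m y) -> ipath (x :: rcons r y) ->
  anti_seq e m r -> m != [::] -> r != [::] -> odd (size m) = odd (size r).
Proof.
move=> i1 i2 a m0 r0; have H := hole_two_paths e_sym e_irr i1 i2 a m0 r0.
case: GA => O _ _; apply/eqP/negPn/negP => ne; case: O.
exists (x :: m ++ y :: rev r); split=> //; move: ne.
by rewrite /= size_cat /= size_rev addnS /= negbK oddD; move: (odd (size m)) (odd (size r)) => [] [].
Qed.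

Lemma far_sym : symmetric far. Proof. exact: anti_sym. Qed.

Lemma far_irr : irreflexive far.
Proof. by move=> x; rewrite /anti eqxx. Qed.

Lemma far_far x y : anti far x y = e x y.
Proof.
rewrite /anti negb_and !negbK; case: eqVneq => [->|] //=; by rewrite e_irr.
Qed.

Lemma no_antihole u s v : capath u s v -> far u v -> 3 <= size s -> False.
Proof.
move=> ap uv s3; case: GA => _ + _; apply.
exists (u :: rcons s v); split; last by rewrite /= size_rcons.
apply: (hole_apath far_sym far_irr ap uv); exact: leq_trans s3.
Qed.

Definition joined (P Q : seq V) (R : rel V) := forall x y, x \in P -> y \in Q -> x != y /\ e x y = R x y.

Lemma uniq_cat_joined P Q R : uniq P -> uniq Q -> joined P Q R -> uniq (P ++ Q).
Proof.
move=> uP uQ j; rewrite cat_uniq uP uQ andbT /=; apply/hasPn => y yQ.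
by apply/negP => yP; case: (j y y yP yQ); rewrite eqxx.
Qed.

Lemma joined_notin P Q R x : joined P Q R -> x \in P -> x \notin Q.
Proof. by move=> j xP; apply/negP => xQ; case: (j x x xP xQ); rewrite eqxx. Qed.

Lemma joined_notin2 P Q R x : joined P Q R -> x \in Q -> x \notin P.
Proof. by move=> j xQ; apply/negP => xP; case: (j x x xP xQ); rewrite eqxx. Qed.

Lemma triangle_edge_sym (a b c : V) : symmetric (triangle_edge a b c).
Proof. by move=> u v; rewrite /triangle_edge /= eq_sym andbCA. Qed.

Lemma triangle_edge1 (P : seq V) (a b c u v : V) : b \notin P -> c \notin P -> u \in P -> v \in P ->
  triangle_edge a b c u v = false.
Proof.
move=> bP cP uP vP; have ne w x : w \in P -> x \notin P -> (w == x) = false.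
  by move=> wP; apply: contraNF => /eqP<-.
rewrite /triangle_edge /= !inE (ne u b) // (ne u c) // (ne v b) // (ne v c) // !orbF.
by case: eqP => //= ->; case: eqP => //= ->; rewrite eqxx.
Qed.

Lemma triangle_edge2 (P Q : seq V) R (a b c u v : V) : joined P Q R -> a \in P -> b \in Q ->
  c \notin P -> c \notin Q -> u \in P -> v \in Q ->
  triangle_edge a b c u v = (u == a) && (v == b).
Proof.
move=> j aP bQ cP cQ uP vQ; have ne (w x : V) (S : seq V) : w \in S -> x \notin S -> (w == x) = false.
  by move=> wP; apply: contraNF => /eqP<-.
rewrite /triangle_edge /= !inE (ne u b P) ?(joined_notin2 j) // (ne u c P) //.
rewrite (ne v a Q) ?(joined_notin j) // (ne v c Q) // !orbF.
have [uv _] := j u v uP vQ.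
by rewrite uv andbT.
Qed.

Lemma no_prism_joined a1 p1 a2 p2 a3 p3 :
  ipath (a1 :: p1) -> ipath (a2 :: p2) -> ipath (a3 :: p3) ->
  p1 != [::] -> p2 != [::] -> p3 != [::] ->
  joined (a1 :: p1) (a2 :: p2) (fun x y => (x == a1) && (y == a2) || (x == last a1 p1) && (y == last a2 p2)) ->
  joined (a1 :: p1) (a3 :: p3) (fun x y => (x == a1) && (y == a3) || (x == last a1 p1) && (y == last a3 p3)) ->
  joined (a2 :: p2) (a3 :: p3) (fun x y => (x == a2) && (y == a3) || (x == last a2 p2) && (y == last a3 p3)) ->
  False.
Proof.
move=> i1 i2 i3 n1 n2 n3.
have := (mem_head a1 p1, mem_last a1 p1, mem_head a2 p2, mem_last a2 p2, mem_head a3 p3, mem_last a3 p3).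
have pos (p : seq V) : p != [::] -> 0 < size p by case: p.
case: GA => _ _ NP ms j12 j13 j23; apply: NP; exists a1, a2, a3, p1, p2, p3.
split; try exact: pos.
move: (last a1 p1) (last a2 p2) (last a3 p3) i1 i2 i3 ms j12 j13 j23.
move: {n1 n2 n3} (a1 :: p1) (a2 :: p2) (a3 :: p3) => L1 L2 L3 l1 l2 l3 i1 i2 i3.
case=> [[[[[m1 m1'] m2] m2'] m3] m3'] j12 j13 j23.
split.
  have j23' : joined L1 (L2 ++ L3) (fun x y => e x y).
    by move=> x y xL; rewrite mem_cat => /orP[/(j12 _ _ xL)|/(j13 _ _ xL)] [].
  apply: uniq_cat_joined j23'; first exact: ipath_uniq i1.
  by apply: uniq_cat_joined j23; apply: ipath_uniq.
set f := (f in e =2 f).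
have fs : symmetric f.
  move=> u v; rewrite /f /= !(path_edge_sym _ u v).
  by rewrite (triangle_edge_sym a1) (triangle_edge_sym l1).
have N12 x := @joined_notin _ _ _ x j12; have N13 x := @joined_notin _ _ _ x j13.
have N23 x := @joined_notin _ _ _ x j23; have N21 x := @joined_notin2 _ _ _ x j12.
have N31 x := @joined_notin2 _ _ _ x j13; have N32 x := @joined_notin2 _ _ _ x j23.
have pes (S : seq V) (x y : V) : y \notin S -> path_edge S x y = false.
  by move=> yS; rewrite path_edge_sym path_edge_notin.
have tp (a b c u v : V) : triangle_edge a b c u v = triangle_edge b a c u v.
  rewrite /triangle_edge /= !inE; move: (u == a) (u == b) (u == c) (v == a) (v == b) (v == c) (u != v).
  by move=> [] [] [] [] [] [] [].
have tr (a b c u v : V) : triangle_edge a b c u v = triangle_edge b c a u v.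
  rewrite /triangle_edge /= !inE; move: (u == a) (u == b) (u == c) (v == a) (v == b) (v == c) (u != v).
  by move=> [] [] [] [] [] [] [].
have [q1 q2] := (N21 _ m2, N21 _ m2'); have [q3 q4] := (N31 _ m3, N31 _ m3').
have [q5 q6] := (N12 _ m1, N12 _ m1'); have [q7 q8] := (N32 _ m3, N32 _ m3').
have [q9 q10] := (N13 _ m1, N13 _ m1'); have [q11 q12] := (N23 _ m2, N23 _ m2').
have tp1 (a b c u v : V) : triangle_edge a b c u v = triangle_edge a c b u v by rewrite tp tr.
(* Within one path both triangles contribute nothing; between two paths each contributes one edge.
   Six blocks are computed, the other three follow from the symmetry of [f]. *)
have E11 u v : u \in L1 -> v \in L1 -> e u v = f u v.
  move=> uL vL; rewrite /f /= !(@triangle_edge1 L1) // (ipath_path_edge e_sym e_irr i1) //.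
  by rewrite (@path_edge_notin _ L2) ?N12 // (@path_edge_notin _ L3) ?N13 // !orbF.
have E22 u v : u \in L2 -> v \in L2 -> e u v = f u v.
  move=> uL vL; rewrite /f /= tp (tp l1) !(@triangle_edge1 L2) // (ipath_path_edge e_sym e_irr i2) //.
  by rewrite (@path_edge_notin _ L1) ?N21 // (@path_edge_notin _ L3) ?N23 // !orbF.
have E33 u v : u \in L3 -> v \in L3 -> e u v = f u v.
  move=> uL vL; rewrite /f /= -tr -(tr l3) !(@triangle_edge1 L3) // (ipath_path_edge e_sym e_irr i3) //.
  by rewrite (@path_edge_notin _ L1) ?N31 // (@path_edge_notin _ L2) ?N32 // !orbF.
have E12 u v : u \in L1 -> v \in L2 -> e u v = f u v.
  move=> uL vL; rewrite /f /= !(@triangle_edge2 _ _ _ _ _ _ _ _ j12) //.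
  by rewrite (pes L1) ?N21 // (@path_edge_notin _ L2) ?N12 // (@path_edge_notin _ L3) ?N13 //; case: (j12 u v).
have E13 u v : u \in L1 -> v \in L3 -> e u v = f u v.
  move=> uL vL; rewrite /f /= (tp1 a1) (tp1 l1) !(@triangle_edge2 _ _ _ _ _ _ _ _ j13) //.
  by rewrite (pes L1) ?N31 // (@path_edge_notin _ L2) ?N12 // (@path_edge_notin _ L3) ?N13 //; case: (j13 u v).
have E23 u v : u \in L2 -> v \in L3 -> e u v = f u v.
  move=> uL vL; rewrite /f /= tr (tr l1) !(@triangle_edge2 _ _ _ _ _ _ _ _ j23) //.
  by rewrite (@path_edge_notin _ L1) ?N21 // (pes L2) ?N32 // (@path_edge_notin _ L3) ?N23 //; case: (j23 u v).
move=> u v; rewrite !mem_cat => /or3P[] uL /or3P[] vL.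
- exact: E11.
- exact: E12.
- exact: E13.
- rewrite e_sym (E12 v u) //; exact: fs.
- exact: E22.
- exact: E23.
- rewrite e_sym (E13 v u) //; exact: fs.
- rewrite e_sym (E23 v u) //; exact: fs.
exact: E33.
Qed.

(** The disjunctive form of [joined], which is what a case analysis on positions produces. *)
Definition linked (P Q : seq V) (a b a' b' : V) := forall x y, x \in P -> y \in Q ->
  [\/ far x y, x = a /\ y = b | x = a' /\ y = b'].

Lemma linked_joined P Q a b a' b' : e a b -> e a' b' -> linked P Q a b a' b' ->
  joined P Q (fun x y => (x == a) && (y == b) || (x == a') && (y == b')).
Proof.
move=> ab ab' L x y xP yQ; case: (L x y xP yQ) => [/andP[xy nxy]|[-> ->]|[-> ->]].
- split=> //; rewrite (negbTE nxy); symmetry; apply: contraNF nxy.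
  by case/orP=> /andP[/eqP-> /eqP->].
- by rewrite !eqxx ab; split=> //; apply: contraTneq ab => ->; rewrite e_irr.
by rewrite !eqxx ab' orbT; split=> //; apply: contraTneq ab' => ->; rewrite e_irr.
Qed.

Lemma no_prism a1 p1 a2 p2 a3 p3 :
  ipath (a1 :: p1) -> ipath (a2 :: p2) -> ipath (a3 :: p3) ->
  p1 != [::] -> p2 != [::] -> p3 != [::] ->
  e a1 a2 -> e a1 a3 -> e a2 a3 ->
  e (last a1 p1) (last a2 p2) -> e (last a1 p1) (last a3 p3) -> e (last a2 p2) (last a3 p3) ->
  linked (a1 :: p1) (a2 :: p2) a1 a2 (last a1 p1) (last a2 p2) ->
  linked (a1 :: p1) (a3 :: p3) a1 a3 (last a1 p1) (last a3 p3) ->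
  linked (a2 :: p2) (a3 :: p3) a2 a3 (last a2 p2) (last a3 p3) ->
  False.
Proof.
move=> i1 i2 i3 n1 n2 n3 e12 e13 e23 f12 f13 f23 L12 L13 L23.
by apply: (no_prism_joined i1 i2 i3 n1 n2 n3); apply: linked_joined.
Qed.

(** * Complete vertices, anticonnected sets and antipaths *)

Definition complete (S : seq V) : pred V := fun v => all (e v) S.

(* An enumeration of a set connected in the complement: every entry but the last has a
   non-neighbour further on. *)
Fixpoint anticonn (S : seq V) : bool :=
  if S is t :: S' then ((S' == [::]) || ~~ complete S' t) && anticonn S' else true.

Lemma complete_sub S S' v : {subset S' <= S} -> complete S v -> complete S' v.
Proof. by move=> sub /allP H; apply/allP => z /sub/H. Qed.

Lemma complete_notin S v : complete S v -> v \notin S.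
Proof. by move=> /allP H; apply/negP => /H; rewrite e_irr. Qed.

Lemma ncompleteP S v : ~~ complete S v -> exists2 s, s \in S & ~~ e v s.
Proof. by rewrite -has_predC => /hasP[s sS nvs]; exists s. Qed.

Lemma anticonn_walk S x y : anticonn S -> x \in S -> y \in S ->
  exists p, [/\ path far x p, last x p = y & {subset p <= S}].
Proof.
elim: S x y => [|t S IH] // x y /= /andP[tS cS].
have sub (p : seq V) : {subset p <= S} -> {subset p <= t :: S}.
  by move=> H z /H; rewrite inE => ->; rewrite orbT.
have IH' a b : a \in S -> b \in S ->
    exists p, [/\ path far a p, last a p = b & {subset p <= t :: S}].
  by move=> aS bS; have [p [H1 H2 /sub H3]] := IH a b cS aS bS; exists p.
rewrite [x \in _]inE [y \in _]inE.
have [->|xt] := eqVneq x t; have [->|yt] := eqVneq y t; rewrite /=.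
- by move=> _ _; exists [::].
- move=> _ yS; have [s sS nts] : exists2 s, s \in S & ~~ e t s.
    by case/orP: tS => [/eqP S0|/ncompleteP //]; rewrite S0 in yS.
  have [p [H1 H2 H3]] := IH' s y sS yS.
  (* Entries may repeat, so [s] may equal [t], and the complement has no loop to step along. *)
  have [st|st] := eqVneq s t; first by exists p; split; rewrite // -st.
  exists (s :: p); split=> //=; first by rewrite /anti eq_sym st nts.
  by move=> z; rewrite inE => /predU1P[->|/H3 //]; rewrite inE sS orbT.
- move=> xS _; have [s sS nts] : exists2 s, s \in S & ~~ e t s.
    by case/orP: tS => [/eqP S0|/ncompleteP //]; rewrite S0 in xS.
  have [p [H1 H2 H3]] := IH' x s xS sS.
  have [st|st] := eqVneq s t; first by exists p; split; rewrite // -st.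
  exists (rcons p t); rewrite last_rcons rcons_path H1 H2 /anti st e_sym nts.
  by split=> // z; rewrite mem_rcons inE => /predU1P[->|/H3 //]; rewrite inE eqxx.
by move=> xS yS; exact: IH'.
Qed.

(** A non-neighbour of [x] and one of [y] in [S] are joined inside [S] by a walk of the complement;
    shortcutting it gives an induced antipath. *)
Lemma antipath S x y : anticonn S -> ~~ complete S x -> ~~ complete S y -> x \notin S -> y \notin S -> x != y ->
  exists q, cipath (x :: rcons q y) /\ {subset q <= S}.
Proof.
move=> cS /ncompleteP[s sS xs] /ncompleteP[s' sS' ys] xS yS xy.
have [p [H1 H2 H3]] := anticonn_walk cS sS sS'.
have ne (a b : V) : a \notin S -> b \in S -> a != b by move=> aS bS; apply: contraNneq aS => ->.
have W : path far x (rcons (s :: p) y).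
  rewrite rcons_path /= H1 H2 /anti ne // xs e_sym ys eq_sym ne //.
have [q [H4 H5]] := walk_rcons_ipath far_irr W xy.
exists q; split=> // z /H5; rewrite inE => /predU1P[->//|]; exact: H3.
Qed.

(* The Roussel-Rubio property; [size s] counts interior vertices, so these paths have even length. *)
Definition odd_between S := forall x s y, ipath (x :: rcons s y) -> complete S x -> complete S y ->
  ~~ has (complete S) s -> s != [::] -> odd (size s).

(** * The Roussel-Rubio lemma *)

(** Since [t] sees only the ends, it closes the path to a hole with [size s + 3] vertices. *)
Lemma odd_between1 t : odd_between [:: t].
Proof.
move=> x s y ip; rewrite /complete /= !andbT => xt yt nt s0.
apply/negPn/negP => os.
have s2 : 2 <= size s by case: s os s0 {ip nt} => [|? []].
have ix : ipath (x :: s) by move: ip; rewrite -rcons_cons -cats1 => /ipath_catl.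
have iy := ipath_behead ip.
have nts z : z \in s -> ~~ e t z.
  by move=> zs; apply: contra nt => tz; apply/hasP; exists z; rewrite //= e_sym tz.
have ns : t \notin s.
  apply/negP => ts; have := ipath_ends e_sym e_irr s2 ix iy ts.
  by rewrite xt yt.
have fts z : z \in s -> far t z.
  by move=> zs; rewrite /anti nts // andbT; apply: contraNneq ns => ->.
have : ~~ odd (size (x :: s)); last by rewrite /= os.
apply: (@apath_even t _ y).
- apply/and3P; split.
  + by apply: ipath_consI => //; [rewrite e_sym|apply/allP].
  + exact: ip.
  by apply: contraTneq yt => ->; rewrite e_irr.
- by rewrite e_sym.
exact: leq_trans s2 _.
Qed.

Lemma par_both_open (c : pred V) x m y : ~~ has c m -> m != [::] -> par (both c) x (rcons m y) = false.
Proof.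
case: m => [|z m] //= /norP[/negbTE cz nm] _; rewrite {1}/both cz andbF /=.
case/lastP: m nm => [|m w]; first by rewrite /= /both cz.
rewrite has_rcons negb_or => /andP[/negbTE cw nm].
by rewrite -cats1 par_cat last_rcons par_both0 ?has_rcons ?cw //= /both cw.
Qed.

(** Segments of length at least 2 between consecutive complete vertices are even, and those of
    length 1 are the complete edges; so the length [size s + 1] has the parity of the number of
    complete edges. *)
Lemma odd_between_par S u s v : odd_between S -> complete S u -> complete S v ->
  (forall l x m y r, u :: rcons s v = l ++ x :: m ++ y :: r -> ~~ has (complete S) m ->
     ipath (x :: rcons m y)) ->
  par (both (complete S)) u (rcons s v) = ~~ odd (size s).
Proof.
move=> R cu cv H.
have : par (fun a b => true (+) both (complete S) a b) u (rcons s v) = false.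
  apply: (par_segments (c := complete S)) => //; last by rewrite last_rcons.
  move=> l x m y r E cx cy nm; rewrite (par_addb (fun _ _ => true)) par_true size_rcons.
  have ip := H _ _ _ _ _ E nm.
  have [m0|m0] := eqVneq m [::]; first by rewrite m0 /= /both cx cy.
  by rewrite par_both_open //= (R _ _ _ ip).
rewrite (par_addb (fun _ _ => true)) par_true size_rcons /=.
by case: (odd _); case: (par _ _ _).
Qed.

Lemma apath_segment u s v l x m y r : apath u s v ->
  u :: rcons s v = l ++ x :: m ++ y :: r -> (l != [::]) || (r != [::]) -> ipath (x :: rcons m y).
Proof.
case/and3P=> us sv _ E; case: l E => [|w l] E /=; last first.
  move=> _; case: E sv => _ -> /ipath_catr.
  rewrite -cat_rcons -cat_cons; exact: ipath_catl.
case/lastP: r E => [|r w] // E _; case: E us => -> E.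
move: E; rewrite -rcons_cons -rcons_cat => /rcons_inj[-> _].
by rewrite -cat_rcons -cat_cons => /ipath_catl.
Qed.

(** A complete vertex inside [s] makes every segment miss part of [u s v], so each is chordless even
    if [u] and [v] are adjacent. *)
Lemma odd_between_par_apath S u s v : odd_between S -> apath u s v -> complete S u -> complete S v -> has (complete S) s ->
  par (both (complete S)) u (rcons s v) = ~~ odd (size s).
Proof.
move=> R ap cu cv hs; apply: odd_between_par => // l x m y r E nm.
apply: (apath_segment ap E); case: l E => [|w l] //; case: r => [|w r] //.
case=> _ /eqP; rewrite cats1 eqseq_rcons => /andP[/eqP sm _].
by rewrite -sm hs in nm.
Qed.

Lemma complete1 t z : complete [:: t] z = e t z.
Proof. by rewrite /complete /= andbT e_sym. Qed.

(** Prolonged by [t] and [z], the segment becomes a chordless path with S-complete ends whose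
    interior is [m], [y], [t]: two vertices more than [m]. *)
Lemma odd_between_mixed S t x m y z : odd_between S -> ipath (x :: rcons m y) -> complete S x -> complete S z ->
  ~~ has (complete S) m -> ~~ complete S y -> ~~ complete S t -> e t y -> e t z ->
  all (far t) (x :: m) -> all (far z) (x :: rcons m y) -> odd (size m).
Proof.
move=> R ip cx cz nm ny nt ty tz ft fz.
have := R x (rcons (rcons m y) t) z; rewrite !size_rcons /= negbK; apply=> //.
- rewrite -!rcons_cons; apply: (ipath_rconsI e_sym); last 2 first.
  + by rewrite e_sym.
  + exact: fz.
  exact: (ipath_rconsI e_sym).
- by rewrite !has_rcons !negb_or nt ny.
by case: (m).
Qed.

Lemma double_label S t u s v : odd_between S -> apath u s v -> 2 <= size s -> ~~ odd (size s) ->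
  complete S u -> complete S v -> e t u -> e t v -> ~~ complete S t ->
  {in s, forall z, ~~ (complete S z && e t z)} -> has (complete S) s -> has (e t) s ->
  exists k1 m k2, [/\ s = k1 :: rcons m k2, ~~ has (complete S) m, ~~ has (e t) m &
    (complete S k1 && e t k2) || (e t k1 && complete S k2)].
Proof.
move=> R ap s2 es Su Sv tu tv nSt disj hS ht; apply: NNPP => noleap.
have [us sv uv] := and3P ap.
pose a := e t; pose b := complete S.
have ts : t \notin s.
  apply/negP => ts; have := ipath_ends e_sym e_irr s2 us sv ts.
  by rewrite [e u t]e_sym [e v t]e_sym tu tv.
have P1 : par (both b) u (rcons s v) by rewrite (odd_between_par_apath R ap).
have P2 : par (both a) u (rcons s v).
  have E : forall z, complete [:: t] z = a z by exact: complete1.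
  have -> : par (both a) u (rcons s v) = par (both (complete [:: t])) u (rcons s v).
    by elim: (rcons s v) (u) => //= z q IH w; rewrite IH /both !E.
  by rewrite (odd_between_par_apath (odd_between1 (t := t)) ap) ?E // (eq_has E).
have : par (fun x y => true (+) (both b x y (+) both a x y)) u (rcons s v) = false.
  apply: (par_segments (c := fun z => b z || a z)); last 2 first.
  - by rewrite /b Su.
  - by rewrite last_rcons /b Sv.
  move=> l x m y r E cx cy nm.
  have [nmb nma] : ~~ has b m /\ ~~ has a m.
    by move: nm; rewrite has_predU negb_or => /andP[].
  rewrite (par_addb (fun _ _ => true)) par_true par_addb size_rcons.
  have prop : m != s -> (l != [::]) || (r != [::]).
    case: l E => [|w l] //; case: r => [|w r] //.
    by case=> _ /eqP; rewrite cats1 eqseq_rcons => /andP[/eqP-> _]; rewrite eqxx.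
  have ms : m != s by apply: contraTneq hS => <-.
  have ip := apath_segment ap E (prop ms).
  have xL : x \in u :: rcons s v by rewrite E mem_cat inE eqxx orbT.
  have yL : y \in u :: rcons s v by rewrite E mem_cat inE mem_cat inE eqxx !orbT.
  have dbl z : z \in u :: rcons s v -> b z -> a z -> z = u \/ z = v.
    rewrite inE mem_rcons inE => /or3P[/eqP|/eqP|zs] bz az; [by left|by right|].
    by have := disj z zs; rewrite -/(b z) -/(a z) bz az.
  have uL := apath_uniq e_irr ap.
  (* An edge counted for both labels has both ends among [u] and [v], which are not consecutive in
     the list. *)
  have xy_uv : m = [::] -> b x -> a x -> b y -> a y -> False.
    move=> m0 bx ax by' ay; have := uL; rewrite E m0 cat_uniq /= => /and4P[_ _].
    rewrite inE negb_or => /andP[xy _] _.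
    case: (dbl x xL bx ax) => xe; case: (dbl y yL by' ay) => ye;
      move: E uL xy; rewrite m0 xe ye ?eqxx // => E uL _; move: uL; rewrite E.
    - case: (l) E => [|w l'] /=.
        case: (s) s2 => [|w s'] //= _ [_ <-].
        by case/and3P=> _; rewrite mem_rcons inE eqxx.
      by case=> ->; rewrite mem_cat !inE eqxx orbT.
    case: (l) E => [|w l'] /=; first by case=> vu; rewrite vu eqxx in uv.
    by case=> ->; rewrite mem_cat !inE eqxx !orbT.
  have mix : ~~ both b x y -> ~~ both a x y -> odd (size m).
    move=> nb na.
    have bau z : z = u \/ z = v -> b z /\ a z by case=> ->; rewrite /b /a.
    have xs : x != u /\ x != v.
      split; apply/eqP => xe; have [bx ax] : b x /\ a x by apply: bau; auto.
        by case/orP: cy nb na => H; rewrite /both ?bx ?ax H.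
      by case/orP: cy nb na => H; rewrite /both ?bx ?ax H.
    have ys : y != u /\ y != v.
      split; apply/eqP => ye; have [bx ax] : b y /\ a y by apply: bau; auto.
        by case/orP: cx nb na => H; rewrite /both ?bx ?ax H.
      by case/orP: cx nb na => H; rewrite /both ?bx ?ax H.
    case: xs ys => xu xv [yu yv].
    case: l E {prop} => [|w l]; first by case=> /esym/eqP; rewrite (negbTE xu).
    case/lastP: r => [|r w'].
      rewrite cat_cons => -[_]; rewrite -[y :: [::]]/(rcons [::] y) -!rcons_cat -rcons_cons -rcons_cat.
      by move/rcons_inj => [_ /esym/eqP]; rewrite (negbTE yv).
    rewrite cat_cons -rcons_cons -rcons_cat -rcons_cons -rcons_cat => -[uw].
    move/rcons_inj => [sE vw]; subst w w'.
    have sxmy : {subset x :: rcons m y <= s}.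
      move=> z; rewrite sE mem_cat !inE mem_rcons mem_cat !inE.
      by case/or3P=> ->; rewrite ?orbT.
    have ft z : z \in x :: rcons m y -> ~~ a z -> far t z.
      move=> zs az; rewrite /anti az andbT; apply: contraNneq ts => ->; exact: sxmy.
    (* A vertex with both labels and far from the segment: [u], unless the segment begins at the
       first vertex of [s], or [v], unless it ends at the last one. If both fail, the segment is a
       leap. *)
    have [z [bz az fz]] : exists z, [/\ b z, a z & all (far z) (x :: rcons m y)].
      case: l sE => [|w l] sE; last first.
        exists u; rewrite /b /a; split=> //; apply/allP => z zs.
        move: us; rewrite sE -[u :: _]/([:: u] ++ w :: (l ++ x :: m ++ y :: r)).
        move/ipath_cat_anti/anti_seqP; apply; rewrite ?inE //.
        by rewrite mem_cat -cat_rcons -cat_cons mem_cat zs !orbT.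
      case/lastP: r sE => [|r w] sE.
        case: noleap; exists x, m, y; rewrite sE cats1; split=> //.
        case/orP: cx => hx; case/orP: cy => hy; rewrite /a /b in hx hy nb na *.
        - by rewrite /both hx hy in nb.
        - by rewrite hx hy.
        - by rewrite hx hy orbT.
        by rewrite /both hx hy in na.
      exists v; rewrite /b /a; split=> //; apply/allP => z zs.
      have E2 : rcons s v = (rcons (x :: m) y ++ r) ++ w :: [:: v].
        by rewrite sE -!cats1 /= -!catA /= -?catA.
      move: sv; rewrite E2 => /ipath_cat_anti/anti_seqP H.
      rewrite (far_sym); apply: H; last by rewrite inE.
      by rewrite mem_cat rcons_cons zs.
    have {}fz z' : z' \in x :: rcons m y -> far z z' by move/allP: fz; apply.
    have nmb' : ~~ has (complete S) m by [].
    case/orP: cx => hx; case/orP: cy => hy.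
    - by rewrite /both hx hy in nb.
    - have nax : ~~ a x by apply: contra na => ax; rewrite /both ax.
      apply: (odd_between_mixed (S := S) (t := t) (x := x) (y := y) (z := z)) => //.
      + by apply: contra nb => by'; apply/andP.
      + apply/allP => w; rewrite inE => wm.
        have wm' : w \in x :: rcons m y by rewrite inE mem_rcons inE; case/orP: wm => ->; rewrite ?orbT.
        apply: ft => //; case/predU1P: wm => [->//|wm]; apply: contra nma => aw.
        by apply/hasP; exists w.
      by apply/allP.
    - have nby : ~~ a y by apply: contra na => ay; rewrite /both ay andbT.
      rewrite -size_rev; apply: (odd_between_mixed (S := S) (t := t) (x := y) (y := x) (z := z)) => //.
      + by rewrite (ipath_rev_ends e_sym).
      + by rewrite has_rev.
      + by apply: contra nb => bx; apply/andP.
      + apply/allP => w; rewrite inE mem_rev => wm.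
        have wm' : w \in x :: rcons m y by rewrite inE mem_rcons inE; case/orP: wm => ->; rewrite ?orbT.
        apply: ft => //; case/predU1P: wm => [->//|wm]; apply: contra nma => aw.
        by apply/hasP; exists w.
      apply/allP => w; rewrite inE mem_rcons inE mem_rev => wm; apply: fz.
      by rewrite inE mem_rcons inE; case/or3P: wm => ->; rewrite ?orbT.
    by rewrite /both hx hy in na.
  have [m0|m0] := eqVneq m [::].
    have [bxy|bxy] := boolP (both b x y); have [axy|axy] := boolP (both a x y).
    - case/andP: bxy => bx by'; case/andP: axy => ax ay.
      by case: (xy_uv m0 bx ax by' ay).
    - by rewrite m0 /= bxy (negbTE axy).
    - by rewrite m0 /= axy (negbTE bxy).
    by have := mix bxy axy; rewrite m0.
  have -> : odd (size m).+1 = false.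
    apply/negbTE; rewrite /= negbK.
    have [/andP[bx by']|nb] := boolP (both b x y); first exact: R ip bx by' nmb m0.
    have [axy|na] := boolP (both a x y); last exact: mix.
    case/andP: axy => ax ay.
    have nmt : ~~ has (complete [:: t]) m by rewrite (eq_has (complete1 t)).
    by apply: (odd_between1 (t := t) ip) => //; rewrite complete1.
  by rewrite !par_both_open.
rewrite (par_addb (fun _ _ => true)) par_true par_addb P1 P2 size_rcons /=.
by rewrite es.
Qed.

Lemma ipath_apath x s y : ipath (x :: rcons s y) -> apath x s y.
Proof.
move=> ip; apply/and3P; split.
- by move: ip; rewrite -rcons_cons -cats1 => /ipath_catl.
- exact: ipath_behead ip.
by have := ipath_uniq e_irr ip; rewrite /= mem_rcons inE negb_or => /andP[/andP[]].
Qed.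

Lemma ipath_ends_far x s y : ipath (x :: rcons s y) -> s != [::] -> far x y.
Proof.
case: s => [|z s] // ip _.
have /anti_seqP := ipath_cat_anti (ip : ipath ([:: x] ++ z :: rcons s y)).
by apply; rewrite ?inE // mem_rcons inE eqxx.
Qed.

Lemma nhas_e a s z : ~~ has (e a) s -> z \in s -> ~~ e a z.
Proof. by move/hasPn; apply. Qed.

(** The prism has triangles [x s1 k1] and [t y k2], joined by the edges [x t] and [s1 y] and by the
    path from [k1] to [k2]. *)
Lemma pair_leap x k1 m k2 y t s1 : ipath (x :: rcons (k1 :: rcons m k2) y) ->
  e s1 x -> e s1 y -> e t x -> e t y -> far s1 t -> e s1 k1 -> e t k2 -> ~~ e t k1 -> ~~ e s1 k2 ->
  ~~ has (e s1) m -> ~~ has (e t) m -> False.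
Proof.
rewrite rcons_cons (ipath_ends2 e_sym).
case/and5P=> xk1 /allP fx xy yk2 /andP[/allP fy ipk] sx sy tx ty st sk1 tk2 ntk1 nsk2 nsm ntm.
have neq a b c : e a b -> ~~ e c b -> a != c by move=> ac; apply: contraNneq => <-.
have Fs z : z \in rcons m k2 -> far s1 z.
  move=> zm; apply/andP; split.
    apply: (@neq _ x); rewrite // e_sym.
    by case/andP: (fx z zm).
  by move: zm; rewrite mem_rcons inE => /predU1P[->|/(nhas_e nsm)].
have Ft z : z \in k1 :: m -> far t z.
  move=> zm; apply/andP; split.
    apply: (@neq _ y); rewrite // e_sym.
    by case/andP: (fy z zm).
  by move: zm; rewrite inE => /predU1P[->|/(nhas_e ntm)].
have S a b : far a b -> far b a by rewrite (far_sym).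
apply: (@no_prism x [:: t] s1 [:: y] k1 (rcons m k2)) => //=; rewrite ?last_rcons //.
- by rewrite ipath_cons e_sym tx.
- by rewrite ipath_cons sy.
- by case: (m).
- by rewrite e_sym.
- move=> a b; rewrite !inE => /orP[/eqP->|/eqP->] /orP[/eqP->|/eqP->].
  + by constructor 2.
  + by constructor 1.
  + by constructor 1; apply: S.
  by constructor 3.
- move=> a b; rewrite !inE => /orP[/eqP->|/eqP->] bk.
    case/predU1P: bk => [->|/fx]; [by constructor 2|by constructor 1].
  move: bk; rewrite -[(b == k1) || _]/(b \in k1 :: rcons m k2) -rcons_cons mem_rcons inE.
  case/predU1P=> [->|/Ft]; [by constructor 3|by constructor 1].
move=> a b; rewrite !inE => /orP[/eqP->|/eqP->] bk.
  case/predU1P: bk => [->|/Fs]; [by constructor 2|by constructor 1].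
move: bk; rewrite -[(b == k1) || _]/(b \in k1 :: rcons m k2) -rcons_cons mem_rcons inE.
case/predU1P=> [->|/fy]; [by constructor 3|by constructor 1].
Qed.

(** Take an antipath from [t] to [k2] through [S]. With two or more interior vertices it extends to
    an antihole. With a single one, [s1], either [S] is [s1] alone, which gives a prism, or the
    property for the pair [s1], [t] contradicts the even interior of the path. *)
Lemma leap_free S t x k1 m k2 y : anticonn S -> ~~ complete S t ->
  (forall s1, s1 \in S -> far s1 t -> S = [:: s1] \/ odd_between [:: s1; t]) ->
  ipath (x :: rcons (k1 :: rcons m k2) y) -> ~~ odd (size m) ->
  complete S x -> complete S y -> e t x -> e t y -> complete S k1 -> e t k2 -> ~~ e t k1 -> ~~ complete S k2 ->
  ~~ has (complete S) m -> ~~ has (e t) m -> False.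
Proof.
move=> cS nSt RS ip em Sx Sy tx ty Sk1 tk2 ntk1 nSk2 nSm ntm.
move: (ip); rewrite rcons_cons (ipath_ends2 e_sym).
case/and5P=> xk1 /allP fx xy yk2 /andP[/allP fy ipk].
have tS : t \notin S by apply: contra ntk1 => tS; rewrite e_sym; move/allP: Sk1; apply.
have k2S : k2 \notin S.
  apply/negP => k2S; have /fx : k2 \in rcons m k2 by rewrite mem_rcons mem_head.
  by move/allP: Sx => /(_ _ k2S) xk2; rewrite /anti xk2 andbF.
have tk2' : t != k2 by apply: contraTneq tk2 => ->; rewrite e_irr.
have [q [ipq qS]] := antipath cS nSt nSk2 tS k2S tk2'.
have S' a b : far a b -> far b a by rewrite (far_sym).
case: q ipq qS => [|s1 [|s2 q]] ipq qS.
- by move: ipq; rewrite ipath_cons /anti tk2 andbF.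
- move: ipq; rewrite /= !ipath_cons => /and3P[ts1 _ /and3P[s1k2 _ _]].
  have s1S : s1 \in S by apply: qS; rewrite inE.
  have sv v : complete S v -> e s1 v by move=> /allP/(_ _ s1S); rewrite e_sym.
  case: (RS s1 s1S (S' _ _ ts1)) => [SE|R].
    have E z : complete S z = e s1 z by rewrite SE complete1.
    apply: (pair_leap (t := t) (s1 := s1) ip) => //; rewrite -?E //.
    - exact: S'.
    by rewrite -(eq_has E).
  have C z : complete [:: s1; t] z = e s1 z && e t z by rewrite /complete /= andbT !(e_sym z).
  have : odd (size (k1 :: rcons m k2)); last by rewrite /= size_rcons /= negbK (negbTE em).
  apply: R ip _ _ _ isT; rewrite ?C ?tx ?ty ?sv //.
  rewrite -rcons_cons has_rcons C negb_or negb_and.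
  have /andP[_ ->] := s1k2; apply/hasPn => z zm; rewrite C negb_and.
  move: zm; rewrite inE => /predU1P[->|/(nhas_e ntm) ->]; last by rewrite orbT.
  by rewrite ntk1 orbT.
have ff a b : e a b -> anti far a b by rewrite (far_far).
have qe v : complete S v -> all (anti far v) [:: s1, s2 & q].
  by move=> /allP Sv; apply/allP => z /qS/Sv/ff.
have k1t : far k1 t.
  by rewrite /anti e_sym ntk1 andbT; apply: contraNneq nSt => <-.
have k1q : all (anti far k1) [:: s1, s2 & q] by exact: qe.
have kt : k1 != k2 by apply: contraNneq nSk2 => <-.
(* For non-adjacent [k1], [k2] the antihole consists of [k1], [t], the antipath and [k2]; for
   adjacent ones it returns to [k1] through [x] and [y]. *)
have [m0|m0] := eqVneq m [::]; last first.
  have k1k2 : far k1 k2.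
    have := ipath_ends_far ipk m0; by [].
  have ap : capath k1 (t :: [:: s1, s2 & q]) k2.
    apply/and3P; split=> //.
    by apply: ipath_consI => //; move: ipq; rewrite -rcons_cons -cats1 => /ipath_catl.
  exact: (no_antihole ap k1k2 isT).
have k1k2 : e k1 k2 by move: ipk; rewrite m0 ipath_cons => /and3P[].
have [xt yt k1x] : [/\ e x t, e y t & e k1 x] by rewrite !(e_sym _ t) (e_sym k1).
have ap : capath k1 (rcons (rcons (t :: [:: s1, s2 & q]) k2) x) y.
  have xk2 : far x k2 by apply: fx; rewrite mem_rcons mem_head.
  have k1y : far k1 y by apply: S'; apply: fy; rewrite mem_head.
  have i1 : cipath (rcons (rcons (t :: [:: s1, s2 & q]) k2) x).
    rewrite (ipath_rcons (far_sym)) ipq xk2 /= andbT.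
    by rewrite (ff _ _ xt); exact: qe.
  apply/and3P; split; last by case/andP: k1y.
    apply: (ipath_consI (s := rcons (rcons [:: s1, s2 & q] k2) x) i1 k1t); rewrite !all_rcons (ff _ _ k1k2) (ff _ _ k1x).
    exact: k1q.
  rewrite (ipath_rcons (far_sym)) i1 (S' _ _ xy) all_rcons (ff _ _ yk2) /= andbT.
  by rewrite (ff _ _ yt); exact: qe.
apply: (no_antihole ap _ isT); apply: S'; apply: fy; exact: mem_head.
Qed.

(** Induction on the size. On a path of odd length without interior vertex complete to [t :: S], the
    smaller sets [[:: t]] and [S] must both label interior vertices; then [double_label] gives a
    leap, and [leap_free] refutes it. *)
Lemma odd_between_anticonn S : anticonn S -> odd_between S.
Proof.
elim: {S}_.+1 {-2}S (ltnSn (size S)) => [|n IH] // [|t S] //.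
  by move=> _ _ x [|z s] y.
rewrite ltnS => sS cS; have [S0|S0] := eqVneq S [::]; first by rewrite S0; exact: odd_between1.
have /= /andP[] := cS; rewrite (negbTE S0) /= => nSt cS'.
have R : odd_between S by apply: IH.
have Rt : odd_between [:: t] by exact: odd_between1.
move=> x s y ip /= /andP[xt Sx] /andP[yt Sy] ns s0; apply/negPn/negP => es.
have ap := ipath_apath ip.
have s2 : 2 <= size s by case: s s0 es {ip ns ap} => [|? []].
have hS : has (complete S) s by apply: contraNT es => nh; exact: R ip Sx Sy nh s0.
have ht : has (e t) s.
  by apply: contraNT es => nh; apply: (Rt x s y) => //; rewrite ?complete1 1?e_sym // (eq_has (complete1 t)).
have dj : {in s, forall z, ~~ (complete S z && e t z)}.
  move=> z zs; apply: contra ns => /andP[Sz tz]; apply/hasP; exists z => //.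
  by apply/andP; rewrite e_sym.
rewrite e_sym in xt; rewrite e_sym in yt.
have [k1 [m [k2 [sE nSm ntm lp]]]] := double_label R ap s2 es Sx Sy xt yt nSt dj hS ht.
have em : ~~ odd (size m) by move: es; rewrite sE /= size_rcons /= negbK.
have RS s1 : s1 \in S -> far s1 t -> S = [:: s1] \/ odd_between [:: s1; t].
  move=> s1S /andP[_ s1t]; case: (S) s1S cS' sS => [|s3 [|s4 S']] //.
    by rewrite inE => /eqP->; left.
  move=> _ _ sS; right; apply: IH; first exact: leq_ltn_trans sS.
  by rewrite /= andbT /complete /= andbT s1t.
have k1s : k1 \in s by rewrite sE mem_head.
have k2s : k2 \in s by rewrite sE inE mem_rcons inE eqxx orbT.
have nd z : z \in s -> (complete S z -> ~~ e t z) /\ (e t z -> ~~ complete S z).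
  by move=> zs; split=> h; have := dj z zs; rewrite h ?andbT.
rewrite sE in ip.
case/orP: lp => /andP[h1 h2].
  apply: (leap_free cS' nSt RS ip) => //; first exact: (nd k1 k1s).1.
  exact: (nd k2 k2s).2.
have ip' : ipath (y :: rcons (k2 :: rcons (rev m) k1) x).
  by move: ip; rewrite -(ipath_rev_ends e_sym) rev_cons rev_rcons.
apply: (leap_free cS' nSt RS ip') => //; rewrite ?size_rev ?has_rev //.
  exact: (nd k2 k2s).1.
exact: (nd k1 k1s).2.
Qed.

(** * Hats: vertices seeing exactly the two ends of one edge of a hole *)

Lemma ipath_nbr u s y : ipath (u :: s) -> y \in s -> exists2 y', y' \in u :: s & e y y'.
Proof.
elim: s u => [|z s IH] u //; rewrite ipath_cons => /and3P[uz _ ip].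
rewrite inE => /predU1P[->|ys]; first by exists u; rewrite ?mem_head // e_sym.
by have [y' y's yy'] := IH z ip ys; exists y'; rewrite // inE y's orbT.
Qed.

Section Hat.

Variables (u : V) (s : seq V) (v t : V).
Hypotheses (ap : apath u s v) (uv : e u v) (s2 : 2 <= size s).
Hypotheses (tu : e t u) (tv : e t v) (nts : ~~ has (e t) s).

Lemma hat_far : all (far t) s.
Proof.
have [us sv _] := and3P ap.
apply/allP => z zs; rewrite /anti (nhas_e nts zs) andbT.
apply/eqP => tz; have := ipath_ends e_sym e_irr s2 us sv zs.
by rewrite -tz e_sym tu e_sym tv.
Qed.

Lemma untouching_far z : ~~ e z u -> ~~ e z v -> ~~ has (e z) s -> all (far z) (u :: rcons s v).
Proof.
move=> zu zv zs; have [us sv _] := and3P ap.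
have zne y y' : e y y' -> ~~ e z y' -> far z y || e z y.
  by move=> yy' zy'; rewrite /anti; case: eqVneq => [zy|_]; [rewrite zy yy' in zy'|rewrite orNb].
apply/allP => y; rewrite inE mem_rcons inE => /or3P[/eqP->|/eqP->|ys].
- by move: (zne u v uv zv); rewrite (negbTE zu) orbF.
- by have := zne v u; rewrite e_sym (negbTE zv) orbF; apply.
have [y' y's yy'] := ipath_nbr us ys.
have /(zne _ _ yy') : ~~ e z y'.
  by move: y's; rewrite inE => /predU1P[->//|]; exact: nhas_e zs.
by rewrite (negbTE (nhas_e zs ys)) orbF.
Qed.

(** The paths from [t] to [a] through [q], [w] and through [u], [s1] have no edge between their
    interiors, so they bound an even hole. *)
Lemma hat_first q w s1 a s3 : ipath (t :: rcons q w) -> all (fun z => all (far z) (u :: rcons s v)) q ->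
  far w u -> all (far w) s1 -> s = s1 ++ a :: s3 -> e w a -> odd (size q) = odd (size s1).
Proof.
move=> ipq qK wu ws1 sE wa; have [us sv _] := and3P ap.
have tfar := hat_far.
suff : odd (size (rcons q w)) = odd (size (u :: s1)) by rewrite size_rcons /=; case: (odd _); case: (odd _).
have us1 : ipath (u :: rcons s1 a).
  by move: us; rewrite sE -cat_rcons -cat_cons => /ipath_catl.
have Kq z y : z \in q -> y \in u :: rcons s1 a -> far z y.
  move=> zq; move/allP: qK => /(_ z zq)/allP H yK; apply: H.
  rewrite sE rcons_cat inE mem_cat; move: yK; rewrite inE mem_rcons inE.
  by rewrite rcons_cons inE; case/or3P=> ->; rewrite ?orbT.
have i1 : ipath (t :: rcons (rcons q w) a).
  rewrite -!rcons_cons (ipath_rcons e_sym) rcons_cons ipq e_sym wa andbT /=.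
  rewrite (far_sym) (allP tfar) ?sE ?mem_cat ?inE ?eqxx ?orbT //=.
  apply/allP => z zq; rewrite (far_sym) Kq //.
  by rewrite inE mem_rcons inE eqxx orbT.
have i2 : ipath (t :: rcons (u :: s1) a).
  rewrite rcons_cons; apply: ipath_consI => //.
  apply/allP => z zs; apply: (allP tfar); rewrite sE mem_cat inE.
  by move: zs; rewrite mem_rcons inE => /orP[] ->; rewrite ?orbT.
apply: (two_paths_parity i1 i2) => //; last by case: (q).
apply/anti_seqP => z y; rewrite mem_rcons inE => /predU1P[->|zq] ys.
  by move: ys; rewrite inE => /predU1P[->//|]; exact: (allP ws1).
apply: Kq => //; move: ys; rewrite !inE mem_rcons inE => /orP[] ->; rewrite ?orbT //.
Qed.

End Hat.

(** Let [a] and [b] be the first and last neighbours of [w] on [s]. By [hat_first] the parts of [s]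
    before [a] and after [b] both have the parity of [q]. If [a = b], the given hole is odd; if [a]
    and [b] are consecutive, there is a prism with triangles [t u v] and [w a b]; otherwise [w] and
    the arc from [a] to [b] through [u v] form an odd hole. *)
Lemma hat_path u s v t q w : apath u s v -> e u v -> 2 <= size s ->
  e t u -> e t v -> ~~ has (e t) s ->
  ipath (t :: rcons q w) -> all (fun z => all (far z) (u :: rcons s v)) q ->
  far w u -> far w v -> has (e w) s -> False.
Proof.
move=> ap uv s2 tu tv nts ipq qK wu wv ws.
have [us sv _] := and3P ap; have tfar := allP (hat_far ap s2 tu tv nts).
have wns : w \notin s.
  apply/negP => w_s; move: ipq; case/lastP: q qK => [|q x] qK.
    by rewrite ipath_cons => /and3P[tw _ _]; case/negP: (nhas_e nts w_s).
  rewrite -!rcons_cons (ipath_rcons e_sym) => /and3P[wx _ _].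
  move/allP: qK => /(_ x); rewrite mem_rcons mem_head => /(_ isT)/allP/(_ w).
  by rewrite inE mem_rcons inE w_s !orbT /anti e_sym wx andbF => /(_ isT).
have wfar l : {subset l <= s} -> ~~ has (e w) l -> all (far w) l.
  move=> ls nl; apply/allP => z zl; rewrite /anti (nhas_e nl zl) andbT.
  by apply: contraNneq wns => ->; exact: ls.
have [s1 [a [s3 [sE wa nws1]]]] := has_first ws.
have h1 : has (e w) (a :: s3) by rewrite /= wa.
have [s5 [b [s4 [E2 wb nws4]]]] := has_last h1.
have sub1 : {subset s1 <= s} by move=> z; rewrite sE mem_cat => ->.
have sub4 : {subset s4 <= s}.
  by move=> z zs; rewrite sE E2 !mem_cat inE zs !orbT.
have o1 := hat_first ap s2 tu tv nts ipq qK wu (wfar _ sub1 nws1) sE wa.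
have o4 : odd (size q) = odd (size s4).
  have ap' : apath v (rev s) u by rewrite -(apath_rev e_sym).
  have s2' : 2 <= size (rev s) by rewrite size_rev.
  have nts' : ~~ has (e t) (rev s) by rewrite has_rev.
  have qK' : all (fun z => all (far z) (v :: rcons (rev s) u)) q.
    apply: sub_all qK => z /allP H; apply/allP => y; rewrite inE mem_rcons inE mem_rev => yK.
    by apply: H; rewrite inE mem_rcons inE; case/or3P: yK => ->; rewrite ?orbT.
  have w4 : all (far w) (rev s4) by rewrite all_rev; exact: wfar.
  have sE' : rev s = rev s4 ++ b :: rev (s1 ++ s5).
    by rewrite sE E2 catA rev_cat rev_cons -cats1 -catA.
  by rewrite (hat_first ap' s2' tv tu nts' ipq qK' wv w4 sE' wb) size_rev.
have es := apath_even ap uv s2.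
case: s5 E2 => [|a' m] /= [? E2].
  by move: es; subst b; rewrite sE E2 size_cat /= addnS /= oddD -o1 -o4 addbb.
subst a'; rewrite E2 in sE => {h1}.
have A1 : anti_seq e (u :: s1) (m ++ b :: s4).
  by apply: (@ipath_cat_anti _ e (u :: s1) _ a); rewrite cat_cons -sE.
have A2 : anti_seq e (s1 ++ a :: m) (rcons s4 v).
  apply: (@ipath_cat_anti _ e _ _ b); move: sv.
  by rewrite sE rcons_cat rcons_cons rcons_cat rcons_cons -cat_cons catA.
have fK z y : z \in u :: rcons s1 a -> y \in b :: rcons s4 v ->
    [\/ far z y, z = u /\ y = v | m = [::] /\ z = a /\ y = b].
  rewrite -rcons_cons mem_rcons inE => /predU1P[->|zs].
    rewrite inE => /predU1P[->|ys]; last first.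
      by constructor 1; apply: (anti_seqP _ _ _ A2) => //; rewrite mem_cat inE eqxx orbT.
    case: m sE {A1 A2 E2} => [|c m] sE; first by constructor 3.
    constructor 1.
    have /anti_seqP : anti_seq e (u :: rcons s1 a) (m ++ b :: s4).
      by apply: (@ipath_cat_anti _ e _ _ c); rewrite cat_cons cat_rcons; move: us; rewrite sE.
    by apply; rewrite ?mem_cat ?inE ?mem_rcons ?inE ?eqxx ?orbT.
  rewrite -rcons_cons mem_rcons inE => /predU1P[->|ys].
    move: zs; rewrite inE => /predU1P[->|zs]; first by constructor 2.
    by constructor 1; apply: (anti_seqP _ _ _ A2); rewrite ?mem_cat ?mem_rcons ?inE ?zs ?eqxx.
  by constructor 1; apply: (anti_seqP _ _ _ A1); rewrite ?mem_cat ?ys ?orbT.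
have i2 : ipath (u :: rcons s1 a).
  by move: us; rewrite sE -cat_rcons -cat_cons => /ipath_catl.
have i3 : ipath (v :: rcons (rev s4) b).
  rewrite (ipath_rev_ends e_sym); move: sv.
  by rewrite sE rcons_cat rcons_cons rcons_cat rcons_cons -cat_cons catA => /ipath_catr.
have mK3 y : (y \in v :: rcons (rev s4) b) = (y \in b :: rcons s4 v).
  by rewrite !inE !mem_rcons !inE mem_rev orbCA.
have [m0|m0] := eqVneq m [::].
  subst m; have ab : e a b.
    by move: us; rewrite sE => /(@ipath_catr _ e (u :: s1)); rewrite ipath_cons => /and3P[].
  apply: (@no_prism t (rcons q w) u (rcons s1 a) v (rcons (rev s4) b)) => //; rewrite ?last_rcons //.
  - by case: (q).
  - by case: (s1).
  - by case: (rev s4).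
  - move=> z y; rewrite -rcons_cons mem_rcons !inE => /or3P[/eqP->|/eqP->|zq].
    + rewrite mem_rcons inE => /or3P[/eqP->|/eqP->|ys1].
      * by constructor 1.
      * by constructor 3.
      by constructor 1; apply: (allP (wfar _ sub1 nws1)).
    + case/predU1P=> [->|ys]; first by constructor 2.
      constructor 1; apply: tfar; rewrite sE mem_cat inE.
      by move: ys; rewrite mem_rcons inE => /orP[] ->; rewrite ?orbT.
    move=> yK; constructor 1; apply: (allP (allP qK z zq)); rewrite inE mem_rcons inE sE mem_cat inE.
    by move: yK; rewrite mem_rcons inE => /or3P[] ->; rewrite ?orbT.
  - move=> z y; rewrite -rcons_cons mem_rcons !inE => /or3P[/eqP->|/eqP->|zq].
    + rewrite mem_rcons inE mem_rev => /or3P[/eqP->|/eqP->|ys1].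
      * by constructor 1.
      * by constructor 3.
      by constructor 1; apply: (allP (wfar _ sub4 nws4)).
    + case/predU1P=> [->|ys]; first by constructor 2.
      constructor 1; apply: tfar; rewrite sE mem_cat !inE.
      by move: ys; rewrite mem_rcons inE mem_rev => /orP[] ->; rewrite ?orbT.
    move=> yK; constructor 1; apply: (allP (allP qK z zq)); rewrite inE mem_rcons inE sE mem_cat !inE.
    by move: yK; rewrite mem_rcons inE mem_rev => /or3P[] ->; rewrite ?orbT.
  move=> z y zK; rewrite mK3 => /(fK z y zK) [?|[-> ->]|[_ [-> ->]]].
  - by constructor 1.
  - by constructor 2.
  by constructor 3.
have far2 z y : z \in u :: rcons s1 a -> y \in b :: rcons s4 v -> z != u \/ y != v -> far z y.
  move=> zs ys; case: (fK z y zs ys) => // [[-> ->]|[E]]; last by rewrite E in m0.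
  by rewrite !eqxx; case.
have ira : ipath (a :: rcons (rev s1 ++ u :: v :: rev s4) b).
  have -> : a :: rcons (rev s1 ++ u :: v :: rev s4) b = rcons (a :: rev s1) u ++ v :: rcons (rev s4) b.
    by rewrite rcons_cat !rcons_cons cat_cons cat_rcons.
  have mr z : z \in b :: rcons s4 v -> z != v -> z \in rcons (rev s4) b.
    by rewrite inE mem_rcons inE mem_rcons inE mem_rev => /or3P[]->; rewrite ?orbT.
  have uP : uniq (v :: rcons (rev s4) b) by apply: ipath_uniq i3.
  have uQ : uniq (u :: rcons s1 a) by apply: ipath_uniq i2.
  rewrite ipath_cat rcons_cons (ipath_rev_ends e_sym) i2 i3 uv /=; apply/andP; split.
    apply/allP => y ys; apply: far2; first exact: mem_head.
      by rewrite -mK3 inE ys orbT.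
    by right; apply: contraTneq uP => <-; rewrite /= ys.
  apply/anti_seqP => z y zs; rewrite mK3 => ys; apply: far2 => //.
    by move: zs; rewrite !inE mem_rcons inE mem_rev => /orP[] ->; rewrite ?orbT.
  left; apply: contraTneq uQ => <-; rewrite /= mem_rcons.
  by move: zs; rewrite !inE mem_rev => ->.
have iw : ipath (a :: rcons [:: w] b).
  rewrite !ipath_cons /= e_sym wa wb !andbT.
  apply: far2; rewrite ?inE ?mem_rcons ?inE ?eqxx ?orbT //.
  left; have := ipath_uniq e_irr i2; rewrite /= mem_rcons inE negb_or => /andP[/andP[]].
  by rewrite eq_sym.
have E : odd (size (rev s1 ++ u :: v :: rev s4)) = false.
  by rewrite size_cat /= !size_rev !addnS /= negbK oddD -o1 -o4 addbb.
suff : odd (size [:: w]) = false by [].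
rewrite -E; apply: (two_paths_parity iw ira) => //; last by case: (rev s1).
apply/anti_seqP => z y; rewrite inE => /eqP->.
rewrite mem_cat mem_rev !inE mem_rev => /or4P[ys|/eqP->|/eqP->|ys] //.
  exact: (allP (wfar _ sub1 nws1)).
exact: (allP (wfar _ sub4 nws4)).
Qed.

(** Stop at the first vertex with a neighbour on [s]: the walk before it is anticomplete to the
    hole, apart from [t], and can be shortcut for [hat_path]. *)
Lemma hat_walk u s v t p : apath u s v -> e u v -> 2 <= size s ->
  e t u -> e t v -> ~~ has (e t) s -> path e t p ->
  all (fun w => ~~ e w u && ~~ e w v) p -> has (fun w => has (e w) s) p -> False.
Proof.
move=> ap uv s2 tu tv nts tp puv pt.
have [p1 [w [p2 [pE ws np1]]]] := has_first pt.
move: tp puv; rewrite pE -cat_rcons cat_path => /andP[tp _].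
rewrite all_cat all_rcons => /andP[/andP[/andP[wu wv] p1uv] _].
have tw : t != w by apply: contraNneq wu => <-.
have [q [ipq qs]] := walk_rcons_ipath e_irr tp tw.
have far' z : ~~ e z u -> ~~ e z v -> ~~ has (e z) s -> all (far z) (u :: rcons s v).
  exact: untouching_far.
apply: (hat_path ap uv s2 tu tv nts ipq) => //.
- apply/allP => z /qs zp; move/allP: p1uv => /(_ z zp)/andP[zu zv].
  by apply: far' => //; move/hasPn: np1; apply.
- by rewrite /anti wu andbT; apply: contraNneq wv => ->.
by rewrite /anti wv andbT; apply: contraNneq wu => ->; rewrite e_sym.
Qed.

(* An outer path from u through k1 to z would become an odd outer path for Y once u is dropped. *)
Lemma leap_outer T Y u k1 s' v z : odd_between T -> odd_between Y -> apath u (k1 :: s') v ->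
  complete T u -> ~~ has (complete T) (k1 :: s') -> complete T z -> far z u -> ~~ e k1 z ->
  complete Y k1 -> ~~ has (complete Y) s' -> complete Y z -> ~~ has (e z) (k1 :: s').
Proof.
move=> RT RY ap Tu nT Tz zu k1z Yk1 nY Yz; apply/negP => hz.
have [us _ _] := and3P ap.
have [s1 [w [s2 [sE zw nz]]]] := has_first hz.
case: s1 sE nz => [|k s1] /= [? sE]; first by subst w; rewrite e_sym zw in k1z.
subst k; rewrite negb_or => /andP[_ nz].
have zns : z \notin k1 :: s' by apply: contra nT => zs; apply/hasP; exists z.
have fz : all (far z) (k1 :: s1).
  apply/allP => y ys; apply/andP; split.
    apply: contraNneq zns => ->; rewrite sE -cat_cons mem_cat ys //.
  by move: ys; rewrite inE => /predU1P[->|/(nhas_e nz) //]; rewrite e_sym.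
have i2 : ipath (k1 :: rcons (rcons s1 w) z).
  rewrite -!rcons_cons (ipath_rcons e_sym) zw fz /=.
  by move/ipath_behead: us; rewrite sE -cat_rcons -cat_cons => /ipath_catl.
have i1 : ipath (u :: rcons (k1 :: rcons s1 w) z).
  move: us; rewrite rcons_cons sE !ipath_cons => /and3P[-> fu _] /=.
  rewrite i2 andbT all_rcons (far_sym) zu.
  by move: fu; rewrite all_cat all_rcons /= => /and3P[-> ->].
have sub : {subset rcons s1 w <= s'}.
  by move=> y; rewrite sE -cat_rcons mem_cat => ->.
have nY' : ~~ has (complete Y) (rcons s1 w).
  by apply: contra nY => /hasP[y /sub ys Yy]; apply/hasP; exists y.
have nT' : ~~ has (complete T) (k1 :: rcons s1 w).
  apply: contra nT => /hasP[y ys Ty]; apply/hasP; exists y => //.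
  by move: ys; rewrite !inE => /orP[->//|/sub ->]; rewrite orbT.
have := RT _ _ _ i1 Tu Tz nT' isT; rewrite /= (RY _ _ _ i2 Yk1 Yz nY') //.
by case: (s1).
Qed.

(** By [leap_outer] the vertex [z] sees nothing on [s], so the leap can be prolonged by [t] and [z];
    the parity from [odd_between_mixed] contradicts the even hole. *)
Lemma no_leap T S t u s v z k1 m k2 : odd_between T -> odd_between S -> apath u s v -> e u v -> 2 <= size s ->
  complete T u -> complete T v -> ~~ has (complete T) s -> complete T z -> far z u -> far z v ->
  {in s, forall w, e w z -> ~~ e w u && ~~ e w v} ->
  t \in T -> {subset S <= T} -> ~~ complete S t -> {in s, forall y, ~~ (complete S y && e t y)} ->
  s = k1 :: rcons m k2 -> ~~ has (complete S) m -> ~~ has (e t) m -> complete S k1 -> e t k2 -> False.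
Proof.
move=> RT RS ap uv s2 Tu Tv nT Tz zu zv star tT ST nSt dj sE nSm ntm Sk1 tk2.
have em : ~~ odd (size m).
  by have := apath_even ap uv s2; rewrite sE /= size_rcons /= negbK.
have Sz : complete S z by apply: complete_sub Tz.
have tz : e t z by rewrite e_sym; move/allP: Tz; apply.
have [us sv _] := and3P ap.
have k1s : k1 \in s by rewrite sE mem_head.
have k2s : k2 \in s by rewrite sE inE mem_rcons inE eqxx orbT.
have uk1 : e u k1 by move: us; rewrite sE ipath_cons => /and3P[].
have ntk1 : ~~ e t k1 by have := dj k1 k1s; rewrite Sk1.
have nSk2 : ~~ complete S k2 by have := dj k2 k2s; rewrite tk2 andbT.
have k1z : ~~ e k1 z by apply/negP => /(star _ k1s); rewrite e_sym uk1.
rewrite sE in ap nT.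
have nSr : ~~ has (complete S) (rcons m k2) by rewrite has_rcons negb_or nSk2.
have nz := leap_outer RT RS ap Tu nT Tz zu k1z Sk1 nSr Sz.
have fz : all (far z) (k1 :: rcons m k2).
  apply/allP => y ys; apply/andP; split; last exact: nhas_e nz ys.
  by apply: contraNneq nT => zy; apply/hasP; exists y => //; rewrite -zy.
have tns : t \notin s.
  apply/negP => ts; have := ipath_ends e_sym e_irr s2 us sv ts.
  by rewrite (allP Tu _ tT) (allP Tv _ tT).
case/negP: em; apply: (odd_between_mixed (S := S) RS (t := t) (x := k1) (y := k2) (z := z)) => //.
  by move/ipath_behead: us; rewrite sE.
apply/allP => y; rewrite inE => ys; apply/andP; split.
  apply: contraNneq tns => ->; rewrite sE inE mem_rcons inE.
  by case/orP: ys => ->; rewrite ?orbT.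
by case/predU1P: ys => [->//|]; exact: nhas_e ntm.
Qed.

Lemma hat_exists T u s v z : anticonn T -> T != [::] -> apath u s v -> e u v -> 2 <= size s ->
  complete T u -> complete T v -> ~~ has (complete T) s -> complete T z -> far z u -> far z v ->
  {in s, forall w, e w z -> ~~ e w u && ~~ e w v} ->
  exists2 t, t \in T & ~~ has (e t) s.
Proof.
move=> cT T0 ap uv s2 Tu Tv nT Tz zu zv star; have RT := odd_between_anticonn cT.
suff : forall T', anticonn T' -> T' != [::] -> {subset T' <= T} -> ~~ has (complete T') s ->
    exists2 t, t \in T & ~~ has (e t) s by move/(_ T); apply.
elim=> [|t S IH] // cS _ sT nS.
have tT : t \in T by apply: sT; rewrite mem_head.
have [ht|nt] := boolP (has (e t) s); last by exists t.
have ST : {subset S <= T} by move=> y yS; apply: sT; rewrite inE yS orbT.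
have [S0|S0] := eqVneq S [::].
  by move: nS; rewrite S0 (eq_has (complete1 t)) ht.
have /= /andP[] := cS; rewrite (negbTE S0) /= => nSt cS'.
have [hS|] := boolP (has (complete S) s); last exact: IH.
have RS := odd_between_anticonn cS'.
have dj : {in s, forall y, ~~ (complete S y && e t y)}.
  move=> y ys; apply: contra nS => /andP[Sy ty]; apply/hasP; exists y => //.
  by apply/andP; rewrite e_sym.
have Tt y : complete T y -> e t y by move=> /allP/(_ _ tT); rewrite e_sym.
have TS y : complete T y -> complete S y by apply: complete_sub.
have [k1 [m [k2 [sE nSm ntm lp]]]] :=
  double_label RS ap s2 (apath_even ap uv s2) (TS _ Tu) (TS _ Tv) (Tt _ Tu) (Tt _ Tv) nSt dj hS ht.
exfalso; case/orP: lp => /andP[h1 h2].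
  exact: (no_leap RT RS ap uv s2 Tu Tv nT Tz zu zv star tT ST nSt dj sE nSm ntm h1 h2).
have sE' : rev s = k2 :: rcons (rev m) k1 by rewrite sE rev_cons rev_rcons.
apply: (no_leap (T := T) (S := S) (t := t) (u := v) (v := u) (s := rev s) (m := rev m) (k1 := k2) (k2 := k1) (z := z) RT RS) => //;
  rewrite ?has_rev ?size_rev //.
- by rewrite -(apath_rev e_sym).
- by rewrite e_sym.
- by move=> y; rewrite mem_rev => ys yz; rewrite andbC star.
by move=> y; rewrite mem_rev; apply: dj.
Qed.

Lemma ipath_path x s : ipath (x :: s) -> path e x s.
Proof. by elim: s x => [|y s IH] x //; rewrite ipath_cons => /and3P[xy _ /IH /= ->]; rewrite xy. Qed.

(** * Snakes *)

(** [S3] and [S4] appear with both ends exposed, as [c :: rcons g c'] and [d :: rcons h d']: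
    positive length is built in and reversal merely permutes the arguments. *)
Record snake a s1 b s2 c g c' d h d' : Prop := Snake {
  snake1 : ipath (a :: s1);
  snake2 : ipath (b :: s2);
  snake3 : ipath (c :: rcons g c');
  snake4 : ipath (d :: rcons h d');
  snake_ac : e (last a s1) c;
  snake_ad : e (last a s1) d;
  snake_cd : e c d;
  snake_bc : e (last b s2) c';
  snake_bd : e (last b s2) d';
  snake_cd' : e c' d';
  snake12 : anti_seq e (a :: s1) (b :: s2);
  snake13 : forall x y, x \in a :: s1 -> y \in c :: rcons g c' -> far x y \/ x = last a s1 /\ y = c;
  snake14 : forall x y, x \in a :: s1 -> y \in d :: rcons h d' -> far x y \/ x = last a s1 /\ y = d;
  snake23 : forall x y, x \in b :: s2 -> y \in c :: rcons g c' -> far x y \/ x = last b s2 /\ y = c';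
  snake24 : forall x y, x \in b :: s2 -> y \in d :: rcons h d' -> far x y \/ x = last b s2 /\ y = d';
  snake34 : linked (c :: rcons g c') (d :: rcons h d') c d c' d' }.

Lemma mem_rev_ends (x y z : V) g : (z \in y :: rcons (rev g) x) = (z \in x :: rcons g y).
Proof. by rewrite !inE !mem_rcons !inE mem_rev orbCA. Qed.

Lemma snake_rev a s1 b s2 c g c' d h d' : snake a s1 b s2 c g c' d h d' ->
  snake b s2 a s1 c' (rev g) c d' (rev h) d.
Proof.
case=> i1 i2 i3 i4 ac ad cd bc bd cd' H12 H13 H14 H23 H24 H34.
split; rewrite ?(ipath_rev_ends e_sym) //.
- by rewrite (anti_seqC e_sym).
- by move=> x y xs; rewrite mem_rev_ends; apply: H23.
- by move=> x y xs; rewrite mem_rev_ends; apply: H24.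
- by move=> x y xs; rewrite mem_rev_ends; apply: H13.
- by move=> x y xs; rewrite mem_rev_ends; apply: H14.
move=> x y; rewrite !mem_rev_ends => xs ys.
case: (H34 x y xs ys) => [H|H|H]; [by constructor 1|by constructor 3|by constructor 2].
Qed.

Lemma snake_swap a s1 b s2 c g c' d h d' : snake a s1 b s2 c g c' d h d' ->
  snake a s1 b s2 d h d' c g c'.
Proof.
case=> i1 i2 i3 i4 ac ad cd bc bd cd' H12 H13 H14 H23 H24 H34; split => //; rewrite 1?e_sym //.
move=> x y xs ys; case: (H34 y x ys xs) => [H|[-> ->]|[-> ->]].
- by constructor 1; rewrite (far_sym).
- by constructor 2.
by constructor 3.
Qed.

Section Snake.

Variables (a : V) (s1 : seq V) (b : V) (s2 : seq V) (c : V) (g : seq V) (c' d : V) (h : seq V) (d' : V).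
Hypothesis sn : snake a s1 b s2 c g c' d h d'.

Lemma snake_neq : c != c' /\ d != d'.
Proof.
have := ipath_uniq e_irr (snake3 sn); have := ipath_uniq e_irr (snake4 sn).
by rewrite /= !mem_rcons !inE !negb_or => /andP[/andP[-> _] _] /andP[/andP[-> _] _].
Qed.

Lemma snake_b_far z : z \in b :: s2 -> far z c /\ far z d.
Proof.
have [cc' dd'] := snake_neq; move=> zs; split.
  by case: (snake23 sn zs (mem_head _ _)) => // [[_ E]]; rewrite E eqxx in cc'.
by case: (snake24 sn zs (mem_head _ _)) => // [[_ E]]; rewrite E eqxx in dd'.
Qed.

Lemma snake_a_tail x y : x \in a :: s1 ->
  (y \in rcons g c' -> far x y) /\ (y \in rcons h d' -> far x y).
Proof.
move=> xs; have /= /andP[cg _] := ipath_uniq e_irr (snake3 sn).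
have /= /andP[dh _] := ipath_uniq e_irr (snake4 sn); split=> ys.
  have ys' : y \in c :: rcons g c' by rewrite inE ys orbT.
  by case: (snake13 sn xs ys') => // [[_ yc]]; rewrite -yc ys in cg.
have ys' : y \in d :: rcons h d' by rewrite inE ys orbT.
by case: (snake14 sn xs ys') => // [[_ yd]]; rewrite -yd ys in dh.
Qed.

Lemma snake_a_belast x y : x \in belast a s1 ->
  (y \in c :: rcons g c' -> far x y) /\ (y \in d :: rcons h d' -> far x y).
Proof.
move=> xb; have ne : x != last a s1.
  have := ipath_uniq e_irr (snake1 sn); rewrite lastI rcons_uniq => /andP[lb _].
  by apply: contraNneq lb => <-.
have xs : x \in a :: s1 by rewrite lastI mem_rcons inE xb orbT.
split=> ys.
  by case: (snake13 sn xs ys) => // [[E]]; rewrite E eqxx in ne.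
by case: (snake14 sn xs ys) => // [[E]]; rewrite E eqxx in ne.
Qed.

Let s := rcons g c' ++ d' :: rev h.

Lemma snake_cd_far z y : z \in c :: rcons g c' -> y \in d :: rcons h d' ->
  (z != c) || (y != d) -> (z != c') || (y != d') -> far z y.
Proof.
move=> zs ys n1 n2; case: (snake34 sn zs ys) => // [[E1 E2]|[E1 E2]].
  by rewrite E1 E2 !eqxx in n1.
by rewrite E1 E2 !eqxx in n2.
Qed.

(** [S3], [S4] and the edges [c d], [c' d'] form a hole, opened here at [c d]; the last vertex of
    [S1] is a hat for this edge. *)
Lemma snake_apath : apath c s d.
Proof.
have [cc' dd'] := snake_neq.
have hr : ipath (d' :: rcons (rev h) d) by rewrite (ipath_rev_ends e_sym) (snake4 sn).
have ug := ipath_uniq e_irr (snake3 sn); have uh := ipath_uniq e_irr (snake4 sn).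
have hd y : y \in h -> y != d /\ y != d'.
  move=> yh; split; first by apply: contraTneq uh => <-; rewrite /= mem_rcons inE yh orbT.
  by apply: contraTneq uh => <-; rewrite /= rcons_uniq yh andbF.
have gc z : z \in g -> z != c /\ z != c'.
  move=> zg; split; first by apply: contraTneq ug => <-; rewrite /= mem_rcons inE zg orbT.
  by apply: contraTneq ug => <-; rewrite /= rcons_uniq zg andbF.
apply/and3P; split; last by apply: contraTneq (snake_cd sn) => ->; rewrite e_irr.
- rewrite /s -cat_cons -rcons_cons ipath_cat rcons_cons (snake3 sn) (snake_cd' sn) /=.
  have -> : ipath (d' :: rev h) by move: hr; rewrite -rcons_cons -cats1 => /ipath_catl.
  rewrite /=; apply/andP; split.
    apply/allP => y; rewrite mem_rev => yh; have [yd yd'] := hd y yh.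
    by apply: snake_cd_far; rewrite ?inE ?mem_rcons ?inE ?eqxx ?yh ?orbT ?yd ?yd' ?orbT.
  apply/anti_seqP => z y zs ys; apply: snake_cd_far.
  + by move: zs; rewrite !inE mem_rcons inE => /orP[] ->; rewrite ?orbT.
  + by move: ys; rewrite !inE mem_rcons inE mem_rev => /orP[] ->; rewrite ?orbT.
  + move: ys; rewrite inE mem_rev => /predU1P[->|/hd[-> _]]; last by rewrite orbT.
    by rewrite [d' == d]eq_sym dd' orbT.
  move: zs; rewrite inE => /predU1P[->|/gc[_ ->] //]; by rewrite cc'.
rewrite /s rcons_cat rcons_cons ipath_cat (ipath_behead (snake3 sn)) hr (snake_cd' sn) /=.
apply/andP; split.
  apply/allP => y; rewrite mem_rcons inE mem_rev => yh; apply: snake_cd_far.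
  + by rewrite inE mem_rcons mem_head orbT.
  + by rewrite inE mem_rcons inE; case/orP: yh => ->; rewrite ?orbT.
  + by rewrite eq_sym cc'.
  by case/predU1P: yh => [->|/hd[_ ->]]; rewrite ?orbT // dd' orbT.
apply/anti_seqP => z y zs ys; have [zc zc'] := gc z zs; apply: snake_cd_far.
+ by rewrite inE mem_rcons inE zs !orbT.
+ by move: ys; rewrite mem_rev_ends.
+ by rewrite zc.
by rewrite zc'.
Qed.

Lemma snake_size : 2 <= size s.
Proof. by rewrite /s size_cat size_rcons /= addSn addnS. Qed.

Lemma snake_hat : ~~ has (e (last a s1)) s.
Proof.
apply/hasPn => y; rewrite /s mem_cat => ys; have [H1 H2] := snake_a_tail y (mem_last a s1).
case/orP: ys => [/H1/andP[]//|yh]; have /H2/andP[] // : y \in rcons h d'.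
by move: yh; rewrite mem_rcons !inE mem_rev.
Qed.

(* A walk from a to the hole s starts at the vertex last a s1 of the first triangle. *)
Lemma snake_hat_walk u t v L : apath u t v -> e u v -> 2 <= size t ->
  e (last a s1) u -> e (last a s1) v -> ~~ has (e (last a s1)) t ->
  {in belast a s1, forall z, far z u /\ far z v} ->
  path e a L -> all (fun w => ~~ e w u && ~~ e w v) L -> has (fun w => has (e w) t) L -> False.
Proof.
move=> ap uv t2 au av nt bl pL aL hL.
have rE : rev (a :: s1) = last a s1 :: rev (belast a s1) by rewrite lastI rev_rcons.
have P : path e (last a s1) (rev (belast a s1) ++ L).
  rewrite cat_path; have -> : last (last a s1) (rev (belast a s1)) = a.
    by rewrite -[LHS]/(last a (last a s1 :: rev (belast a s1))) -rE rev_cons last_rcons.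
  rewrite pL andbT; apply: ipath_path; rewrite -rE (ipath_rev e_sym); exact: snake1 sn.
apply: (hat_walk ap uv t2 au av nt P); last by rewrite has_cat hL orbT.
rewrite all_cat aL andbT all_rev; apply/allP => z /bl[/andP[_ ->] /andP[_ ->]] //.
Qed.

(** Otherwise the hat could walk back along [S1] to [a], then through [t] and [b] along [S2] to a
    neighbour of [c'], avoiding the neighbours of [c] and [d]. *)
Lemma snake_T_edge T t : complete T a -> complete T b -> t \in T -> e t c || e t d.
Proof.
move=> Ta Tb tT; apply/negPn/negP; rewrite negb_or => ntcd.
have [at' tb] : e a t /\ e t b by rewrite (e_sym t) (allP Ta) // (allP Tb).
apply: (snake_hat_walk (L := t :: b :: s2) snake_apath (snake_cd sn) snake_size
  (snake_ac sn) (snake_ad sn) snake_hat).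
- by move=> z zb; have [H1 H2] := snake_a_belast c zb; have [_ H3] := snake_a_belast d zb;
     split; [apply: H1|apply: H3]; exact: mem_head.
- by rewrite /= at' tb; apply: ipath_path; exact: snake2 sn.
- apply/allP => z; rewrite inE => /predU1P[->//|zs].
  by have [/andP[_ ->] /andP[_ ->]] := snake_b_far zs.
apply/hasP; exists (last b s2); first by rewrite inE mem_last orbT.
apply/hasP; exists c'; last exact: snake_bc sn.
by rewrite /s mem_cat mem_rcons mem_head.
Qed.

(** Otherwise an antipath joins [c] and [d] through [T]. A single interior vertex contradicts
    [snake_T_edge]; a longer antipath closes to an antihole through [b], which is complete to [T]
    and far from [c] and [d]. *)
Lemma snake_complete T : anticonn T -> complete T a -> complete T b -> complete T c || complete T d.
Proof.
move=> cT Ta Tb; apply/negPn/negP; rewrite negb_or => /andP[nc nd].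
have [fbc fbd] := snake_b_far (mem_head _ _).
have nT z : far b z -> z \notin T.
  by move=> /andP[_]; apply: contra => zT; apply: (allP Tb).
have cd : c != d by apply: contraTneq (snake_cd sn) => ->; rewrite e_irr.
have [q [ipq qT]] := antipath cT nc nd (nT c fbc) (nT d fbd) cd.
case: q ipq qT => [|t1 [|t2 q]] ipq qT.
- by move: ipq; rewrite ipath_cons /anti (snake_cd sn) andbF.
- have t1T : t1 \in T by apply: qT; rewrite inE.
  move: ipq; rewrite /= !ipath_cons => /and3P[/andP[_ t1c] _ /and3P[/andP[_ t1d] _ _]].
  by have := snake_T_edge Ta Tb t1T; rewrite e_sym (negbTE t1c) (negbTE t1d).
have ap : capath b (c :: [:: t1, t2 & q]) d.
  apply/and3P; split; last by case/andP: fbd.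
    apply: ipath_consI => //; first by move: ipq; rewrite -rcons_cons -cats1 => /ipath_catl.
    by apply/allP => z zq; rewrite (far_far) (allP Tb) // qT.
  exact: ipq.
exact: (no_antihole ap fbd isT).
Qed.

End Snake.

(** Special even pairs of the subgraph induced on [X], without a change of vertex type. *)
Definition special_in (X : {set V}) a b :=
  [/\ a != b, ~~ e a b,
      forall q, ipath (a :: rcons q b) -> {subset q <= X} -> odd (size q) &
      forall s1 s2 c g c' d h d', snake a s1 b s2 c g c' d h d' -> (s1 != [::]) || (s2 != [::]) ->
        {subset a :: s1 <= X} -> {subset b :: s2 <= X} -> {subset c :: rcons g c' <= X} ->
        {subset d :: rcons h d' <= X} -> False].

(** Serves to confine snakes: this path has at least two interior vertices, so facts about long
    chordless paths from [a] to [b] apply to it, and after [snake_swap] to [S4] as well. *)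
Lemma snake_path a s1 b s2 c g c' d h d' : snake a s1 b s2 c g c' d h d' ->
  ipath (a :: rcons (s1 ++ c :: rcons g c' ++ rev s2) b).
Proof.
move=> sn; have [cc' _] := snake_neq sn.
have -> : a :: rcons (s1 ++ c :: rcons g c' ++ rev s2) b =
    rcons (belast a s1) (last a s1) ++ c :: rcons g c' ++ rev (b :: s2).
  rewrite -lastI rev_cons rcons_cat rcons_cons rcons_cat; exact: erefl.
have i2 : ipath (c :: rcons g c' ++ rev (b :: s2)).
  have -> : rev (b :: s2) = last b s2 :: rev (belast b s2) by rewrite lastI rev_rcons.
  rewrite -cat_cons -rcons_cons ipath_cat rcons_cons (snake3 sn) e_sym (snake_bc sn).
  rewrite -rev_rcons -lastI (ipath_rev e_sym) (snake2 sn) /=.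
  have bb z : z \in rev (belast b s2) -> z \in b :: s2.
    by rewrite mem_rev lastI mem_rcons inE orbC => ->.
  have ub := ipath_uniq e_irr (snake2 sn); rewrite lastI rcons_uniq in ub.
  have ug := ipath_uniq e_irr (snake3 sn).
  apply/andP; split.
    apply/allP => z zb; rewrite (far_sym).
    case: (snake23 sn (bb z zb) (_ : c' \in c :: rcons g c')) => //; first by rewrite inE mem_rcons mem_head orbT.
    by case=> zl _; move: zb; rewrite mem_rev zl (negbTE (proj1 (andP ub))).
  apply/anti_seqP => x z xg zb; rewrite (far_sym).
  have zs : z \in b :: s2 by move: zb; rewrite mem_rev.
  have xs : x \in c :: rcons g c' by rewrite -rcons_cons mem_rcons inE xg orbT.
  case: (snake23 sn zs xs) => // [[_ xc]].
  by move: ug; rewrite -rcons_cons rcons_uniq -xc xg.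
rewrite ipath_cat -lastI (snake1 sn) (snake_ac sn) i2 /=; apply/andP; split.
  apply/allP => z; rewrite mem_cat mem_rev => /orP[zg|zb].
    exact: (snake_a_tail sn z (mem_last a s1)).1.
  exact: (anti_seqP _ _ _ (snake12 sn) _ _ (mem_last a s1)).
apply/anti_seqP => x z xb; have xs : x \in a :: s1 by rewrite lastI mem_rcons inE xb orbT.
rewrite -cat_cons mem_cat mem_rev => /orP[zg|zb].
  exact: (snake_a_belast sn z xb).1.
exact: (anti_seqP _ _ _ (snake12 sn)).
Qed.

(** * Outer paths and the vertices attached to a shortest one *)

Section Outer.

Variables (X : {set V}) (T : seq V).
Hypotheses (cT : anticonn T) (T0 : T != [::]).

Definition C : pred V := fun z => (z \in X) && complete T z.
Definition rest : pred V := fun w => [&& w \in X, w \notin T & ~~ complete T w].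

(* Otherwise w could be added to T, with x and y remaining complete to it. *)
Hypothesis star : forall w x y, rest w -> C x -> C y -> e w x -> e w y -> x != y -> e x y.

Definition outer x s y := [&& ipath (x :: rcons s y), C x, C y, all rest s & s != [::]].

(* r1 R0 r2 is the interior of a shortest outer path. *)
Record shortest (r1 : V) (R0 : seq V) (r2 : V) : Prop := Shortest {
  short_path : ipath (r1 :: rcons R0 r2);
  short_rest : all rest (r1 :: rcons R0 r2);
  short_odd : odd (size R0);
  short_min : forall x s y, outer x s y -> (size R0).+2 <= size s }.

(* For R = r1 R0 r2, A and B below are the complete vertices whose only neighbour on R is r1,
   respectively r2. *)
Definition attach r R z := [&& C z, e z r & ~~ has (e z) R].

Local Notation A r1 R0 r2 := (attach r1 (rcons R0 r2)).
Local Notation B r1 R0 r2 := (attach r2 (rcons (rev R0) r1)).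

Lemma outer_odd x s y : outer x s y -> odd (size s).
Proof.
case/and5P=> ip /andP[_ Tx] /andP[_ Ty] rs s0; apply: (odd_between_anticonn cT ip) => //.
by apply/hasPn => z /(allP rs)/and3P[].
Qed.

Lemma shortest_rev r1 R0 r2 : shortest r1 R0 r2 -> shortest r2 (rev R0) r1.
Proof.
case=> H1 H2 H3 H4; split; rewrite ?size_rev //.
  by rewrite (ipath_rev_ends e_sym).
by move: H2; rewrite /= !all_rcons all_rev andbCA.
Qed.

Lemma C_rest z w : C z -> rest w -> z != w.
Proof. by move=> /andP[_ Tz] /and3P[_ _]; apply: contraNneq => <-. Qed.

Lemma C_rest_far z s : C z -> all rest s -> ~~ has (e z) s -> all (far z) s.
Proof.
move=> Cz /allP rs ns; apply/allP => w ws.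
by rewrite /anti (C_rest Cz (rs w ws)) (nhas_e ns ws).
Qed.

Section Short.

Variables (r1 : V) (R0 : seq V) (r2 : V).
Hypothesis sR : shortest r1 R0 r2.
Let R := r1 :: rcons R0 r2.

Lemma attach_clique x y : A r1 R0 r2 x -> A r1 R0 r2 y -> x != y -> e x y.
Proof.
case: sR => _ /andP[r1r _] _ _ /and3P[Cx xr1 _] /and3P[Cy yr1 _].
by apply: star r1r Cx Cy _ _; rewrite e_sym.
Qed.

Lemma attach_path a : A r1 R0 r2 a -> ipath (a :: R).
Proof.
case/and3P=> Ca ar na; apply: ipath_consI => //; first exact: short_path sR.
by apply: C_rest_far => //; case: sR => _ /andP[].
Qed.

(** If [v] and [a] were non-adjacent, [a], the part of [R] up to the first neighbour [w] of [v], and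
    [v] would form an outer path. By minimality it uses all of [R], so [w] is [r2] and [v] lies in
    [B]. *)
Lemma touch_attach v a : C v -> has (e v) R -> ~~ B r1 R0 r2 v -> A r1 R0 r2 a -> v != a -> e v a.
Proof.
move=> Cv hv nB Aa va; apply/negPn/negP => nva.
have Ca : C a by case/and3P: Aa.
have [s1 [w [s2 [sE vw ns1]]]] := has_first hv.
have rs1 : all rest (s1 ++ w :: s2) by rewrite -sE; exact: short_rest sR.
have O : outer a (rcons s1 w) v.
  apply/and5P; split=> //; last by case: (s1).
    rewrite -!rcons_cons (ipath_rcons e_sym) vw rcons_cons /=.
    have := attach_path Aa; rewrite sE -cat_rcons -cat_cons => /ipath_catl ->.
    rewrite /anti va nva /= andbT; apply: C_rest_far => //.
    by move: rs1; rewrite all_cat => /andP[].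
  by move: rs1; rewrite -cat_rcons all_cat => /andP[].
have s20 : size s2 = 0.
  have := short_min sR O; have := congr1 size sE; rewrite /= !size_rcons size_cat /=.
  by move: (size R0) (size s1) (size s2); clear; lia.
rewrite (size0nil s20) in sE; move: sE.
rewrite cats1 /R -rcons_cons => /rcons_inj[sE wE].
case/negP: nB; apply/and3P; split=> //; first by rewrite wE.
by rewrite has_rcons has_rev; rewrite -sE in ns1.
Qed.

End Short.

Lemma attach_rev r1 R0 r2 z : B r2 (rev R0) r1 z = A r1 R0 r2 z.
Proof. by rewrite revK. Qed.

(** [R] has an odd number of vertices, so an edge [x y] would close it to an odd hole. *)
Lemma attach_far r1 R0 r2 x y : shortest r1 R0 r2 -> A r1 R0 r2 x -> B r1 R0 r2 y -> far x y.
Proof.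
move=> sR Ax By; have [ipR rR oR _] := sR.
have ne : x != y.
  apply: contraTneq By => <-; rewrite /attach; case/and3P: Ax => _ _.
  by rewrite has_rcons negb_or => /andP[/negbTE-> _]; rewrite andbF.
rewrite /anti ne /=; apply/negP => xy.
have ipx := attach_path sR Ax.
have ipy := attach_path (shortest_rev sR) By.
have ap : apath x (r1 :: rcons R0 r2) y.
  by apply/and3P; split=> //; rewrite -(ipath_rev e_sym) rev_rcons rev_cons rev_rcons.
have s2 : 2 <= size (r1 :: rcons R0 r2) by rewrite /= size_rcons.
by case/negP: (apath_even ap xy s2); rewrite /= size_rcons /= negbK.
Qed.

Lemma touch_cases r1 R0 r2 v : shortest r1 R0 r2 -> C v -> has (e v) (r1 :: rcons R0 r2) ->
  [\/ A r1 R0 r2 v, B r1 R0 r2 v |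
      (forall a, A r1 R0 r2 a -> e v a) /\ (forall b, B r1 R0 r2 b -> e v b)].
Proof.
move=> sR Cv hv.
have [Av|nA] := boolP (A r1 R0 r2 v); first by constructor 1.
have [Bv|nB] := boolP (B r1 R0 r2 v); first by constructor 2.
constructor 3; split=> [a Aa|b Bb].
  by apply: (touch_attach sR) => //; apply: contraNneq nA => ->.
apply: (touch_attach (shortest_rev sR)) => //; last by apply: contraNneq nB => ->.
  by move: hv; rewrite /= !has_rcons has_rev orbCA.
by rewrite attach_rev.
Qed.

Lemma ipath_walk s y z : ipath s -> y \in s -> z \in s ->
  exists p, [/\ path e y p, last y p = z & {subset p <= s}].
Proof.
elim: s y z => [|x s IH] // y z ip ys zs.
have sub (p : seq V) : {subset p <= s} -> {subset p <= x :: s}.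
  by move=> H w /H; rewrite inE => ->; rewrite orbT.
move: ys zs; rewrite [y \in _]inE [z \in _]inE.
have [->|yx] := eqVneq y x; have [->|zx] := eqVneq z x; rewrite /=.
- by move=> _ _; exists [::].
- case: s ip IH sub => [|w s] // ip IH sub _ zs.
  have [p [H1 H2 H3]] := IH w z (ipath_behead ip) (mem_head _ _) zs.
  exists (w :: p); rewrite /= H1; move: ip; rewrite ipath_cons => /and3P[-> _ _].
  split=> // y'; rewrite inE => /predU1P[->|/H3 H]; last by rewrite inE H orbT.
  by rewrite !inE eqxx orbT.
- case: s ip IH sub => [|w s] // ip IH sub ys _.
  have [p [H1 H2 H3]] := IH y w (ipath_behead ip) ys (mem_head _ _).
  exists (rcons p x); rewrite rcons_path last_rcons H1 H2 e_sym.
  move: ip; rewrite ipath_cons => /and3P[-> _ _].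
  by split=> // y'; rewrite mem_rcons inE => /predU1P[->|/H3 H]; rewrite inE ?eqxx // H orbT.
move=> ys zs; have [p [H1 H2 H3]] := IH y z (ipath_behead ip) ys zs.
by exists p; split=> //; exact: sub.
Qed.

Lemma ipath_link s x y : ipath s -> has (e x) s -> has (e y) s -> far x y ->
  exists p, [/\ ipath (x :: rcons p y), {subset p <= s} & p != [::]].
Proof.
move=> ip /hasP[x' x's xx'] /hasP[y' y's yy'] /andP[xy nxy].
have [p [H1 H2 H3]] := ipath_walk ip x's y's.
have W : path e x (rcons (x' :: p) y) by rewrite rcons_path /= xx' H1 H2 e_sym.
have [q [ipq qs]] := walk_rcons_ipath e_irr W xy.
exists q; split=> //; first by move=> z /qs; rewrite inE => /predU1P[->//|/H3].
by apply: contraNneq nxy => q0; move: ipq; rewrite q0 ipath_cons => /and3P[].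
Qed.

Lemma uniq_split (s1 s2 s3 s4 : seq V) x : uniq (s1 ++ x :: s2) ->
  s1 ++ x :: s2 = s3 ++ x :: s4 -> s1 = s3 /\ s2 = s4.
Proof.
elim: s1 s3 => [|y s1 IH] [|z s3] /=.
- by move=> _ [].
- by move=> /andP[xs _] [zx E]; rewrite E mem_cat inE eqxx orbT in xs.
- by move=> /andP[ys _] [yx E]; rewrite yx mem_cat inE eqxx orbT in ys.
by move=> /andP[_ us] [-> E]; have [-> ->] := IH s3 us E.
Qed.

(** * Chordless paths of odd length from A to B *)

Section OddPath.

Variables (r1 : V) (R0 : seq V) (r2 : V).
Hypothesis sR : shortest r1 R0 r2.
Local Notation R := (r1 :: rcons R0 r2).

Variables (a : V) (q : seq V) (b : V).
Hypotheses (Aa : A r1 R0 r2 a) (Bb : B r1 R0 r2 b) (ipQ : ipath (a :: rcons q b)).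
Hypotheses (qX : {subset q <= X}) (nAq : ~~ has (A r1 R0 r2) q) (nBq : ~~ has (B r1 R0 r2) q).
Hypothesis (q2 : 2 <= size q).

Lemma odd_ends z : z \in q -> ~~ (e a z && e b z).
Proof.
apply: (ipath_ends e_sym e_irr q2); last exact: ipath_behead ipQ.
by move: ipQ; rewrite -rcons_cons -cats1 => /ipath_catl.
Qed.

(** A T-complete vertex that touches [R] outside [A] and [B] would be adjacent to both [a] and
    [b]. *)
Lemma odd_untouch z : z \in q -> complete T z -> ~~ has (e z) R.
Proof.
move=> zq Tz; apply/negP => tz; have Cz : C z by rewrite /C (qX zq).
case: (touch_cases sR Cz tz) => [Az|Bz|[H1 H2]].
- by case/hasP: nAq; exists z.
- by case/hasP: nBq; exists z.
by case/negP: (odd_ends zq); rewrite e_sym H1 // e_sym H2.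
Qed.

Lemma odd_Ca : C a. Proof. by case/and3P: Aa. Qed.
Lemma odd_Cb : C b. Proof. by case/and3P: Bb. Qed.

Lemma odd_notin_T z : z \in a :: rcons q b -> z \notin T.
Proof.
have [/andP[_ Ta] /andP[_ Tb]] := (odd_Ca, odd_Cb).
rewrite inE mem_rcons inE => /or3P[/eqP->|/eqP->|zq]; [exact: complete_notin|exact: complete_notin|].
apply/negP => zT; have /negP := odd_ends zq; apply.
by rewrite (allP Ta) // (allP Tb).
Qed.

Lemma odd_X z : z \in a :: rcons q b -> z \in X.
Proof.
have [/andP[aX _] /andP[bX _]] := (odd_Ca, odd_Cb).
by rewrite inE mem_rcons inE => /or3P[/eqP->|/eqP->|/qX].
Qed.

(** As [u] and [v] are the only T-complete vertices of the hole, [hat_exists] with [b] as outside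
    vertex gives a hat in [T]. It walks through [b] and back along [R] to a neighbour of [h], which
    lies on the hole. *)
Lemma odd_hole u v L L' s h : a :: rcons q b = L ++ u :: v :: L' -> apath v s u ->
  2 <= size s -> complete T u -> complete T v -> ~~ has (complete T) s ->
  {subset s <= (a :: rcons q b) ++ R} -> v != b -> (e b v -> b \in s) ->
  h \in s -> h \in R -> (u = a -> h = r1) -> False.
Proof.
move=> QE ap s2 Tu Tv nT sQ vb bv hs hR ua.
have uQ : uniq (a :: rcons q b) by apply: ipath_uniq ipQ.
have [Ca Cb] := (odd_Ca, odd_Cb).
have [ipR rR oR _] := sR.
have uv : e v u by move: ipQ; rewrite QE => /ipath_catr; rewrite ipath_cons e_sym => /and3P[].
have uinQ : u \in a :: rcons q b by rewrite QE mem_cat inE eqxx orbT.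
have vinQ : v \in a :: rcons q b by rewrite QE mem_cat !inE eqxx !orbT.
have [Cu Cv] : C u /\ C v by rewrite /C Tu Tv !odd_X.
have bs : b \notin s by apply: contra nT => bs; apply/hasP; exists b => //; case/andP: Cb.
have nbv : ~~ e b v by apply: contra bs.
have va : v != a.
  apply: contraTneq uQ => va; rewrite QE va; case: (L) QE => [|y L2] [-> QE].
    by rewrite /= inE eqxx.
  by rewrite /= mem_cat !inE eqxx !orbT.
have ub : u != b.
  apply: contraTneq uQ => ub; rewrite -rcons_cons rcons_uniq; apply/nandP; left; rewrite negbK.
  have := QE; rewrite ub; case/lastP: (L') => [|L2 y].
    rewrite -[_ :: [:: v]]/(rcons [:: b] v) -rcons_cat -rcons_cons => /rcons_inj[-> _].
    by rewrite mem_cat inE eqxx orbT.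
  rewrite -!rcons_cons -rcons_cat => /rcons_inj[-> _].
  by rewrite mem_cat inE eqxx orbT.
have vq : v \in q by move: vinQ; rewrite inE mem_rcons inE (negbTE va) (negbTE vb).
have nbu : ~~ e b u.
  apply/negP => bu; have ua' : u \in a :: q.
    by move: uinQ; rewrite -rcons_cons mem_rcons inE (negbTE ub).
  have [s' E] := ipath_last_adj e_sym (ipQ : ipath (rcons (a :: q) b)) ua' bu.
  have := QE; rewrite -rcons_cons E -cats1 cat_rcons => E2.
  have [] := uniq_split _ E2; first by move: uQ; rewrite -rcons_cons E -cats1 cat_rcons.
  by move=> _ [bv' _]; rewrite bv' eqxx in vb.
have fbu : far b u by rewrite /anti nbu eq_sym ub.
have fbv : far b v by rewrite /anti nbv eq_sym vb.
have rs w : w \in s -> rest w.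
  move=> ws; have := sQ w ws; rewrite mem_cat => /orP[wQ|/(allP rR)//].
  rewrite /rest odd_X // odd_notin_T //=.
  by apply: contra nT => Tw; apply/hasP; exists w.
have st : {in s, forall w, e w b -> ~~ e w v && ~~ e w u}.
  move=> w ws wb; apply/andP; split; apply/negP => H.
    by case/negP: nbv; apply: (star (rs w ws)) => //; rewrite eq_sym.
  by case/negP: nbu; apply: (star (rs w ws)) => //; rewrite eq_sym.
have [t tT nts] := hat_exists cT T0 ap uv s2 Tv Tu nT (proj2 (andP Cb)) fbv fbu st.
have te y : C y -> e t y by case/andP=> _ /allP/(_ t tT); rewrite e_sym.
have nv w : w \in R -> ~~ e w v.
  by move=> wR; rewrite e_sym; apply: nhas_e wR; apply: odd_untouch.
have br2 : e b r2 by case/and3P: Bb.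
(* For [u = a] the walk must stop short of [r1], a neighbour of [a]; in this case [h] is [r1], and
   the vertex before it on the walk is already adjacent to it. *)
have [ua'|ua'] := eqVneq u a.
  have hr := ua ua'.
  have P : path e t (b :: rev (rcons R0 r2)).
    rewrite rev_rcons /= te // br2 /=; apply: ipath_path.
    by move/ipath_behead: ipR; rewrite -(ipath_rev e_sym) rev_rcons.
  apply: (hat_walk ap uv s2 (te v Cv) (te u Cu) nts P).
    rewrite /= nbv nbu /=; apply/allP => w; rewrite mem_rev => wR.
    rewrite nv ?inE ?wR ?orbT //= ua' e_sym.
    by case/and3P: Aa => _ _ /nhas_e; apply.
  case: R0 ipR oR hR {hs} (hs) => [|y R1] // ipR' _ _ hs'.
  apply/hasP; exists y; first by rewrite inE mem_rev rcons_cons inE eqxx orbT.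
  apply/hasP; exists h => //; rewrite hr e_sym.
  by move: ipR'; rewrite rcons_cons ipath_cons => /and3P[].
have uq : u \in q by move: uinQ; rewrite inE mem_rcons inE (negbTE ua') (negbTE ub).
have P : path e t (b :: rev R).
  rewrite rev_cons rev_rcons /= te // br2 /=; apply: ipath_path.
  by move: ipR; rewrite -(ipath_rev e_sym) rev_cons rev_rcons.
apply: (hat_walk ap uv s2 (te v Cv) (te u Cu) nts P).
  rewrite /= nbv nbu /=; apply/allP => w; rewrite mem_rev => wR; rewrite nv //= e_sym.
  by apply: nhas_e wR; apply: odd_untouch.
have [h' h'R hh'] : exists2 h', h' \in R & e h h'.
  move: hR; rewrite inE => /predU1P[->|hR]; last exact: ipath_nbr _ _ _ ipR hR.
  case: (R0) ipR => [|y R1]; rewrite ?rcons_cons ipath_cons => /and3P[H _ _].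
    by exists r2; rewrite // !inE eqxx orbT.
  by exists y; rewrite // !inE eqxx orbT.
apply/hasP; exists h'; first by rewrite inE mem_rev h'R orbT.
by apply/hasP; exists h; rewrite // e_sym.
Qed.

End OddPath.

Lemma attach_nbr r1 R0 r2 a h : A r1 R0 r2 a -> h \in r1 :: rcons R0 r2 -> e a h -> h = r1.
Proof.
case/and3P=> _ _ na; rewrite inE => /predU1P[//|hR] ah.
by case/negP: (nhas_e na hR).
Qed.

Lemma short_touch r1 R0 r2 h : shortest r1 R0 r2 -> h \in r1 :: rcons R0 r2 ->
  has (e h) (r1 :: rcons R0 r2).
Proof.
move=> sR hR; have [ipR _ _ _] := sR; apply/hasP.
move: hR; rewrite inE => /predU1P[->|hR]; last exact: ipath_nbr _ _ _ ipR hR.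
case: (R0) ipR => [|y R1]; rewrite ?rcons_cons ipath_cons => /and3P[H _ _].
  by exists r2; rewrite // !inE eqxx orbT.
by exists y; rewrite // !inE eqxx orbT.
Qed.

(** Otherwise the path has an odd number of T-complete edges. Cut it at the vertices with a
    neighbour on [R]: some segment has an odd number of them, and closing it through [R] gives a
    hole. Parity on this hole leaves one complete edge and no further complete vertex, the situation
    of [odd_hole]. *)
Lemma odd_attach r1 R0 r2 a q b : shortest r1 R0 r2 -> A r1 R0 r2 a -> B r1 R0 r2 b ->
  ipath (a :: rcons q b) -> {subset q <= X} -> ~~ odd (size q) ->
  has (A r1 R0 r2) q || has (B r1 R0 r2) q.
Proof.
move=> sR Aa Bb ip qX eq; apply/negPn/negP; rewrite negb_or => /andP[nA nB].
have fab := attach_far sR Aa Bb; have [ab nab] := andP fab.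
have q2 : 2 <= size q.
  case: q ip eq {qX nA nB} => [|x [|y q]] //.
  by rewrite ipath_cons => /and3P[H]; rewrite H in nab.
have [/andP[_ Ta] /andP[_ Tb]] := (odd_Ca Aa, odd_Cb Bb).
have aR : e a r1 by case/and3P: Aa.
have bR : e b r2 by case/and3P: Bb.
have [ipR rR _ _] := sR.
pose c z := has (e z) (r1 :: rcons R0 r2).
have RT := odd_between_anticonn cT.
have nTR z : z \in r1 :: rcons R0 r2 -> ~~ complete T z by move=> /(allP rR)/and3P[].
have := odd_between_par (s := q) RT Ta Tb; rewrite (negbTE eq) => P.
have : par (both (complete T)) a (rcons q b) = false; last first.
  rewrite P // => l x m y r E _; apply: (@ipath_infix _ e l _ r).
  by rewrite cat_cons cat_rcons -E.
apply: (par_segments (c := c)); last 2 first.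
- by rewrite /c /= aR.
- by rewrite /c last_rcons /= has_rcons bR orbT.
move=> l x m y r QE cx cy nm; apply/negbTE/negP => parD.
have ipD : ipath (x :: rcons m y).
  by apply: (@ipath_infix _ e l _ r); rewrite cat_cons cat_rcons -QE.
have unt z := @odd_untouch _ _ _ sR a q b Aa Bb ip qX nA nB q2 z.
have xyQ z : z \in x :: rcons m y -> z \in a :: rcons q b.
  move=> zD; rewrite QE mem_cat; apply/orP; right.
  by rewrite -cat_rcons -cat_cons mem_cat zD.
have ends z : z \in x :: rcons m y -> complete T z -> c z -> z = a \/ z = b.
  move=> /xyQ; rewrite inE mem_rcons inE => /or3P[/eqP|/eqP|zq Tz cz]; [by left|by right|].
  by case/negP: (unt z zq Tz).
(* A T-complete edge with both ends touching [R] could only join [a] and [b]. *)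
have [m0|m0] := eqVneq m [::].
  move: parD; rewrite m0 /= addbF => /andP[Tx Ty].
  have xy : e x y by move: ipD; rewrite m0 ipath_cons => /and3P[].
  have xe : x = a \/ x = b by apply: ends; rewrite ?inE ?eqxx.
  have ye : y = a \/ y = b by apply: ends; rewrite ?inE ?mem_rcons ?inE ?eqxx ?orbT.
  case: xe ye xy => -> [] ->; rewrite ?e_irr // => H; first by rewrite H in nab.
  by rewrite e_sym H in nab.
have [l1 [u [v [l2 [DE /andP[Tu Tv]]]]]] := par_edge parD.
have [p [ipp pR p0]] := ipath_link ipR cx cy (ipath_ends_far ipD m0).
have amp : anti_seq e m p.
  apply/anti_seqP => z w zm wp; rewrite /anti.
  have nzR := hasPn nm z zm.
  rewrite (nhas_e nzR (pR _ wp)) andbT; apply: contraNneq nzR => ->.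
  exact: short_touch (pR _ wp).
have H := hole_two_paths e_sym e_irr ipD ipp amp m0 p0.
have HE : x :: m ++ y :: rev p = rcons l1 u ++ v :: l2 ++ rev p.
  by rewrite -cat_rcons -cat_cons DE cat_rcons -!catA.
have := hole_rot (size (rcons l1 u)) H; rewrite HE rot_size_cat cat_cons -!rcons_cat.
case/(apath_hole e_sym e_irr) => ap vu s2.
set s := l2 ++ rev p ++ l1; have {}ap : apath v s u by rewrite /s catA.
have {}s2 : 2 <= size s by rewrite /s catA.
have np : ~~ has (complete T) (rev p).
  by rewrite has_rev; apply/hasPn => z /pR/nTR.
have rp0 : rev p != [::] by rewrite -size_eq0 size_rev size_eq0.
(* One more complete vertex would force an odd number of complete edges besides [u v], hence an even
   total on the segment; the vertices taken from [R] contribute none. *)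
have nT : ~~ has (complete T) s.
  apply/negP => hs; have := odd_between_par_apath RT ap Tv Tu hs.
  rewrite (negbTE (apath_even ap vu s2)) /s !rcons_cat.
  have [p' E] : exists p', rcons l1 u = x :: p'.
    case: (l1) DE => [|y' l1'] /= [-> _]; first by exists [::].
    by exists (rcons l1' u).
  rewrite par_cat E par_skip //.
  move: parD; have -> : rcons m y = p' ++ v :: l2.
    by move: DE; rewrite -cat_rcons E => -[].
  have lp : last x p' = u by rewrite -[last x p']/(last x (x :: p')) -E last_rcons.
  rewrite par_cat lp /= /both Tu Tv /=.
  by case: (par _ x p'); case: (par _ v l2).
have sub1 z : z \in l1 ++ u :: v :: l2 -> z \in a :: rcons q b by rewrite -DE; exact: xyQ.
have sQ : {subset s <= (a :: rcons q b) ++ (r1 :: rcons R0 r2)}.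
  move=> z; rewrite /s !mem_cat mem_rev => /or3P[zs|/pR ->|zs]; rewrite ?orbT //.
    by rewrite sub1 // mem_cat !inE zs !orbT.
  by rewrite sub1 // mem_cat zs.
have QE' : a :: rcons q b = (l ++ l1) ++ u :: v :: l2 ++ r.
  by rewrite QE -(cat_rcons y) -cat_cons DE -!catA.
have uQ : uniq (a :: rcons q b) by apply: ipath_uniq ip.
have vy : l2 = [::] -> v = y.
  move=> l20; have := congr1 (last x) DE; by rewrite /= last_rcons last_cat l20.
have ux : l1 = [::] -> u = x by move=> l10; move: DE; rewrite l10 => -[].
(* [odd_hole] requires [v != b]. For [v = b] it is applied to the reversed path with [u] in the
   place of [v]; here [u != a], because [a] and [b] are non-adjacent. *)
have [vb|vb] := eqVneq v b; last first.
  have [h [ph hs]] : exists h, h \in p /\ e x h.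
    case: (p) ipp p0 => [|h p'] // + _; rewrite rcons_cons ipath_cons => /and3P[xh _ _].
    by exists h; rewrite mem_head.
  apply: (odd_hole sR Aa Bb ip qX nA nB q2 QE' ap s2 Tu Tv nT sQ vb _ _ (pR _ ph)).
  - move=> bv; have vaq : v \in a :: q.
      have : v \in a :: rcons q b by rewrite QE' mem_cat !inE eqxx !orbT.
      by rewrite -rcons_cons mem_rcons inE (negbTE vb).
    have [s' E] := ipath_last_adj e_sym (ip : ipath (rcons (a :: q) b)) vaq bv.
    have E2 : s' ++ v :: [:: b] = ((l ++ l1) ++ [:: u]) ++ v :: l2 ++ r.
      by rewrite -catA -QE' -rcons_cons E -cats1 cat_rcons.
    have [] := uniq_split _ E2; first by move: uQ; rewrite -rcons_cons E -cats1 cat_rcons.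
    move=> _; rewrite /s; case: (l2) vy => [/(_ erefl) vy _|w l2' _ [-> _]]; last by rewrite inE eqxx.
    case: (ends v) => //; rewrite ?vy ?inE ?mem_rcons ?inE ?eqxx ?orbT //; rewrite -?vy //.
      by move=> va; rewrite va e_sym (negbTE nab) in bv.
    by move=> vb'; rewrite vb' eqxx in vb.
  - by rewrite /s !mem_cat mem_rev ph orbT.
  move=> ua; apply: (attach_nbr Aa (pR _ ph)); rewrite -ua ux //.
  have [] := @uniq_split (l ++ l1) (v :: l2 ++ r) [::] (rcons q b) u.
  - by rewrite -QE'.
  - by rewrite -QE' ua.
  by case: (l) => //= _; case: (l1).
have l2r : l2 ++ r = [::].
  have QE2 : a :: rcons q b = ((l ++ l1) ++ [:: u]) ++ v :: (l2 ++ r).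
    by rewrite QE' -[RHS]catA.
  have [] := @uniq_split ((l ++ l1) ++ [:: u]) (l2 ++ r) (a :: q) [::] v.
  - by rewrite -QE2.
  - by rewrite -QE2 vb cats1.
  by [].
have l20 : l2 = [::] by case: (l2) l2r.
have uaN : u != a.
  by apply: contraNneq nab => <-; rewrite -vb e_sym.
have [h [ph hs]] : exists h, h \in p /\ e y h.
  case/lastP: (p) ipp p0 => [|p' h] // ipp' _.
  move: ipp'; rewrite -!rcons_cons (ipath_rcons e_sym) => /and3P[yh _ _].
  by exists h; rewrite mem_rcons mem_head.
have Aa' : B r2 (rev R0) r1 a by rewrite attach_rev.
have ip' : ipath (b :: rcons (rev q) a) by rewrite (ipath_rev_ends e_sym).
have qX' : {subset rev q <= X} by move=> z; rewrite mem_rev => /qX.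
have nA' : ~~ has (A r2 (rev R0) r1) (rev q) by rewrite has_rev.
have nB' : ~~ has (B r2 (rev R0) r1) (rev q).
  by rewrite has_rev; apply: contra nA => /hasP[z zq]; rewrite attach_rev => Az; apply/hasP; exists z.
have q2' : 2 <= size (rev q) by rewrite size_rev.
have QE3 : b :: rcons (rev q) a = rev (l2 ++ r) ++ v :: u :: rev (l ++ l1).
  have -> : b :: rcons (rev q) a = rev (a :: rcons q b) by rewrite rev_cons rev_rcons.
  by rewrite QE' (rev_cat (l ++ l1)) 2!rev_cons !cat_rcons.
have ap' : apath u (rev s) v by rewrite -(apath_rev e_sym).
have s2' : 2 <= size (rev s) by rewrite size_rev.
have nT' : ~~ has (complete T) (rev s) by rewrite has_rev.
have mR z : z \in r1 :: rcons R0 r2 -> z \in r2 :: rcons (rev R0) r1.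
  rewrite !inE !mem_rcons !inE mem_rev.
  by case/or3P=> ->; rewrite ?orbT.
have sQ' : {subset rev s <= (b :: rcons (rev q) a) ++ (r2 :: rcons (rev R0) r1)}.
  move=> z; rewrite mem_rev => /sQ; rewrite !mem_cat => /orP[zQ|/mR ->]; last by rewrite orbT.
  apply/orP; left; move: zQ; rewrite !inE !mem_rcons !inE mem_rev.
  by case/or3P=> ->; rewrite ?orbT.
apply: (odd_hole (shortest_rev sR) Bb Aa' ip' qX' nA' nB' q2' QE3 ap' s2' Tv Tu nT' sQ' uaN _ _ (mR _ (pR _ ph))).
- move=> au; rewrite mem_rev; have urq : u \in rcons q b.
    have : u \in a :: rcons q b by rewrite QE' mem_cat inE eqxx orbT.
    by rewrite inE (negbTE uaN).
  have [s' E] := ipath_head_adj ip urq au.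
  have [] := @uniq_split [:: a] s' (l ++ l1) (v :: l2 ++ r) u.
  - by move: uQ; rewrite E.
  - by rewrite -QE' E.
  move=> ll1 _; rewrite /s; case: (l1) ll1 ux => [|w l1'] E1 ux'.
    have ux1 := ux' erefl; case: (ends u) => //; rewrite ?ux1 ?inE ?eqxx // -?ux1.
      by move=> ua; rewrite ua eqxx in uaN.
    by move=> ub; rewrite ub vb e_irr in vu.
  case: (l) E1 => [|w' l'] /= [->]; first by rewrite !mem_cat inE eqxx !orbT.
  by case: (l').
- by rewrite mem_rev /s !mem_cat mem_rev ph orbT.
by move=> _; apply: (attach_nbr Bb (mR _ (pR _ ph))); rewrite -vb vy.
Qed.

(** * The strict order on A *)

Section Order.

Variables (r1 : V) (R0 : seq V) (r2 : V).
Hypothesis sR : shortest r1 R0 r2.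
Local Notation R := (r1 :: rcons R0 r2).
Local Notation A := (attach r1 (rcons R0 r2)).
Local Notation B := (attach r2 (rcons (rev R0) r1)).

(* Chordless paths of odd length from u to B start with some such v, so an end u that is maximal
   for this strict order has none. *)
Definition before u v := exists q b,
  [/\ A u, A v, B b, ipath (u :: v :: rcons q b) & {subset q <= X} /\ odd (size q)].

Lemma attach_C r S z : attach r S z -> C z.
Proof. by case/and3P. Qed.

Lemma attach_complete r S z : attach r S z -> complete T z.
Proof. by case/and3P=> /andP[]. Qed.

Lemma before_noA u v q : A u -> ipath (u :: v :: q) -> ~~ has A q.
Proof.
move=> Au; rewrite ipath_cons => /and3P[_ /allP fu _]; apply/hasPn => z zq.
have /andP[uz nuz] := fu z zq; apply: contra nuz => Az.
exact: (attach_clique sR).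
Qed.

(** A vertex [z] of [B] on [q] is adjacent to [b], hence last on [q]. Cut at [z], the path from [v]
    has odd length, and the vertex of [B] that [odd_attach] finds inside it would be a second
    neighbour of [b]. *)
Lemma before_noB u v q b : A u -> A v -> B b -> ipath (u :: v :: rcons q b) -> {subset q <= X} ->
  odd (size q) -> ~~ has B q.
Proof.
move=> Au Av Bb ip qX oq; apply/hasPn => z zq; apply/negP => Bz.
have nA := before_noA Au ip; rewrite has_rcons negb_or in nA; have [_ {}nA] := andP nA.
have ipq := ipath_behead ip; have := ipath_uniq e_irr ipq.
rewrite /= rcons_uniq => /and3P[_ bq uq].
have bz : e b z.
  by apply: (attach_clique (shortest_rev sR)) => //; apply: contraNneq bq => ->.
have [s' E] := ipath_last_adj e_sym (ipath_behead ipq) zq bz.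
have ipv : ipath (v :: rcons s' z).
  by move: ipq; rewrite E -cats1 -cat_cons => /ipath_catl.
have es : ~~ odd (size s') by move: oq; rewrite E size_rcons.
have sX : {subset s' <= X} by move=> y ys; apply: qX; rewrite E mem_rcons inE ys orbT.
case/orP: (odd_attach sR Av Bz ipv sX es) => /hasP[y ys].
  by apply/negP; move/hasPn: nA; apply; rewrite E mem_rcons inE ys orbT.
move=> By; have yz : y != z.
  by apply: contraTneq uq => yz; rewrite E -yz rcons_uniq ys.
have yb : e b y.
  apply: (attach_clique (shortest_rev sR)) => //.
  by apply: contraNneq bq => ->; rewrite E mem_rcons inE ys orbT.
have := ipath_behead ipq; rewrite E => /ipath_last_adj -/(_ e_sym y).
rewrite mem_rcons inE ys orbT => /(_ isT yb)[s3] /rcons_inj[_ zy].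
by rewrite zy eqxx in yz.
Qed.

(** * Antisymmetry: the hole formed by two opposite paths at their first contact *)

Section Contact.

Variables (u v : V) (m n : seq V) (b1 b2 : V).
Hypotheses (Au : A u) (Av : A v) (Bb1 : B b1) (Bb2 : B b2).
Hypotheses (ipM : ipath (u :: v :: rcons m b1)) (ipN : ipath (v :: u :: rcons n b2)).
Hypotheses (mX : {subset m <= X}) (nX : {subset n <= X}) (om : odd (size m)) (on : odd (size n)).

Local Notation M := (rcons m b1).
Local Notation N := (rcons n b2).

(* w is the first vertex of M with a neighbour on N, and y1 is its first neighbour there. *)
Variables (m1 : seq V) (w : V) (m2 n1 : seq V) (y1 : V) (n2 : seq V).
Hypotheses (ME : M = m1 ++ w :: m2) (NE : N = n1 ++ y1 :: n2).
Hypotheses (wy1 : e w y1) (nm1 : ~~ has (fun z => has (e z) N) m1) (nn1 : ~~ has (e w) n1).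

Lemma contact_uM z : z \in M -> far u z.
Proof. by move: ipM; rewrite ipath_cons => /and3P[_ /allP H _]; apply: H. Qed.

Lemma contact_vN z : z \in N -> far v z.
Proof. by move: ipN; rewrite ipath_cons => /and3P[_ /allP H _]; apply: H. Qed.

Lemma contact_uv : e u v.
Proof. by move: ipM; rewrite ipath_cons => /and3P[]. Qed.

Lemma contact_m1N z : z \in m1 -> z \notin N.
Proof.
move=> zm; apply/negP => zN.
have [y yN zy] := ipath_nbr (ipath_behead ipN) zN.
move: yN; rewrite inE => /predU1P[yu|yN].
  have /contact_uM/andP[_] : z \in M by rewrite ME mem_cat zm.
  by rewrite e_sym -yu zy.
by have /negP := hasPn nm1 z zm; apply; apply/hasP; exists y.
Qed.

Lemma contact_wN : w \notin N.
Proof.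
apply/negP => wN.
have ipm : ipath (rcons (v :: m1) w).
  by have := ipath_behead ipM; rewrite ME -cat_rcons -cat_cons -rcons_cons => /ipath_catl.
case/lastP: m1 ipm nm1 => [|m' z] ipm nm.
  have := contact_vN wN; rewrite /anti; move: ipm.
  by rewrite [rcons _ _]/= ipath_cons => /and3P[-> _ _]; rewrite andbF.
move: ipm; rewrite -rcons_cons (ipath_rcons e_sym) => /and3P[wz _ _].
move: nm; rewrite has_rcons negb_or => /andP[/negP nz _]; apply: nz.
by apply/hasP; exists w; rewrite // e_sym.
Qed.

Lemma contact_far z y : z \in u :: rcons n1 y1 -> y \in v :: rcons m1 w ->
  [\/ far z y, z = u /\ y = v | z = y1 /\ y = w].
Proof.
have sN x : x \in rcons n1 y1 -> x \in N by rewrite NE -cat_rcons mem_cat => ->.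
have sM x : x \in rcons m1 w -> x \in M by rewrite ME -cat_rcons mem_cat => ->.
rewrite inE => /predU1P[->|zN].
  rewrite inE => /predU1P[->|/sM/contact_uM]; [by constructor 2|by constructor 1].
rewrite inE => /predU1P[->|].
  by constructor 1; rewrite (far_sym); apply: contact_vN; apply: sN.
rewrite mem_rcons inE => /predU1P[->|ym]; last first.
  constructor 1; apply/andP; split; last first.
    by rewrite e_sym; have /hasPn := hasPn nm1 y ym; apply; apply: sN.
  by apply: contraNneq (contact_m1N ym) => <-; apply: sN.
move: zN; rewrite mem_rcons inE => /predU1P[->|zn]; first by constructor 3.
constructor 1; apply/andP; split; last by rewrite e_sym (nhas_e nn1 zn).
by apply: contraNneq contact_wN => <-; rewrite NE mem_cat zn.
Qed.

Let s := n1 ++ y1 :: w :: rev m1.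

Lemma contact_ipN : ipath (u :: rcons n1 y1).
Proof. by have := ipath_behead ipN; rewrite NE -cat_rcons -cat_cons => /ipath_catl. Qed.

Lemma contact_ipM : ipath (v :: rcons m1 w).
Proof. by have := ipath_behead ipM; rewrite ME -cat_rcons -cat_cons => /ipath_catl. Qed.

(** By [contact_far] the only edges between the two arms are [u v] and [y1 w]. *)
Lemma contact_apath : apath u s v.
Proof.
have uP := ipath_uniq e_irr contact_ipN; have uQ := ipath_uniq e_irr contact_ipM.
have wr : ipath (w :: rcons (rev m1) v) by rewrite (ipath_rev_ends e_sym) contact_ipM.
have F z y : z \in u :: rcons n1 y1 -> y \in v :: rcons m1 w -> (z != u) || (y != v) ->
    (z != y1) || (y != w) -> far z y.
  move=> zs ys; case: (contact_far zs ys) => // [[-> ->]|[-> ->]]; first by rewrite !eqxx.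
  by rewrite !eqxx.
have y1u : y1 != u by apply: contraTneq uP => ->; rewrite /= mem_rcons mem_head.
have wv : w != v by apply: contraTneq uQ => ->; rewrite /= mem_rcons mem_head.
have vm1 y : y \in m1 -> y != v.
  by move=> ym; apply: contraTneq uQ => <-; rewrite /= mem_rcons inE ym orbT.
have wm1 y : y \in m1 -> y != w.
  by move=> ym; apply: contraTneq uQ => <-; rewrite /= rcons_uniq ym andbF.
have n1y z : z \in n1 -> z != y1.
  by move=> zn; apply: contraTneq uP => <-; rewrite /= rcons_uniq zn andbF.
have n1u z : z \in n1 -> z != u.
  by move=> zn; apply: contraTneq uP => <-; rewrite /= mem_rcons inE zn orbT.
apply/and3P; split; last by apply: contraTneq contact_uv => ->; rewrite e_irr.
- rewrite /s -cat_rcons -cat_cons -rcons_cons ipath_cat rcons_cons contact_ipN e_sym wy1 /=.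
  have -> : ipath (w :: rev m1) by move: wr; rewrite -rcons_cons -cats1 => /ipath_catl.
  rewrite /=; apply/andP; split.
    apply/allP => y; rewrite mem_rev => ym; apply: F; rewrite ?inE ?mem_rcons ?inE ?eqxx ?ym ?orbT ?y1u //.
    by rewrite wm1 ?orbT.
  apply/anti_seqP => z y zs ys; apply: F.
  + by move: zs; rewrite !inE mem_rcons inE => /orP[] ->; rewrite ?orbT.
  + by move: ys; rewrite !inE mem_rcons inE mem_rev => /orP[] ->; rewrite ?orbT.
  + by move: ys; rewrite inE mem_rev => /predU1P[->|/vm1 ->]; rewrite ?wv orbT.
  by move: zs; rewrite inE => /predU1P[->|/n1y ->//]; rewrite eq_sym y1u.
rewrite /s rcons_cat !rcons_cons -cat_rcons ipath_cat e_sym wy1 wr (ipath_behead contact_ipN) /=.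
apply/andP; split.
  apply/allP => y; rewrite mem_rcons inE mem_rev => ym; apply: F.
  + by rewrite inE mem_rcons mem_head orbT.
  + by rewrite inE mem_rcons inE; case/orP: ym => ->; rewrite ?orbT.
  + by rewrite y1u.
  by case/predU1P: ym => [->|/wm1 ->]; rewrite ?orbT // eq_sym wv orbT.
apply/anti_seqP => z y zs ys; apply: F.
+ by rewrite inE mem_rcons inE zs !orbT.
+ by move: ys; rewrite !inE !mem_rcons !inE mem_rev => /or3P[] ->; rewrite ?orbT.
+ by rewrite n1u.
by rewrite n1y.
Qed.

Lemma contact_size : 2 <= size s.
Proof. by rewrite /s size_cat /= !addnS. Qed.

Lemma contact_even : ~~ odd (size n1 + size m1).
Proof.
have := apath_even contact_apath contact_uv contact_size.
by rewrite /s size_cat /= size_rev !addnS /= negbK.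
Qed.

Lemma contact_X z : z \in s -> z \in X.
Proof.
have [/andP[b1X _] /andP[b2X _]] := (attach_C Bb1, attach_C Bb2).
have NX x : x \in N -> x \in X by rewrite mem_rcons inE => /predU1P[->//|/nX].
have MX x : x \in M -> x \in X by rewrite mem_rcons inE => /predU1P[->//|/mX].
rewrite /s mem_cat !inE mem_rev => /or4P[zs|/eqP->|/eqP->|zs].
- by apply: NX; rewrite NE mem_cat zs.
- by apply: NX; rewrite NE mem_cat inE eqxx orbT.
- by apply: MX; rewrite ME mem_cat inE eqxx orbT.
by apply: MX; rewrite ME mem_cat zs.
Qed.

Lemma contact_ends z : z \in s -> ~~ (e u z && e v z).
Proof.
have [us sv _] := and3P contact_apath.
exact: (ipath_ends e_sym e_irr contact_size us sv).
Qed.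

Lemma contact_T z : z \in s -> z \notin T.
Proof.
move=> zs; apply/negP => zT; have /negP := contact_ends zs; apply.
by rewrite (allP (attach_complete Au) _ zT) (allP (attach_complete Av) _ zT).
Qed.

Lemma contact_rest z : z \in s -> ~~ complete T z -> rest z.
Proof. by move=> zs nT; rewrite /rest contact_X // contact_T. Qed.

Lemma contact_tail z : z \in n2 -> ~~ e z u && ~~ e z v.
Proof.
move=> zn; rewrite ![e z _]e_sym.
have zN : z \in N by rewrite NE mem_cat inE zn !orbT.
have /andP[_ ->] := contact_vN zN; rewrite andbT.
have : anti_seq e (u :: n1) n2.
  by apply: (@ipath_cat_anti _ e _ _ y1); rewrite cat_cons -NE; apply: ipath_behead ipN.
by move/anti_seqP => /(_ u z (mem_head _ _) zn)/andP[].
Qed.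

Lemma contact_b2 : last y1 n2 = b2.
Proof. by have := congr1 (last y1) NE; rewrite last_rcons last_cat. Qed.

Lemma contact_path z : e z b2 -> n2 != [::] -> path e z (rev n2).
Proof.
move=> zb2; case/lastP: n2 NE => [|n3 b] // NE' _.
have bE : b = b2.
  by have := congr1 (last y1) NE'; rewrite last_rcons last_cat /= last_rcons.
rewrite rev_rcons /= bE zb2 /=; apply: ipath_path; rewrite -rev_rcons (ipath_rev e_sym) -bE.
by have := ipath_behead (ipath_behead ipN); rewrite NE' => /ipath_catr/ipath_behead.
Qed.

Lemma contact_touch : n2 != [::] -> has (fun z => has (e z) s) (rev n2).
Proof.
move=> n20; rewrite has_rev; case: n2 n20 NE => [|z n3] // _ NE' /=.
suff -> : has (e z) s by [].
apply/hasP; exists y1; first by rewrite /s mem_cat inE eqxx orbT.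
rewrite e_sym; have := ipath_behead (ipath_behead ipN).
by rewrite NE' => /ipath_catr; rewrite ipath_cons => /and3P[].
Qed.

Lemma contact_fuv : [/\ e u v, far b2 u & far b2 v].
Proof.
by split; [exact: contact_uv|rewrite (far_sym) (attach_far sR)|
  rewrite (far_sym) (attach_far sR)].
Qed.

(** Otherwise [hat_exists] gives a hat in [T] for [u v], which walks to [b2] and back along [N] to a
    neighbour of [y1]. *)
Lemma contact_complete : has (complete T) s.
Proof.
apply/negPn/negP => nT; have [uv b2u b2v] := contact_fuv.
have [[Tu Tv] Tb] := (attach_complete Au, attach_complete Av, attach_complete Bb2).
have [_ nb2u] := andP b2u; have [_ nb2v] := andP b2v.
have st : {in s, forall x, e x b2 -> ~~ e x u && ~~ e x v}.
  move=> x xs xb; have rx : rest x.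
    apply: contact_rest => //; apply: contra nT => Tx.
    by apply/hasP; exists x.
  apply/andP; split; apply/negP => H.
    by case/negP: nb2u; apply: (star rx (attach_C Bb2) (attach_C Au)); case/andP: b2u.
  by case/negP: nb2v; apply: (star rx (attach_C Bb2) (attach_C Av)); case/andP: b2v.
have [t tT nts] := hat_exists cT T0 contact_apath uv contact_size Tu Tv nT Tb b2u b2v st.
have te y : complete T y -> e t y by move/allP/(_ t tT); rewrite e_sym.
have n20 : n2 != [::].
  apply: contraNneq nT => n20; apply/hasP; exists b2 => //.
  by rewrite -contact_b2 n20 /s mem_cat inE eqxx orbT.
apply: (hat_walk contact_apath uv contact_size (te u Tu) (te v Tv) nts
  (contact_path (te b2 Tb) n20)); last exact: contact_touch.
by apply/allP => z; rewrite mem_rev => /contact_tail.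
Qed.

(** Otherwise [r1] itself is a hat for [u v], and walks along [R] to [r2], then from [b2] back along
    [N]. If [n2] is empty, [b2] is [y1] and already lies on the hole. *)
Lemma contact_r1 : has (e r1) s.
Proof.
apply/negPn/negP => nr; have [uv b2u b2v] := contact_fuv.
have ru : e r1 u by rewrite e_sym; case/and3P: Au.
have rv : e r1 v by rewrite e_sym; case/and3P: Av.
have [ipR rR _ _] := sR.
have P1 : path e r1 (rcons R0 r2) by apply: ipath_path.
have b2r : e r2 b2 by rewrite e_sym; case/and3P: Bb2.
have fR z : z \in rcons R0 r2 -> ~~ e z u && ~~ e z v.
  move=> zR; rewrite ![e z _]e_sym; case/and3P: Au => _ _ /nhas_e->//.
  by case/and3P: Av => _ _ /nhas_e->.
have [n20|n20] := eqVneq n2 [::].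
  apply: (hat_walk contact_apath uv contact_size ru rv nr P1); first exact/allP.
  rewrite has_rcons; apply/orP; left; apply/hasP; exists b2 => //.
  by rewrite -contact_b2 n20 /s mem_cat inE eqxx orbT.
have P2 : path e r1 (rcons R0 r2 ++ rev n2).
  by rewrite cat_path P1 last_rcons contact_path.
apply: (hat_walk contact_apath uv contact_size ru rv nr P2).
  by apply/allP => z; rewrite mem_cat mem_rev => /orP[/fR|/contact_tail].
by rewrite has_cat contact_touch // orbT.
Qed.

Lemma contact_u_tail z : z \in n2 -> far u z.
Proof.
move=> zn; have : anti_seq e (u :: n1) n2.
  by apply: (@ipath_cat_anti _ e _ _ y1); rewrite cat_cons -NE; apply: ipath_behead ipN.
by move/anti_seqP; apply; rewrite ?mem_head.
Qed.

Lemma contact_wN_far y : y \in N -> ~~ e w y -> far w y.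
Proof. by move=> yN wy; rewrite /anti wy andbT; apply: contraNneq contact_wN => ->. Qed.

Lemma contact_m1N_far z y : z \in m1 -> y \in N -> far z y.
Proof.
move=> zm yN; apply/andP; split; last by have /hasPn := hasPn nm1 z zm; apply.
by apply: contraNneq (contact_m1N zm) => ->.
Qed.

(** The labels by [T] and by [r1] yield a leap on the hole, so at most its ends are T-complete.
    Applied to detours through [w], [odd_attach] leaves [y1] and the next vertex as the only
    neighbours of [w] on [N]. Roussel-Rubio parities then shrink one arm to a single vertex, and a
    path through [r1] and the other arm has odd length. *)
Lemma contact_false : False.
Proof.
have RT := odd_between_anticonn cT; have [uv b2u b2v] := contact_fuv.
have [[Tu Tv] Tb2] := (attach_complete Au, attach_complete Av, attach_complete Bb2).
have Tb1 := attach_complete Bb1.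
have [ipR /= /andP[rr1 _] _ _] := sR.
have nTr1 : ~~ complete T r1 by case/and3P: rr1.
have ur : e u r1 by case/and3P: Au.
have vr : e v r1 by case/and3P: Av.
have [ru rv] : e r1 u /\ e r1 v by rewrite !(e_sym r1).
have r1C z x : C z -> C x -> far x z -> e r1 x -> ~~ e r1 z.
  move=> Cz Cx /andP[xz nxz] rx; apply: contra nxz => rz.
  exact: (star rr1).
(* By [star], a vertex with both labels would be adjacent to [u] and to [v]. *)
have dj : {in s, forall z, ~~ (complete T z && e r1 z)}.
  move=> z zs; apply/negP => /andP[Tz rz].
  have Cz : C z by rewrite /C contact_X.
  have [us sv _] := and3P contact_apath.
  have zu : z != u by apply: contraTneq (ipath_uniq e_irr us) => <-; rewrite /= zs.
  have zv : z != v by apply: contraTneq (ipath_uniq e_irr sv) => <-; rewrite rcons_uniq zs.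
  have /negP := contact_ends zs; apply; rewrite ![e _ z]e_sym.
  by rewrite (star rr1 Cz (attach_C Au)) ?(star rr1 Cz (attach_C Av)).
have es := apath_even contact_apath uv contact_size.
have [k1 [k [k2 [sE nTk nrk lp]]]] :=
  double_label RT contact_apath contact_size es Tu Tv ru rv nTr1 dj contact_complete contact_r1.
have Tk z : z \in s -> complete T z -> z = k1 \/ z = k2.
  rewrite sE inE mem_rcons inE => /or3P[/eqP|/eqP|zk Tz]; [by left|by right|].
  by case/hasP: nTk; exists z.
have k1N : k1 \in rcons n1 y1.
  by move: sE; rewrite /s; case: (n1) => [|z n1'] [-> _]; rewrite mem_rcons !inE eqxx ?orbT.
have k2M : k2 \in rcons m1 w.
  have := congr1 (last k1) sE; rewrite /s last_cat /= last_rcons => <-.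
  by have := mem_last w (rev m1); rewrite mem_rcons !inE mem_rev.
have N1 z : z \in rcons n1 y1 -> z \in N by rewrite NE -cat_rcons mem_cat => ->.
have M1 z : z \in rcons m1 w -> z \in M by rewrite ME -cat_rcons mem_cat => ->.
have MN z : z \in rcons m1 w -> z \notin N.
  by rewrite mem_rcons inE => /predU1P[->|/contact_m1N //]; exact: contact_wN.
have N1s z : z \in rcons n1 y1 -> z \in s.
  by rewrite mem_rcons /s mem_cat !inE => /orP[] ->; rewrite ?orbT.
have M1s z : z \in rcons m1 w -> z \in s.
  by rewrite mem_rcons /s mem_cat !inE mem_rev => /orP[] ->; rewrite ?orbT.
have uM := ipath_uniq e_irr contact_ipM; have uN := ipath_uniq e_irr contact_ipN.
have sE' : rev s = k2 :: rcons (rev k) k1 by rewrite sE rev_cons rev_rcons.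
have srE : rev s = m1 ++ w :: y1 :: rev n1.
  by rewrite /s rev_cat !rev_cons revK !cat_rcons.
have m20 : m2 != [::].
  apply/eqP => m20; move: ME; rewrite m20 cats1 => /rcons_inj[mE bE].
  case: (m1) mE srE uM k2M M1s MN => [|z m1'] mE; first by move: om; rewrite mE.
  rewrite sE' => -[k2E _] uM' _ M1s' MN'.
  have ws : w \in rcons (z :: m1') w by rewrite mem_rcons mem_head.
  case: (Tk w (M1s' w ws)); first by rewrite -bE.
    by move=> wk; case/negP: (MN' w ws); rewrite wk N1.
  by move=> wk; move: uM'; rewrite -k2E -wk /= mem_rcons inE eqxx andbF.
have sE1 : n1 ++ y1 :: w :: rev m1 = k1 :: rcons k k2 by exact: sE.
have n20 : n2 != [::].
  apply/eqP => n20; move: NE; rewrite n20 cats1 => /rcons_inj[nE bE].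
  have ys : y1 \in rcons n1 y1 by rewrite mem_rcons mem_head.
  case: (Tk y1 (N1s _ ys)); first by rewrite -bE.
    move: uN; rewrite /= rcons_uniq => /andP[_ /andP[yn _]] yk.
    move: on sE1 yn; rewrite nE; case: (n1) => [|z n1'] // _ [zk _].
    by rewrite zk yk mem_head.
  by move=> yk; case/negP: (MN _ k2M); rewrite -yk N1.
have nAm := before_noA Au ipM; have nAn := before_noA Av ipN.
have nBm := before_noB Au Av Bb1 ipM mX om.
have nBn := before_noB Av Au Bb2 ipN nX on.
have [m2' m2E] : exists m2', m2 = rcons m2' b1.
  case/lastP: (m2) m20 ME => [|m2' b] // _; rewrite -rcons_cons -rcons_cat => /rcons_inj[_ ->].
  by exists m2'.
have mE : m = m1 ++ w :: m2'.
  by move: ME; rewrite m2E -rcons_cons -rcons_cat => /rcons_inj[].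
have [n2' n2E] : exists n2', n2 = rcons n2' b2.
  case/lastP: (n2) n20 NE => [|n2' b] // _; rewrite -rcons_cons -rcons_cat => /rcons_inj[_ ->].
  by exists n2'.
have nE : n = n1 ++ y1 :: n2'.
  by move: NE; rewrite n2E -rcons_cons -rcons_cat => /rcons_inj[].
have hw : has (e w) (y1 :: n2') || has (e w) [:: b2] by rewrite /= wy1.
have [n3 [y2 [n4 [n2wE wy2 nw4]]]] : exists n3 y2 n4,
    [/\ y1 :: n2 = n3 ++ y2 :: n4, e w y2 & ~~ has (e w) n4].
  by apply: has_last; rewrite /= wy1.
have [n4' n4E] : exists n4', y2 :: n4 = rcons n4' b2.
  exists (belast y2 n4); rewrite lastI; congr rcons.
  by rewrite -contact_b2 -[LHS]/(last y1 (y2 :: n4)) -[RHS]/(last y1 (y1 :: n2)) n2wE last_cat.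
have nE3 : n = n1 ++ n3 ++ n4'.
  by move: NE; rewrite n2wE n4E -!rcons_cat => /rcons_inj[].
have sub4 z : z \in y2 :: n4 -> z \in N.
  by move=> zs; rewrite NE n2wE !mem_cat zs !orbT.
have fw4 : all (far w) n4.
  apply/allP => z zs; apply: contact_wN_far; last exact: nhas_e nw4 zs.
  by apply: sub4; rewrite inE zs orbT.
have ipw : ipath (w :: y2 :: n4).
  apply: ipath_consI => //; apply: (@ipath_catr _ e (v :: u :: n1 ++ n3)).
  by move: ipN; rewrite NE n2wE /= catA.
have ipJ : ipath (rcons (v :: m1) w ++ y2 :: n4).
  apply: ipath_glue => //; first exact: contact_ipM.
  apply/anti_seqP => z y zs /sub4 yN; move: zs; rewrite inE => /predU1P[->|zm].
    exact: contact_vN.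
  exact: contact_m1N_far.
have noAB q : {subset q <= m ++ n} -> ~~ (has A q || has B q).
  move=> qs; apply/negP => /orP[] /hasP[z /qs]; rewrite mem_cat => /orP[] zs.
  - by apply/negP; apply: (hasPn nAm); rewrite mem_rcons inE zs orbT.
  - by apply/negP; apply: (hasPn nAn); rewrite mem_rcons inE zs orbT.
  - by apply/negP; apply: (hasPn nBm).
  by apply/negP; apply: (hasPn nBn).
have mnX : {subset m ++ n <= X} by move=> z; rewrite mem_cat => /orP[/mX|/nX].
(* The detour from [v] along [m1] and [w] to [y2] and on to [b2] has no interior vertex in [A] or
   [B], so it has even length. *)
have oJ : odd (size (m1 ++ w :: n4')).
  have sub : {subset m1 ++ w :: n4' <= m ++ n}.
    move=> z; rewrite !mem_cat inE mE nE3 !mem_cat inE.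
    by case/or3P=> ->; rewrite ?orbT.
  apply/negPn/negP => eJ; have := noAB _ sub; apply/negP/negPn.
  apply: (odd_attach sR Av Bb2 _ _ eJ); last by move=> z /sub/mnX.
  have -> // : v :: rcons (m1 ++ w :: n4') b2 = rcons (v :: m1) w ++ y2 :: n4.
  by rewrite n4E rcons_cat !rcons_cons cat_cons cat_rcons.
have en := contact_even.
have par_n : odd (size n1 + size n3 + size n4').
  by move: on; rewrite nE3 !size_cat addnA.
have par_m : ~~ odd (size m1 + size n4').
  by move: oJ; rewrite size_cat /= addnS.
have par_n3 : odd (size n3).
  move: par_n par_m en; rewrite !oddD.
  by move: (odd (size n1)) (odd (size m1)) (odd (size n3)) (odd (size n4')) => [] [] [] [].
(* If the odd list [n3] had three or more vertices, the shortcut from [y1] through [w] to [y2] would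
   give a path from [u] to [b2] of odd length, against [odd_attach]. *)
have n3E : n3 = [:: y1].
  case: n3 n2wE nE3 par_n3 {par_n} => [|y n5] //= -[<- n2E5] nE3 o5.
  case: n5 n2E5 nE3 o5 => [|c n6] // n2E5 nE3 o6.
  have ipN' : ipath (u :: rcons (n1 ++ y1 :: w :: n4') b2).
    have -> : u :: rcons (n1 ++ y1 :: w :: n4') b2 = rcons (u :: rcons n1 y1) w ++ y2 :: n4.
      by rewrite n4E cat_rcons cat_cons cat_rcons rcons_cat !rcons_cons.
    apply: ipath_glue => //.
      rewrite -rcons_cons (ipath_rcons e_sym) wy1 rcons_cons contact_ipN andbT /=.
      rewrite (far_sym) contact_uM ?M1 ?mem_rcons ?mem_head //=.
      apply/allP => z zn; apply: contact_wN_far; last exact: nhas_e nn1 zn.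
      by apply: N1; rewrite mem_rcons inE zn orbT.
    have : anti_seq e (u :: rcons n1 y1) (n6 ++ y2 :: n4).
      apply: (@ipath_cat_anti _ e _ _ c); move: (ipath_behead ipN).
      by rewrite NE n2E5 /= cat_rcons.
    by move/anti_seqP => H; apply/anti_seqP => z x zs xs; apply: H; rewrite // mem_cat xs orbT.
  have sub : {subset n1 ++ y1 :: w :: n4' <= m ++ n}.
    move=> z; rewrite !mem_cat !inE mE nE3 !mem_cat !inE mem_cat.
    by case/or4P=> ->; rewrite ?orbT.
  have eN : ~~ odd (size (n1 ++ y1 :: w :: n4')).
    move: par_m en; rewrite size_cat /= !addnS /= negbK !oddD.
    by move: (odd (size n1)) (odd (size m1)) (odd (size n4')) => [] [] [].
  have := noAB _ sub; rewrite (odd_attach sR Au Bb2 ipN' _ eN) // => z /sub/mnX; exact.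
move: n2wE; rewrite n3E => -[n2E4].
have hb2 : has (complete T) (y2 :: n4) by rewrite n4E has_rcons Tb2.
have [h [e0 [h' [hE Te0 nTh]]]] := has_first hb2.
have e0N : e0 \in N by apply: sub4; rewrite hE mem_cat inE eqxx orbT.
have e0n2 : e0 \in n2 by rewrite n2E4 hE mem_cat inE eqxx orbT.
have ue0 := contact_u_tail e0n2; have ve0 := contact_vN e0N.
have Ce0 : C e0.
  rewrite /C Te0 andbT; move: e0N; rewrite mem_rcons inE => /predU1P[->|/nX //].
  by case/andP: (attach_C Bb2).
have re0 : far r1 e0.
  apply/andP; split; first by apply: contraNneq nTr1 => ->.
  exact: r1C Ce0 (attach_C Au) ue0 ru.
have ipJh : ipath (rcons (v :: m1) w ++ h ++ [:: e0]).
  by apply: (@ipath_catl _ e _ h'); move: ipJ; rewrite hE -(cat1s e0) !catA.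
have ipNh : ipath (u :: rcons n1 y1 ++ h ++ [:: e0]).
  apply: (@ipath_catl _ e _ h'); move: (ipath_behead ipN).
  by rewrite NE n2E4 hE -(cat1s e0) -cat_rcons !catA.
have Tu1 z : z \in k -> ~~ complete T z by apply: (hasPn nTk).
have us := ipath_uniq e_irr (proj1 (andP contact_apath)).
(* The T-complete end of the leap is on [N] or on [M]. The arm free of complete vertices fixes the
   parity of [h]; the other arm, from its complete end on, demands the opposite parity unless
   nothing lies between that end and [e0]. *)
case/orP: lp => /andP[h1 h2].
  have nTk2 : ~~ complete T k2.
    by have := dj k2; rewrite sE inE mem_rcons mem_head orbT h2 andbT; apply.
  have nTm : ~~ has (complete T) (rcons m1 w).
    apply/hasPn => z zs; apply/negP => Tz; case: (Tk z (M1s z zs) Tz) => zk.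
      by case/negP: (MN z zs); rewrite zk N1.
    by rewrite zk (negbTE nTk2) in Tz.
  have oh : odd (size m1 + size h).+1.
    have : odd (size (rcons m1 w ++ h)); last by rewrite size_cat size_rcons addSn.
    apply: (RT v _ e0) => //; last by case: (m1).
      by rewrite -cats1 -catA -cat_cons -rcons_cons.
    by rewrite has_cat negb_or nTm.
  have [n6 n6E] : exists n6, rcons n1 y1 = k1 :: n6.
    by move: sE1; case: (n1) => [|z n1'] [-> _]; eexists; reflexivity.
  have s6 : size n6 = size n1 by have := congr1 size n6E; rewrite size_rcons => -[].
  have sub6 z : z \in n6 -> z \in rcons n1 y1 by rewrite n6E inE orbC => ->.
  have nT6 : ~~ has (complete T) n6.
    apply/hasPn => z zs; apply/negP => Tz; case: (Tk z (N1s z (sub6 z zs)) Tz) => zk.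
      by move: uN; rewrite n6E => /= /and3P[_]; rewrite -zk zs.
    by rewrite zk (negbTE nTk2) in Tz.
  have nh0 : n6 ++ h = [::].
    apply/eqP/negPn/negP => nh0.
    have : odd (size (n6 ++ h)).
      apply: (RT k1 _ e0) => //; last by rewrite has_cat negb_or nT6.
      by have := ipath_behead ipNh; rewrite n6E -cats1 -catA.
    rewrite size_cat s6; move: oh en; rewrite /= !oddD.
    by move: (odd (size n1)) (odd (size m1)) (odd (size h)) => [] [] [].
  have [n60 h0] : n6 = [::] /\ h = [::] by case: (n6) nh0.
  have n10 : n1 = [::] by apply: size0nil; rewrite -s6 n60.
  have mkE : rcons m1 w = k2 :: rev k.
    move: sE1; rewrite n10 => -[_ E].
    by apply: (can_inj revK); rewrite rev_rcons rev_cons revK.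
  have iJ : ipath (rcons (rcons m1 w) e0).
    by have := ipath_behead ipJh; rewrite h0 -[rcons _ e0]cats1.
  (* [r1] replaces [v]: it sees only [u] and [k2] on this path. The interior has [size m1 + 2]
     vertices, an even number because [n1] is empty. *)
  have iP : ipath (u :: rcons (r1 :: rcons m1 w) e0).
    rewrite rcons_cons; apply: ipath_consI => //; last first.
      rewrite all_rcons ue0 /=; apply/allP => z zs; exact: contact_uM (M1 z zs).
    rewrite mkE in iJ *; apply: ipath_consI => //.
    rewrite -/(rcons _ _) all_rcons re0 all_rev; apply/allP => z zk; rewrite /anti (nhas_e nrk zk) andbT.
    have /andP[_ nuz] : far u z by apply/contact_uM/M1; rewrite mkE inE mem_rev zk orbT.
    by apply: contraNneq nuz => <-.
  have : odd (size (r1 :: rcons m1 w)).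
    by apply: (RT u _ e0) => //; rewrite /= negb_or nTr1.
  by move: en; rewrite n10 /= size_rcons /= negbK => /negbTE->.
have nTk1 : ~~ complete T k1.
  by have := dj k1; rewrite sE mem_head h1 andbT; apply.
have nTn : ~~ has (complete T) (rcons n1 y1).
  apply/hasPn => z zs; apply/negP => Tz; case: (Tk z (N1s z zs) Tz) => zk.
    by rewrite zk (negbTE nTk1) in Tz.
  by case/negP: (MN k2 k2M); rewrite -zk N1.
have oh : odd (size n1 + size h).+1.
  have : odd (size (rcons n1 y1 ++ h)); last by rewrite size_cat size_rcons addSn.
  apply: (RT u _ e0) => //; last by case: (n1).
    by rewrite -cats1 -catA -cat_cons.
  by rewrite has_cat negb_or nTn.
have [m6 m6E] : exists m6, rcons m1 w = k2 :: m6.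
  by move: srE; rewrite sE'; case: (m1) => [|z m1'] [-> _]; eexists; reflexivity.
have s6 : size m6 = size m1 by have := congr1 size m6E; rewrite size_rcons => -[].
have sub6 z : z \in m6 -> z \in rcons m1 w by rewrite m6E inE orbC => ->.
have nT6 : ~~ has (complete T) m6.
  apply/hasPn => z zs; apply/negP => Tz; case: (Tk z (M1s z (sub6 z zs)) Tz) => zk.
    by rewrite zk (negbTE nTk1) in Tz.
  by move: uM; rewrite m6E => /= /and3P[_]; rewrite -zk zs.
have nh0 : m6 ++ h = [::].
  apply/eqP/negPn/negP => nh0.
  have : odd (size (m6 ++ h)).
    apply: (RT k2 _ e0) => //; last by rewrite has_cat negb_or nT6.
    by have : ipath (rcons m1 w ++ h ++ [:: e0]) := ipath_behead ipJh; rewrite m6E -cats1 -catA.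
  rewrite size_cat s6; move: oh en; rewrite /= !oddD.
  by move: (odd (size n1)) (odd (size m1)) (odd (size h)) => [] [] [].
have [m60 h0] : m6 = [::] /\ h = [::] by case: (m6) nh0.
have m10 : m1 = [::] by apply: size0nil; rewrite -s6 m60.
have nkE : rcons n1 y1 = k1 :: k.
  by move: sE1; rewrite m10 -cat_rcons cats1 -rcons_cons => /rcons_inj[].
have iN : ipath (rcons (rcons n1 y1) e0).
  by have := ipath_behead ipNh; rewrite h0 -[rcons _ e0]cats1.
have iP : ipath (v :: rcons (r1 :: rcons n1 y1) e0).
  rewrite rcons_cons; apply: ipath_consI => //; last first.
    rewrite all_rcons ve0 /=; apply/allP => z zs; exact: contact_vN (N1 z zs).
  rewrite nkE in iN *; apply: ipath_consI => //.
  rewrite -/(rcons _ _) all_rcons re0; apply/allP => z zk; rewrite /anti (nhas_e nrk zk) andbT.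
  have /andP[_ nvz] : far v z by apply/contact_vN/N1; rewrite nkE inE zk orbT.
  by apply: contraNneq nvz => <-.
have : odd (size (r1 :: rcons n1 y1)).
  by apply: (RT v _ e0) => //; rewrite /= negb_or nTr1.
by move: en; rewrite m10 addn0 /= size_rcons /= negbK => /negbTE->.
Qed.

End Contact.

(** The two paths do touch, as their ends lie in the clique [B]; [contact_false] applies at the
    first contact. *)
Lemma before_antisym u v : before u v -> before v u -> False.
Proof.
case=> [m [b1 [Au Av Bb1 ipM [mX om]]]] [n [b2 [_ _ Bb2 ipN [nX on]]]].
have hM : has (fun z => has (e z) (rcons n b2)) (rcons m b1).
  have [b12|b12] := eqVneq b1 b2; last first.
    rewrite has_rcons; apply/orP; left; apply/hasP; exists b2; first by rewrite mem_rcons mem_head.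
    exact: (attach_clique (shortest_rev sR)).
  case/lastP: (m) om ipM => [|m' z] // _ /ipath_behead/ipath_behead.
  rewrite (ipath_rcons e_sym) => /and3P[bz _ _].
  apply/hasP; exists z; first by rewrite !mem_rcons !inE mem_rcons mem_head orbT.
  by apply/hasP; exists b2; rewrite ?mem_rcons ?mem_head // -b12 e_sym.
have [m1 [w [m2 [ME wN nm1]]]] := has_first hM.
have [n1 [y1 [n2 [NE wy1 nn1]]]] := has_first wN.
exact: (contact_false Au Av Bb1 Bb2 ipM ipN mX nX om on ME NE wy1 nm1 nn1).
Qed.

(** Replacing [v] by [u] in the path for [before v w] works unless [u] has a neighbour further on.
    Then the path [v u] continued from the last such neighbour has odd length, or gets it when [b]
    is dropped in favour of a vertex of [B] next to it; either way [before v u]. *)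
Lemma before_trans u v w : before u v -> before v w -> before u w.
Proof.
move=> buv bvw; have [m [b1 [Au Av _ ipM _]]] := buv.
have [q [b [_ Aw Bb ip [qX oq]]]] := bvw.
have uw : u != w by apply/eqP => uw; apply: (before_antisym buv); rewrite uw.
have euv : e u v by move: ipM; rewrite ipath_cons => /and3P[].
have euw := attach_clique sR Au Aw uw.
have nA := before_noA Av ip.
have uq : u \notin rcons q b by apply: contra nA => uq; apply/hasP; exists u.
have ufar s : {subset s <= rcons q b} -> ~~ has (e u) s -> all (far u) s.
  move=> sub ns; apply/allP => z zs; rewrite /anti (nhas_e ns zs) andbT.
  by apply: contraNneq uq => ->; apply: sub.
have [hu|nu] := boolP (has (e u) (rcons q b)); last first.
  exists q, b; split=> //; apply: ipath_consI => //; first exact: ipath_behead ip.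
  exact: ufar.
have [s1 [z [s2 [qE uz nu]]]] := has_last hu.
have [s3 sE] : exists s3, s2 = rcons s3 b.
  case/lastP: s2 qE nu => [|s3 b']; last first.
    by rewrite -rcons_cons -rcons_cat => /rcons_inj[_ ->]; exists s3.
  rewrite cats1 => /rcons_inj[_ zb] _.
  by have := attach_far sR Au Bb; rewrite zb /anti uz andbF.
have qE3 : q = s1 ++ z :: s3 by move: qE; rewrite sE -rcons_cons -rcons_cat => /rcons_inj[].
have subz x : x \in z :: s3 -> x \in q by rewrite qE3 mem_cat orbC => ->.
have ipv : ipath (v :: u :: rcons (z :: s3) b).
  have ipz : ipath (z :: s2) by move: (ipath_behead (ipath_behead ip)); rewrite qE => /ipath_catr.
  have ipu : ipath (u :: z :: s2).
    by apply: ipath_consI => //; apply: ufar => // x xs; rewrite qE mem_cat inE xs !orbT.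
  rewrite rcons_cons -sE; apply: ipath_consI => //; first by rewrite e_sym.
  move: ip; rewrite ipath_cons qE all_cat => /and3P[_ /andP[_ ->] _] //.
have zX : {subset z :: s3 <= X} by move=> x /subz/qX.
have [ez|ez] := boolP (odd (size (z :: s3))).
  by case: (before_antisym buv); exists (z :: s3), b.
case/orP: (odd_attach sR Au Bb (ipath_behead ipv) zX ez) => /hasP[y /[dup] ys /subz yq].
  by move/hasPn: nA => /(_ y); rewrite mem_rcons inE yq orbT => /(_ isT)/negP.
move=> By; have ipb := ipath_behead ipv.
have yb : e b y.
  apply: (attach_clique (shortest_rev sR)) => //.
  have := ipath_uniq e_irr ipb; rewrite -rcons_cons rcons_uniq => /andP[bn _].
  by apply: contraNneq bn => ->; rewrite inE ys orbT.
have [s4 E] := ipath_last_adj e_sym (ipath_behead ipb) ys yb.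
case: (before_antisym buv); exists s4, y; split=> //; last split.
- by move: ipv; rewrite E -cats1 -!cat_cons => /ipath_catl.
- by move=> x xs; apply: zX; rewrite E mem_rcons inE xs orbT.
by move: ez; rewrite E size_rcons /= negbK.
Qed.

(** One pass over the vertices keeps a candidate that lies before none of those already met;
    transitivity preserves this when it is replaced. *)
Lemma before_max a : A a -> exists2 a', A a' & forall v, ~ before a' v.
Proof.
move=> Aa; suff [a' Aa' H] : exists2 a', A a' & forall v, v \in enum V -> ~ before a' v.
  by exists a' => // v; apply: H; rewrite mem_enum.
elim: (enum V) => [|x l [a' Aa' H]]; first by exists a.
have [bx|nbx] := classic (before a' x); last first.
  by exists a' => // v; rewrite inE => /predU1P[->|/H].
exists x; first by case: bx => m [b1 [_ Ax _ _ _]].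
move=> v; rewrite inE => /predU1P[->|vl] xv; first exact: (before_antisym xv xv).
exact: (H v vl (before_trans bx xv)).
Qed.

End Order.

(** The vertex of [A] or [B] found by [odd_attach] on a path of odd length is adjacent to the end
    [a] or [b], hence second or penultimate, so the path shows that this end is not maximal. *)
Lemma max_even_pair r1 R0 r2 a b q : shortest r1 R0 r2 ->
  attach r1 (rcons R0 r2) a -> attach r2 (rcons (rev R0) r1) b ->
  (forall v, ~ before r1 R0 r2 a v) -> (forall v, ~ before r2 (rev R0) r1 b v) ->
  ipath (a :: rcons q b) -> {subset q <= X} -> odd (size q).
Proof.
move=> sR Aa Bb ma mb ip qX; apply/negPn/negP => eq.
case/orP: (odd_attach sR Aa Bb ip qX eq) => /hasP[z zq az].
  have za : e a z.
    apply: (attach_clique sR) => //; have := ipath_uniq e_irr ip => /= /andP[aq _].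
    by apply: contraNneq aq => ->; rewrite mem_rcons inE zq orbT.
  have zq' : z \in rcons q b by rewrite mem_rcons inE zq orbT.
  have [q' E] := ipath_head_adj ip zq' za.
  case: q E zq ip qX eq {zq'} => [|z' q] E zq ip qX eq //.
  move: E; rewrite rcons_cons => -[zE qE]; subst z'.
  apply: (ma z); exists q, b; split=> //; split; last by move: eq; rewrite /= negbK.
  by move=> x xq; apply: qX; rewrite inE xq orbT.
have zb : e b z.
  apply: (attach_clique (shortest_rev sR)) => //; have := ipath_uniq e_irr ip.
  rewrite -rcons_cons rcons_uniq => /andP[bq _].
  by apply: contraNneq bq => ->; rewrite inE zq orbT.
have [q' E] := ipath_last_adj e_sym (ipath_behead ip) zq zb.
apply: (mb z); exists (rev q'), a; split=> //.
- by rewrite attach_rev.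
- by move: ip; rewrite E -(ipath_rev_ends e_sym) rev_rcons.
split; first by move=> x; rewrite mem_rev => xq; apply: qX; rewrite E mem_rcons inE xq orbT.
by move: eq; rewrite E size_rcons size_rev /= negbK.
Qed.

(** * Exclusion of proper snakes *)

Section NoSnake.

Variables (r1 : V) (R0 : seq V) (r2 : V).
Hypothesis sR : shortest r1 R0 r2.
Local Notation A := (attach r1 (rcons R0 r2)).
Local Notation B := (attach r2 (rcons (rev R0) r1)).

Variables (a : V) (s1 : seq V) (b : V) (s2 : seq V) (c : V) (g : seq V) (c' d : V) (h : seq V) (d' : V).
Hypotheses (Aa : A a) (Bb : B b) (s10 : s1 != [::]) (sn : snake a s1 b s2 c g c' d h d').
Hypotheses (s1X : {subset a :: s1 <= X}) (gX : {subset c :: rcons g c' <= X})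
  (hX : {subset d :: rcons h d' <= X}).

Lemma snake_untouched z : C z -> far a z -> far b z -> ~~ has (e z) (r1 :: rcons R0 r2).
Proof.
move=> Cz /andP[az naz] /andP[bz nbz]; apply/negP => tz.
case: (touch_cases sR Cz tz) => [Az|Bz|[H1 _]].
- by case/negP: naz; apply: (attach_clique sR).
- by case/negP: nbz; apply: (attach_clique (shortest_rev sR)).
by case/negP: naz; rewrite e_sym H1.
Qed.

Lemma snake_a_far y : y \in (c :: rcons g c') ++ (d :: rcons h d') -> far a y.
Proof.
have ab : a \in belast a s1 by case: (s1) s10 => [|? ?] //= _; rewrite mem_head.
have H y0 := snake_a_belast sn y0 ab.
by rewrite mem_cat => /orP[] ys; [apply: (H y).1|apply: (H y).2].
Qed.

(** [c] has no neighbour on [R], hence [d] has one, and minimality reduces [R] to [r1 p r2] with [p]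
    the only neighbour of [d]. The last vertex of [S1] must then see [p], so it is not T-complete;
    paths through [d] into [S4], started in [S1] and at [c], finally have incompatible parities. *)
Lemma no_snake_c : complete T c -> False.
Proof.
move=> Tc; have RT := odd_between_anticonn cT.
have [[Ta Ca] [Tb Cb]] := ((attach_complete Aa, attach_C Aa), (attach_complete Bb, attach_C Bb)).
have [ipR rR oR minR] := sR.
have nTR z : z \in r1 :: rcons R0 r2 -> ~~ complete T z by move=> /(allP rR)/and3P[].
have [bc bd] := snake_b_far sn (mem_head b s2).
have ac : far a c by apply: snake_a_far; rewrite mem_cat mem_head.
have ad : far a d by apply: snake_a_far; rewrite mem_cat mem_head orbT.
have Cc : C c by rewrite /C Tc gX ?mem_head.
have cR := snake_untouched Cc ac bc.
have ncR z : z \in r1 :: rcons R0 r2 -> ~~ e z c by move=> zR; rewrite e_sym (nhas_e cR zR).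
have fcR : all (far c) (r1 :: rcons R0 r2) by apply: C_rest_far.
have ar1 : e a r1 by case/and3P: Aa.
have br2 : e b r2 by case/and3P: Bb.
have ecd := snake_cd sn.
(* Otherwise the hat ending [S1] could walk to [a], along [R] to [b] and along [S2] to the far
   triangle. *)
have dR : has (e d) (r1 :: rcons R0 r2).
  apply/negPn/negP => nd.
  have bl : {in belast a s1, forall z, far z c /\ far z d}.
    by move=> z zb; split; [apply: (snake_a_belast sn c zb).1|apply: (snake_a_belast sn d zb).2];
      exact: mem_head.
  apply: (snake_hat_walk sn (L := (r1 :: rcons R0 r2) ++ b :: s2) (snake_apath sn) ecd (snake_size _ _ _ _)
    (snake_ac sn) (snake_ad sn) (snake_hat sn) bl).
  - rewrite cat_path [path _ _ (r1 :: _)]/= ar1 ipath_path // last_cons last_rcons /=.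
    by rewrite e_sym br2; apply: ipath_path; exact: snake2 sn.
  - rewrite all_cat; apply/andP; split; apply/allP => z zs.
      by rewrite ncR // e_sym (nhas_e nd zs).
    by have [/andP[_ ->] /andP[_ ->]] := snake_b_far sn zs.
  apply/hasP; exists (last b s2); first by rewrite mem_cat mem_last orbT.
  apply/hasP; exists c'; last exact: snake_bc sn.
  by rewrite mem_cat mem_rcons mem_head.
have nTd : ~~ complete T d.
  apply: contraTN dR => Td; apply: snake_untouched => //.
  by rewrite /C Td hX ?mem_head.
have dT : d \notin T.
  have /andP[_] := bd; apply: contra => zT; exact: (allP Tb).
have rd : rest d by rewrite /rest hX ?mem_head // dT.
have dnR z : z \in r1 :: rcons R0 r2 -> d != z.
  by move=> zR; apply: contraTneq ecd => ->; rewrite e_sym ncR.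
have [R1 [p [R2 [RE dp nd1]]]] := has_first dR.
have subR1 z : z \in rcons R1 p -> z \in r1 :: rcons R0 r2.
  by rewrite RE -cat_rcons mem_cat => ->.
have dfar L : {subset L <= r1 :: rcons R0 r2} -> ~~ has (e d) L -> all (far d) L.
  by move=> sub nL; apply/allP => z zL; rewrite /anti (nhas_e nL zL) andbT dnR // sub.
have subR z : z \in R1 -> z \in r1 :: rcons R0 r2 by rewrite RE mem_cat => ->.
(* An outer path with [size R1 + 2] interior vertices: minimality and parity leave exactly one
   vertex of [R] after [p]. *)
have out1 : outer a (rcons (rcons R1 p) d) c.
  apply/and5P; split=> //; last by rewrite -size_eq0 size_rcons.
    have i1 : ipath (rcons (a :: R1) p).
      by have := attach_path sR Aa; rewrite RE -cat_rcons -cat_cons => /ipath_catl.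
    have i2 : ipath (rcons (rcons (a :: R1) p) d).
      by rewrite (ipath_rcons e_sym) dp i1 /= (far_sym) ad dfar.
    rewrite -!rcons_cons (ipath_rcons e_sym) ecd i2 andbT /= (far_sym) ac.
    by apply/allP => z /subR1; apply: (allP fcR).
  rewrite all_rcons rd; apply/allP => z /subR1; exact: (allP rR).
have sizeR : (size R0).+2 = (size R1).+1 + size R2.
  by have := congr1 size RE; rewrite /= size_rcons size_cat /= addnS.
have min1 := minR _ _ _ out1; have odd1 := outer_odd out1.
rewrite !size_rcons in min1 odd1.
have sR2 : size R2 = 1.
  by move: sizeR min1 odd1 oR; move: (size R0) (size R1) (size R2); clear; lia.
have [R2E RE2] : R2 = [:: r2] /\ r1 :: R0 = rcons R1 p.
  case: (R2) sR2 RE => [|r [|]] // _; rewrite -cat_rcons cats1 -rcons_cons.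
  by move/rcons_inj => [-> ->].
have r2R : r2 \in r1 :: rcons R0 r2 by rewrite inE mem_rcons mem_head orbT.
have pR : p \in r1 :: rcons R0 r2 by apply: subR1; rewrite mem_rcons mem_head.
have fbR : all (far b) (r1 :: R0).
  have := attach_path (shortest_rev sR) Bb; rewrite ipath_cons => /and3P[_ + _].
  by rewrite all_rcons all_rev.
have r2c : far r2 c by rewrite (far_sym) (allP fcR).
have pc : far p c by rewrite (far_sym) (allP fcR).
have nTr2 := nTR _ r2R; have nTp := nTR _ pR.
have dr2 : far d r2.
  rewrite /anti dnR //=; apply/negP => dr.
  have ip3 : ipath (b :: rcons [:: r2; d] c).
    rewrite /= !ipath_cons /= br2 bd bc (e_sym r2) dr r2c (e_sym d) ecd //.
  by have := RT _ _ _ ip3 Tb Tc; rewrite /= (negbTE nTr2) (negbTE nTd) => /(_ isT isT).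
have r2p : e r2 p.
  have := ipR; rewrite -rcons_cons RE2 (ipath_rcons e_sym) => /and3P[] //.
(* Three interior vertices, so [R] has no more than three. *)
have out2 : outer b [:: r2; p; d] c.
  apply/and5P; split=> //; last by rewrite /= rd !(allP rR).
  have bp : far b p by apply: (allP fbR); rewrite RE2 mem_rcons mem_head.
  rewrite /= !ipath_cons /= br2 bp bd bc r2p (e_sym p) dp (e_sym d) ecd pc r2c.
  by rewrite (far_sym) dr2.
have min2 := minR _ _ _ out2; rewrite /= in min2.
have R01 : size R0 = 1 by move: min2 oR; clear; lia.
have [R1E R0E] : R1 = [:: r1] /\ R0 = [:: p].
  move: RE2 R01; case: (R0) => [|x [|]] // + _; case: (R1) => [|y [|? [|]]] //=.
  by case=> -> ->.
have r1R : r1 \in r1 :: rcons R0 r2 by rewrite mem_head.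
have ndr1 : ~~ e d r1 by move: nd1; rewrite R1E /= orbF.
pose a' := last a s1.
have a's : a' \in a :: s1 by exact: mem_last.
have fa'b z : z \in b :: s2 -> far a' z by move=> zs; apply: (anti_seqP _ _ _ (snake12 sn)).
have a'b := fa'b b (mem_head _ _).
have ea'c : e a' c := snake_ac sn; have ea'd : e a' d := snake_ad sn.
have r1p : e r1 p by move: ipR; rewrite R0E ipath_cons => /and3P[].
(* A T-complete last a s1 could only be attached at r1. *)
have a'T z : z \in [:: p; r2] -> e a' z -> ~~ complete T a'.
  move=> zs az; apply/negP => Ta'.
  have Ca' : C a' by rewrite /C Ta' s1X.
  have ta' : has (e a') (r1 :: rcons R0 r2).
    by apply/hasP; exists z => //; move: zs; rewrite R0E !inE => /orP[] ->; rewrite ?orbT.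
  have [a'b1 a'b2] := andP a'b.
  case: (touch_cases sR Ca' ta') => [Az|Bz|[_ H]].
  - case/and3P: Az => _ _ /hasPn/(_ z); rewrite R0E /= => /(_ zs).
    by rewrite az.
  - by case/negP: a'b2; apply: (attach_clique (shortest_rev sR)).
  by case/negP: a'b2; rewrite H.
have na'r2 : ~~ e a' r2.
  apply/negP => ar2; have nTa' : ~~ complete T a' by apply: (a'T r2) => //; rewrite !inE eqxx orbT.
  have ip3 : ipath (c :: rcons [:: a'; r2] b).
    rewrite /= !ipath_cons /= e_sym ea'c ar2 a'b (e_sym r2) br2 (far_sym) r2c.
    by rewrite (far_sym) bc.
  by have := RT _ _ _ ip3 Tc Tb; rewrite /= (negbTE nTr2) (negbTE nTa') => /(_ isT isT).
have [cc' dd'] := snake_neq sn.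
have ug := ipath_uniq e_irr (snake3 sn); have uh := ipath_uniq e_irr (snake4 sn).
have dg y : y \in rcons g c' -> far d y.
  move=> yg; rewrite (far_sym); apply: (snake_cd_far sn).
  - by rewrite inE yg orbT.
  - exact: mem_head.
  - by apply/orP; left; apply: contraTneq ug => <-; rewrite /= yg.
  by rewrite dd' orbT.
have ch y : y \in rcons h d' -> far c y.
  move=> yh; apply: (snake_cd_far sn).
  - exact: mem_head.
  - by rewrite inE yh orbT.
  - by apply/orP; right; apply: contraTneq uh => <-; rewrite /= yh.
  by rewrite cc'.
(* If the last vertex of [S1] misses [p], it is a hat over [c d] for a hole shortcut from the closed
   walk through [S3], [S2], [r2], [p]; the walk back to [a] and on to [r1] ends next to [p]. *)
have [ea'p|na'p] := boolP (e a' p); last first.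
  pose F := rcons g c' ++ rev (b :: s2) ++ [:: r2; p].
  have [k [F' FE]] : exists k F', F = k :: F'.
    by rewrite /F; case: (g) => [|k g']; eexists; eexists; reflexivity.
  have lF : last k F' = p by rewrite -[LHS]/(last p (k :: F')) -FE /F !last_cat.
  have P : path e c F.
    rewrite /F cat_path (ipath_path (snake3 sn)) last_rcons cat_path.
    have -> : rev (b :: s2) = last b s2 :: rev (belast b s2) by rewrite lastI rev_rcons.
    rewrite [path _ _ (last _ _ :: _)]/= e_sym (snake_bc sn) ipath_path /=; last first.
      by rewrite -rev_rcons -lastI (ipath_rev e_sym); exact: snake2 sn.
    have -> : last (last b s2) (rev (belast b s2)) = b.
      by rewrite -[LHS]/(last b (last b s2 :: rev (belast b s2))) -rev_rcons -lastI rev_cons last_rcons.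
    by rewrite br2 r2p.
  have Pk : path e k F' by move: P; rewrite FE => /andP[].
  have ck : e c k by move: P; rewrite FE => /andP[].
  have [q [ipq lq sq]] := walk_ipath Pk.
  have FF z : z \in F -> [\/ z \in rcons g c', z \in b :: s2, z = r2 | z = p].
    rewrite /F !mem_cat mem_rev !inE => /orP[H|/orP[H|/orP[/eqP|/eqP]]] //.
    - by constructor 1.
    - by constructor 2.
    - by constructor 3.
    by constructor 4.
  have qF z : z \in k :: q -> z \in F by rewrite FE; exact: sq.
  have kg : k \in rcons g c'.
    by move: FE; rewrite /F; case: (g) => [|? ?] /= [-> _]; rewrite mem_head.
  have kp : k != p by apply: contraTneq ck => ->; rewrite e_sym; case/andP: pc.
  case/lastP: q ipq lq sq qF => [|q p'] ipq lq sq qF.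
    by move: kp; rewrite -lF -lq eqxx.
  have p'E : p' = p by rewrite -lF -lq last_rcons.
  subst p'; have uq := ipath_uniq e_irr ipq.
  have fc z : z \in rcons q p -> far c z.
    move=> zq; have zF : z \in F by apply: qF; rewrite inE zq orbT.
    have zk : z != k by apply: contraTneq uq => <-; rewrite /= zq.
    case: (FF z zF) => [zg|zs|->|->].
    - rewrite /anti; apply/andP; split.
        by apply: contraTneq ug => ->; rewrite /= zg.
      apply/negP => cz; have [g' E] := ipath_head_adj (snake3 sn) zg cz.
      by move: FE zk; rewrite /F E => -[->]; rewrite eqxx.
    - by rewrite (far_sym); apply: (snake_b_far sn zs).1.
    - by rewrite (far_sym).
    by rewrite (far_sym).
  have fd z : z \in k :: q -> far d z.
    move=> zq; have zF : z \in F.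
      by apply: qF; move: zq; rewrite !inE mem_rcons inE => /orP[] ->; rewrite ?orbT.
    case: (FF z zF) => [zg|zs|->//|zp].
    - exact: dg.
    - by rewrite (far_sym); apply: (snake_b_far sn zs).2.
    by move: uq; rewrite -rcons_cons rcons_uniq -zp zq.
  have ap : apath c (k :: rcons q p) d.
    apply/and3P; split.
    - by apply: ipath_consI => //; apply/allP.
    - by rewrite -rcons_cons (ipath_rcons e_sym) dp ipq andbT; apply/allP.
    by apply: contraTneq ecd => ->; rewrite e_irr.
  have na' : ~~ has (e a') (k :: rcons q p).
    apply/hasPn => z /qF/FF [zg|/fa'b/andP[]//|->//|->//].
    by have /andP[] := (snake_a_tail sn z a's).1 zg.
  have s2' : 2 <= size (k :: rcons q p) by rewrite /= size_rcons.
  have bl : {in belast a s1, forall z, far z c /\ far z d}.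
    by move=> z zb; split; [apply: (snake_a_belast sn c zb).1|apply: (snake_a_belast sn d zb).2];
      exact: mem_head.
  apply: (snake_hat_walk sn (L := [:: r1]) ap ecd s2' ea'c ea'd na' bl).
  - by rewrite /= ar1.
  - by rewrite /= ncR // e_sym ndr1.
  apply/hasP; exists r1; first by rewrite inE.
  apply/hasP; exists p => //.
  by rewrite inE mem_rcons mem_head orbT.
have nTa' : ~~ complete T a' by apply: (a'T p) => //; rewrite mem_head.
have Ts1 : has (complete T) (a :: s1) by rewrite /= Ta.
(* The last T-complete vertex [al] of [S1], where [a] is one; the path from it to [c] shows that the
   remainder [h2] has odd size. *)
have [h1 [al [h2 [SE Tal nTh2]]]] := has_last Ts1.
have [h3 h3E] : exists h3, h2 = rcons h3 a'.
  have := congr1 (last a) SE; rewrite last_cat /= -/a'.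
  case/lastP: (h2) => [/= a'al|h3 x]; first by rewrite -a'al (negbTE nTa') in Tal.
  by rewrite last_rcons => ->; exists h3.
have bE : belast a s1 = h1 ++ al :: h3.
  have := SE; rewrite lastI h3E -rcons_cons -rcons_cat => E.
  by have [] := rcons_inj E.
have subb z : z \in al :: h3 -> z \in belast a s1 by rewrite bE mem_cat orbC => ->.
have ipal : ipath (rcons (al :: h3) a').
  by move: (snake1 sn); rewrite SE h3E => /ipath_catr.
have ipac : ipath (al :: rcons (rcons h3 a') c).
  rewrite -!rcons_cons (ipath_rcons e_sym) e_sym ea'c ipal andbT; apply/allP => z /subb zb.
  by rewrite (far_sym); apply: (snake_a_belast sn c zb).1; exact: mem_head.
have o2 : odd (size h2).
  by rewrite h3E; rewrite h3E in nTh2; apply: (RT _ _ _ ipac) => //; case: (h3).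
have glue D : ipath (d :: D) -> {subset D <= rcons (rcons h d') c'} ->
    ipath (al :: h2 ++ d :: D).
  move=> ipD sD; have -> : al :: h2 ++ d :: D = rcons (al :: h3) a' ++ d :: D by rewrite h3E.
  rewrite ipath_cat ipal ipD ea'd /=; apply/andP; split.
    apply/allP => z /sD; rewrite mem_rcons inE => /predU1P[->|zh].
      by apply: (snake_a_tail sn c' a's).1; rewrite mem_rcons mem_head.
    exact: (snake_a_tail sn z a's).2.
  apply/anti_seqP => x z /subb xb; rewrite inE => /predU1P[->|/sD].
    by apply: (snake_a_belast sn d xb).2; exact: mem_head.
  rewrite mem_rcons inE => /predU1P[->|zh].
    by apply: (snake_a_belast sn c' xb).1; rewrite inE mem_rcons mem_head orbT.
  by apply: (snake_a_belast sn z xb).2; rewrite inE zh orbT.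
have nTd1 L : ~~ has (complete T) L -> ~~ has (complete T) (d :: L) by rewrite /= negb_or nTd.
(* To the first T-complete vertex beyond [d], the paths from [al] and from [c] differ in length by
   the odd size of [h2], so they cannot both be even. *)
have [hT|nhT] := boolP (has (complete T) (rcons h d')).
  have [g1 [ep [g2 [hE Tep nTg1]]]] := has_first hT.
  have sg z : z \in rcons g1 ep -> z \in rcons h d' by rewrite hE -cat_rcons mem_cat => ->.
  have ipD : ipath (d :: rcons g1 ep).
    by have := snake4 sn; rewrite hE -cat_rcons -cat_cons => /ipath_catl.
  have ipA : ipath (al :: rcons (h2 ++ d :: g1) ep).
    rewrite rcons_cat rcons_cons; apply: glue => // z /sg zs.
    by rewrite mem_rcons inE zs orbT.
  have ipC : ipath (c :: rcons (d :: g1) ep).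
    by rewrite rcons_cons; apply: ipath_consI => //; apply/allP => z /sg/ch.
  have oA : odd (size (h2 ++ d :: g1)).
    by apply: (RT _ _ _ ipA) => //; [rewrite has_cat negb_or nTh2 nTd1|case: (h2)].
  have oC : odd (size (d :: g1)) by apply: (RT _ _ _ ipC) => //; rewrite nTd1.
  by move: oA; rewrite size_cat oddD o2 oC.
have Tc' : complete T c'.
  have := snake_complete (snake_rev sn) cT Tb Ta.
  by case/orP=> // Td'; case/hasP: nhT; exists d'; rewrite ?mem_rcons ?mem_head.
have ipD : ipath (d :: rcons (rcons h d') c').
  rewrite -!rcons_cons (ipath_rcons e_sym) (snake_cd' sn) rcons_cons (snake4 sn) andbT.
  apply/allP => z zs; apply: (snake_cd_far sn).
  - by rewrite inE mem_rcons mem_head orbT.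
  - by move: zs; rewrite !inE mem_rcons inE => /orP[] ->; rewrite ?orbT.
  - by rewrite eq_sym cc'.
  by apply/orP; right; apply: contraTneq uh => <-; rewrite -rcons_cons rcons_uniq zs.
have ipA : ipath (al :: rcons (h2 ++ d :: rcons h d') c').
  by rewrite rcons_cat rcons_cons; apply: glue.
have oA : odd (size (h2 ++ d :: rcons h d')).
  by apply: (RT _ _ _ ipA) => //; [rewrite has_cat negb_or nTh2 nTd1|case: (h2)].
have apc : apath c (d :: rcons h d') c'.
  apply/and3P; split=> //.
  by apply: ipath_consI => //; [exact: snake4 sn|apply/allP].
(* For non-adjacent [c], [c'] the same parity clash recurs. Otherwise [S4] with the edge [c c']
   forms a hole, and a hat from [T] walks through [a] and [r1] to [p], a neighbour of [d]. *)
have [ecc'|ncc'] := boolP (e c c'); last first.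
  have ipC : ipath (c :: rcons (d :: rcons h d') c') by apply: apath_ipath.
  have oC : odd (size (d :: rcons h d')) by apply: (RT _ _ _ ipC) => //; rewrite nTd1.
  by move: oA; rewrite size_cat oddD o2 oC.
have s2' : 2 <= size (d :: rcons h d') by rewrite /= size_rcons.
have ac' : far a c'.
  by apply: snake_a_far; rewrite mem_cat inE mem_rcons mem_head orbT.
have st : {in d :: rcons h d', forall w, e w a -> ~~ e w c && ~~ e w c'}.
  move=> w wd; have /andP[_] : far a w by apply: snake_a_far; rewrite mem_cat wd orbT.
  by rewrite e_sym => /negbTE->.
have [t tT nt] := hat_exists cT T0 apc ecc' s2' Tc Tc' (nTd1 _ nhT) Ta ac ac' st.
have te z : complete T z -> e t z by move=> /allP/(_ t tT); rewrite e_sym.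
have c'R z : z \in [:: r1; p] -> ~~ e z c'.
  move=> zR; apply/negP => zc'; have Cc' : C c'.
    by rewrite /C Tc' gX // inE mem_rcons mem_head orbT.
  have [ac1 ac2] := andP ac'.
  have tc' : has (e c') (r1 :: rcons R0 r2).
    apply/hasP; exists z; last by rewrite e_sym.
    by move: zR; rewrite R0E !inE => /orP[] ->; rewrite ?orbT.
  case: (touch_cases sR Cc' tc') => [Az|Bz|[H _]].
  - by case/negP: ac2; apply: (attach_clique sR).
  - case/and3P: Bz => _ _ nB; have zB : z \in rcons (rev R0) r1.
      by rewrite R0E mem_rcons.
    by have := nhas_e nB zB; rewrite e_sym zc'.
  by case/negP: ac2; rewrite e_sym H.
apply: (hat_walk apc ecc' s2' (te c Tc) (te c' Tc') nt (p := [:: a; r1; p])).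
- by rewrite /= (te a Ta) ar1 r1p.
- have [/andP[_ nac] /andP[_ nac']] := (ac, ac').
  by rewrite /= nac nac' !ncR // !c'R // !inE eqxx ?orbT.
apply/hasP; exists p; first by rewrite !inE eqxx !orbT.
by apply/hasP; exists d; rewrite ?mem_head // e_sym.
Qed.

End NoSnake.

Lemma no_snake r1 R0 r2 a s1 b s2 c g c' d h d' : shortest r1 R0 r2 ->
  attach r1 (rcons R0 r2) a -> attach r2 (rcons (rev R0) r1) b ->
  snake a s1 b s2 c g c' d h d' -> (s1 != [::]) || (s2 != [::]) ->
  {subset a :: s1 <= X} -> {subset b :: s2 <= X} -> {subset c :: rcons g c' <= X} ->
  {subset d :: rcons h d' <= X} -> False.
Proof.
move=> sR Aa Bb sn s0 s1X s2X gX hX.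
have [Ta Tb] := (attach_complete Aa, attach_complete Bb).
case/orP: s0 => s0.
  case/orP: (snake_complete sn cT Ta Tb) => Tc.
    exact: (no_snake_c sR Aa Bb s0 sn s1X gX hX Tc).
  exact: (no_snake_c sR Aa Bb s0 (snake_swap sn) s1X hX gX Tc).
have Ba : attach r1 (rcons (rev (rev R0)) r2) a by rewrite revK.
have sn' := snake_rev sn.
have gX' : {subset c' :: rcons (rev g) c <= X} by move=> z; rewrite mem_rev_ends => /gX.
have hX' : {subset d' :: rcons (rev h) d <= X} by move=> z; rewrite mem_rev_ends => /hX.
case/orP: (snake_complete sn' cT Tb Ta) => Tc.
  exact: (no_snake_c (shortest_rev sR) Bb Ba s0 sn' s2X gX' hX' Tc).
exact: (no_snake_c (shortest_rev sR) Bb Ba s0 (snake_swap sn') s2X hX' gX' Tc).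
Qed.

Lemma outer_shortest x s y : outer x s y -> exists r1 R0 r2, exists2 a, shortest r1 R0 r2 /\
  attach r1 (rcons R0 r2) a & exists b, attach r2 (rcons (rev R0) r1) b.
Proof.
elim: {s}_.+1 {-2}s (ltnSn (size s)) x y => [|n IH] // s; rewrite ltnS => sn x y O.
have [[x' [s' [y' [O' lt]]]]|min] :=
    classic (exists x' s' y', outer x' s' y' /\ size s' < size s).
  exact: (IH s' (leq_trans lt sn) x' y' O').
have os := outer_odd O; have /and5P[ip Cx Cy rs s0] := O.
(* By [star], a single interior vertex would make the ends adjacent, so there are at least two. *)
have [r1 [R0 [r2 sE]]] : exists r1 R0 r2, s = r1 :: rcons R0 r2.
  case: s ip rs s0 {sn O min os} => [|w [|w' s]] // ip rs _.
    move: rs ip; rewrite /= andbT => rw; rewrite !ipath_cons => /and3P[xw + /and3P[wy _ _]].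
    rewrite /= andbT => /andP[xy nxy]; case/negP: nxy.
    by apply: (star rw) => //; rewrite e_sym.
  by exists w, (belast w' s), (last w' s); rewrite -lastI.
exists r1, R0, r2; rewrite sE in ip rs os.
have ipx : ipath (x :: r1 :: rcons R0 r2) by move: ip; rewrite -rcons_cons -cats1 => /ipath_catl.
have ipy : ipath (y :: r2 :: rcons (rev R0) r1).
  by have := ipath_behead ip; rewrite -(ipath_rev e_sym) rev_rcons rev_cons rev_rcons.
have att z r L : C z -> ipath (z :: r :: L) -> attach r L z.
  move=> Cz; rewrite ipath_cons => /and3P[zr /allP fL _]; apply/and3P; split=> //.
  by apply/hasPn => w /fL/andP[].
exists x; last by exists y; apply: att.
split; last exact: att.
split=> //; first exact: ipath_behead ipx.
  by move: os; rewrite /= size_rcons /= negbK.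
move=> x' s' y' O'; rewrite leqNgt; apply/negP => lt; case: min; exists x', s', y'.
by split=> //; rewrite sE /= size_rcons.
Qed.

Lemma outer_special x s y : outer x s y -> exists a b, [/\ C a, C b & special_in X a b].
Proof.
case/outer_shortest=> r1 [R0 [r2 [a0 [sR Aa0] [b0 Bb0]]]].
have [a Aa ma] := before_max sR Aa0; have [b Bb mb] := before_max (shortest_rev sR) Bb0.
exists a, b; split; [exact: attach_C Aa|exact: attach_C Bb|].
have /andP[ab nab] := attach_far sR Aa Bb; split=> //.
  by move=> q; apply: (max_even_pair sR).
by move=> s1 s2 c g c' d h d' sn s0; apply: (no_snake sR Aa Bb sn s0).
Qed.

(** * Descent to the complete vertices and the double induction *)

(** A maximal run of non-complete vertices on the path would be the interior of an outer path. The
    bound on [size q] keeps [T] off the path, since a vertex of [T] is adjacent to both ends. *)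
Lemma no_outer_path a b q : (forall x s y, ~ outer x s y) -> C a -> C b ->
  ipath (a :: rcons q b) -> {subset q <= X} -> 2 <= size q -> {subset q <= C}.
Proof.
move=> no Ca Cb ip qX q2 z zq.
have [/andP[aX Ta] /andP[bX Tb]] := (Ca, Cb).
have nqT w : w \in q -> w \notin T.
  move=> wq; apply/negP => wT.
  have iq : ipath (a :: q) by move: ip; rewrite -rcons_cons -cats1 => /ipath_catl.
  have /negP := ipath_ends e_sym e_irr q2 iq (ipath_behead ip) wq; apply.
  by rewrite (allP Ta) // (allP Tb).
rewrite -[_ \in _]/(C z) /C qX //=; apply/negPn/negP => nz.
have hz : has (predC (complete T)) q by apply/hasP; exists z.
have [q1 [w [q3 [qE nw nq1]]]] := has_first hz.
have hb : has (complete T) (rcons q3 b) by rewrite has_rcons Tb.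
have [m [y [r [E Ty nm]]]] := has_first hb.
have aE : a :: rcons q b = belast a q1 ++ (last a q1 :: rcons (w :: m) y) ++ r.
  by rewrite qE rcons_cat rcons_cons E -cat_cons (lastI a q1) cat_rcons rcons_cons !cat_cons cat_rcons.
have wX u : u \in a :: rcons q b -> u \in X.
  by rewrite inE mem_rcons inE => /or3P[/eqP->|/eqP->|/qX].
have wq : {subset w :: m <= a :: rcons q b}.
  move=> u um; rewrite aE !mem_cat inE mem_rcons inE um !orbT //.
apply: (no (last a q1) (w :: m) y); apply/and5P; split=> //.
- by move: ip; rewrite aE => /ipath_infix.
- rewrite /C wX ?aE ?mem_cat ?inE ?eqxx ?orbT //=.
  have := mem_last a q1; rewrite inE => /predU1P[->//|lq].
  by move/hasPn: nq1 => /(_ _ lq); rewrite /= negbK.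
- by rewrite /C Ty wX // aE !mem_cat inE mem_rcons inE eqxx !orbT.
apply/allP => u um; have nTu : ~~ complete T u.
  by move: um; rewrite inE => /predU1P[->//|]; apply: (hasPn nm).
rewrite /rest nTu wX ?wq // andbT /=.
have : u \in a :: rcons q b by apply: wq.
rewrite inE mem_rcons inE => /or3P[/eqP ua|/eqP ub|/nqT //].
  by rewrite ua Ta in nTu.
by rewrite ub Tb in nTu.
Qed.

End Outer.

(** By [no_outer_path] long chordless paths from [a] to [b], and with them whole snakes, lie in
    [X']; a path with one interior vertex is even anyway. *)
Lemma special_in_complete (X X' : {set V}) T a b : anticonn T -> T != [::] ->
  X' = [set z in X | complete T z] -> (forall x s y, ~ outer X T x s y) ->
  a \in X' -> b \in X' -> special_in X' a b -> special_in X a b.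
Proof.
move=> cT T0 XE no aX bX [ab nab par nsn].
have inX' z : z \in X' = C X T z by rewrite XE inE.
have [Ca Cb] : C X T a /\ C X T b by rewrite -!inX'.
have sub q : ipath (a :: rcons q b) -> {subset q <= X} -> 2 <= size q -> {subset q <= X'}.
  by move=> ip qX q2 z /(no_outer_path no Ca Cb ip qX q2); rewrite inX'.
split=> // [q ip qX|s1 s2 c g c' d h d' sn s0 s1X s2X gX hX].
  case: (ltnP 1 (size q)) => [q2|]; first by apply: par => //; apply: sub.
  case: q ip {qX} => [|x [|y q]] // ip _; move: ip.
  by rewrite ipath_cons (negbTE nab).
have subS g0 c0 c0' d0 h0 d0' : snake a s1 b s2 c0 g0 c0' d0 h0 d0' ->
    {subset c0 :: rcons g0 c0' <= X} -> {subset s1 ++ c0 :: rcons g0 c0' ++ rev s2 <= X'}.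
  move=> sn0 g0X; apply: sub; first exact: (snake_path sn0).
    move=> z; rewrite -cat_cons !mem_cat mem_rev => /or3P[zs|/g0X//|zs].
      by apply: s1X; rewrite inE zs orbT.
    by apply: s2X; rewrite inE zs orbT.
  by rewrite size_cat /= size_cat size_rcons addnS ltnS addnC addSn.
have H1 := subS _ _ _ _ _ _ sn gX; have H2 := subS _ _ _ _ _ _ (snake_swap sn) hX.
apply: (nsn _ _ _ _ _ _ _ _ sn s0) => z; rewrite ?inE.
- by case/predU1P=> [->//|zs]; apply: H1; rewrite mem_cat zs.
- by case/predU1P=> [->//|zs]; apply: H1; rewrite -cat_cons !mem_cat mem_rev zs !orbT.
- by move=> zs; apply: H1; rewrite -cat_cons !mem_cat inE zs !orbT.
by move=> zs; apply: H2; rewrite -cat_cons !mem_cat inE zs !orbT.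
Qed.

(** [X] induces disjoint cliques: the first three vertices of a chordless path joining non-adjacent
    vertices would violate the hypothesis. *)
Lemma special_in_no_P3 (X : {set V}) a b :
  (forall x t y, x \in X -> t \in X -> y \in X -> e x t -> e t y -> x != y -> e x y) ->
  a \in X -> b \in X -> a != b -> ~~ e a b -> special_in X a b.
Proof.
move=> tr aX bX ab nab.
have no q : ipath (a :: rcons q b) -> {subset q <= X} -> False.
  case: q => [|x q]; first by rewrite ipath_cons (negbTE nab).
  rewrite rcons_cons => ip qX.
  have [z [r E]] : exists z r, rcons q b = z :: r by case: q {qX ip} => [|z r]; do 2 eexists.
  have zX : z \in X.
    have : z \in rcons q b by rewrite E mem_head.
    rewrite mem_rcons inE => /predU1P[->//|zq]; by apply: qX; rewrite inE zq orbT.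
  move: ip; rewrite E !ipath_cons => /and3P[ax /andP[/andP[az naz] _] /and3P[xz _ _]].
  by case/negP: naz; apply: (tr a x z) => //; apply: qX; rewrite mem_head.
split=> // [q ip /(no q ip)//|s1 s2 c g c' d h d' sn _ s1X s2X gX hX].
apply: (no _ (snake_path sn)) => z.
rewrite -cat_cons !mem_cat mem_rev => /or3P[zs|/gX//|zs].
  by apply: s1X; rewrite inE zs orbT.
by apply: s2X; rewrite inE zs orbT.
Qed.

(** The outer induction is on [X], the inner one on the part of [X] outside [T], which shrinks as
    [T] absorbs violations of [star]. The set of complete vertices is smaller than [X] because it
    misses [T]. *)
Lemma special_in_exists (X : {set V}) (T : seq V) x y : anticonn T -> T != [::] -> {subset T <= X} ->
  x \in X -> y \in X -> complete T x -> complete T y -> x != y -> ~~ e x y ->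
  exists a b, [/\ C X T a, C X T b & special_in X a b].
Proof.
have [n] := ubnP #|X|; elim: n X T x y => // n IHX X T x y; rewrite ltnS => Xn.
have [m] := ubnP #|[set z in X | z \notin T]|.
elim: m T x y => // m IHT T x y; rewrite ltnS => Tm cT T0 TX xX yX Tx Ty xy nxy.
have [[w [x' [y' [rw Cx' Cy' [wx wy] [xy' nxy']]]]]|max] := classic (exists w x' y',
    [/\ rest X T w, C X T x', C X T y', e w x' /\ e w y' & x' != y' /\ ~~ e x' y']).
  have [/and3P[wX wT nTw] /andP[xX' Tx'] /andP[yX' Ty']] := And3 rw Cx' Cy'.
  have [||||||||||a [b [/andP[aX Ta] /andP[bX Tb] sp]]] := IHT (w :: T) x' y' => //=.
  - apply: leq_trans Tm; apply: proper_card; apply/properP; split.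
      by apply/subsetP => z; rewrite !inE negb_or => /and3P[-> _ ->].
    by exists w; rewrite !inE ?wX ?wT ?eqxx ?andbF.
  - by rewrite nTw orbT.
  - by move=> z; rewrite inE => /predU1P[->//|/TX].
  - by rewrite e_sym wx.
  - by rewrite e_sym wy.
  by exists a, b; split=> //; apply/andP; split=> //; [case/andP: Ta|case/andP: Tb].
have star w x' y' : rest X T w -> C X T x' -> C X T y' -> e w x' -> e w y' -> x' != y' -> e x' y'.
  move=> rw Cx' Cy' wx wy xy'; apply/negPn/negP => nxy'.
  by case: max; exists w, x', y'.
have [[x' [s [y' O]]]|no] := classic (exists x' s y', outer X T x' s y').
  exact: (outer_special cT T0 star O).
set X' := [set z in X | complete T z].
have X'X z : z \in X' -> z \in X by rewrite inE => /andP[].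
have [[xX' yX']] : x \in X' /\ y \in X' by rewrite !inE xX yX Tx Ty.
have lift a b : a \in X' -> b \in X' -> special_in X' a b ->
    exists a b, [/\ C X T a, C X T b & special_in X a b].
  move=> aX bX sp; exists a, b; split; [by move: aX; rewrite inE|by move: bX; rewrite inE|].
  apply: (special_in_complete (T := T) (X' := X')) => // x' s y' O.
  by apply: no; exists x', s, y'.
(* The recursive call needs an anticonnected set with two non-adjacent complete vertices: the middle
   vertex of an induced path on three vertices suffices. Without such a path the complete vertices
   form disjoint cliques. *)
have [[x' [t [y' [[xX2 tX2 yX2] xt ty xy' nxy']]]]|tr] := classic (exists x' t y',
    [/\ [/\ x' \in X', t \in X' & y' \in X'], e x' t, e t y', x' != y' & ~~ e x' y']).
  have [||||||||||a [b [/andP[aX _] /andP[bX _] sp]]] := IHX X' [:: t] x' y' => //=.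
  - apply: leq_trans Xn; apply: proper_card; apply/properP; split; first by apply/subsetP.
    have [t0 t0T] : exists t0, t0 \in T by case: (T) T0 => [|t0 r] // _; exists t0; exact: mem_head.
    exists t0; first exact: TX.
    by rewrite inE negb_and; apply/orP; right; apply: contraL t0T; apply: (complete_notin).
  - by move=> z; rewrite inE => /eqP->.
  - by rewrite xt.
  - by rewrite e_sym ty.
  exact: lift sp.
apply: (lift x y) => //; apply: special_in_no_P3 => // x' t y' xX2 tX2 yX2 xt ty xy'.
by apply/negPn/negP => nxy'; case: tr; exists x', t, y'.
Qed.

(** * Translation from sets and induced subgraphs to lists *)

Lemma path_exit (r : rel V) (s : seq V) x p : path r x p -> x \in s -> last x p \notin s ->
  exists u t, [/\ u \in s, t \notin s & r u t].
Proof.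
elim: p x => [|y p IH] x /=; first by move=> _ ->.
case/andP=> rxy pp xs; case: (boolP (y \in s)) => ys; first exact: IH.
by move=> _; exists x, y.
Qed.

(** Grow the list from one vertex: a path of the complement that leaves it does so along a non-edge
    of the graph, and the vertex reached is put in front. *)
Lemma connected_anticonn (T : {set V}) : connected_in (compl_graph e) T -> T != set0 ->
  exists s, [/\ anticonn s, s =i T & s != [::]].
Proof.
move=> con /set0Pn[x0 x0T].
have [k kT] : exists k, k.+1 = #|T| by exists #|T|.-1; rewrite prednK // (cardD1 x0) x0T.
have grow j : j <= k -> exists s, [/\ anticonn s, uniq s, size s = j.+1 & {subset s <= T}].
  elim: j => [_|j IH jk].
    by exists [:: x0]; split=> // z; rewrite inE => /eqP->.
  have [s [cs us sz sT]] := IH (ltnW jk).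
  have [y yT ys] : exists2 y, y \in T & y \notin s.
    apply/subsetPn; apply: contraTN jk => sub; rewrite -leqNgt -ltnS kT -sz.
    by rewrite -(card_uniqP us); apply: subset_leq_card.
  have [x xs] : exists x, x \in s by case: (s) sz => [|x r] // _; exists x; exact: mem_head.
  have /connectP[p pp yE] := con x y (sT x xs) yT.
  rewrite yE in ys; have [u [t [uS tS]]] := path_exit pp xs ys.
  case/and3P=> _ tT /andP[_ nut].
  exists (t :: s); split=> /=; last by move=> z; rewrite inE => /predU1P[->//|/sT].
  - by rewrite cs andbT; apply/orP; right; apply: contra nut => /allP/(_ u uS); rewrite e_sym.
  - by rewrite tS.
  by rewrite sz.
have [s [cs us sz sT]] := grow k (leqnn k).
exists s; split=> //; last by rewrite -size_eq0 sz.
have sz' : #|s| = #|T| by rewrite (card_uniqP us) sz kT.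
by apply/(subset_cardP sz')/subsetP.
Qed.

Lemma mem_complete_vertices (s : seq V) (T : {set V}) z : s =i T ->
  (z \in complete_vertices e T) = complete s z.
Proof.
move=> sT; rewrite inE; apply/andP/idP => [[_ /forall_inP H]|H].
  by apply/allP => t; rewrite sT; apply: H.
split; first by rewrite -sT; apply: (complete_notin).
by apply/forall_inP => t; rewrite -sT => /(allP H).
Qed.

Lemma snake_of_induces a s1 b s2 c g c' d h d' :
  induces e ((a :: s1) ++ (b :: s2) ++ (c :: rcons g c') ++ (d :: rcons h d'))
    [rel u v | [|| path_edge (a :: s1) u v, path_edge (b :: s2) u v,
        path_edge (c :: rcons g c') u v, path_edge (d :: rcons h d') u v,
        triangle_edge (last a s1) c d u v | triangle_edge (last b s2) c' d' u v]] ->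
  snake a s1 b s2 c g c' d h d'.
Proof.
case; set P1 := a :: s1; set P2 := b :: s2; set P3 := c :: _; set P4 := d :: _.
set f := [rel u v | _] => uniqP E.
have [a'P1 b'P2 cP3 c'P3] : [/\ last a s1 \in P1, last b s2 \in P2, c \in P3 & c' \in P3].
  by rewrite !mem_last /P3 mem_head inE mem_rcons mem_head orbT.
have [dP4 d'P4] : d \in P4 /\ d' \in P4 by rewrite /P4 mem_head inE mem_rcons mem_head orbT.
have cat_dis (P Q : seq V) : uniq (P ++ Q) ->
    [/\ uniq P, uniq Q & forall x y, x \in P -> y \in Q -> (x == y) = false].
  rewrite cat_uniq => /and3P[uP /hasPn H uQ]; split=> // x y xP /H yP.
  by apply: contraNF yP => /eqP<-.
have [u1 /cat_dis[u2 /cat_dis[u3 u4 D34] D2] D1] := cat_dis _ _ uniqP.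
have D23 x y : x \in P2 -> y \in P3 -> (x == y) = false by move=> xP yP; rewrite D2 ?mem_cat ?yP.
have D24 x y : x \in P2 -> y \in P4 -> (x == y) = false by move=> xP yP; rewrite D2 ?mem_cat ?yP ?orbT.
have D12 x y : x \in P1 -> y \in P2 -> (x == y) = false by move=> xP yP; rewrite D1 ?mem_cat ?yP.
have D13 x y : x \in P1 -> y \in P3 -> (x == y) = false by move=> xP yP; rewrite D1 ?mem_cat ?yP ?orbT.
have D14 x y : x \in P1 -> y \in P4 -> (x == y) = false by move=> xP yP; rewrite D1 ?mem_cat ?yP ?orbT.
have cc' : c != c'.
  by have /= /andP[+ _] := u3; rewrite mem_rcons inE negb_or => /andP[].
have dd' : d != d'.
  by have /= /andP[+ _] := u4; rewrite mem_rcons inE negb_or => /andP[].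
have sw (P Q : seq V) : (forall x y, x \in P -> y \in Q -> (x == y) = false) ->
  forall x y, x \in Q -> y \in P -> (x == y) = false by move=> D x y xQ yP; rewrite eq_sym D.
have ni (P Q : seq V) x : (forall x y, x \in P -> y \in Q -> (x == y) = false) ->
   x \in P -> x \in Q = false by move=> D xP; apply/negP => xQ; have := D x x xP xQ; rewrite eqxx.
(* [Q1] to [Q4] record where each path meets the two triangles, which reduces the adjacency between
   any two paths to an explicit formula. *)
have Q1 x : x \in P1 -> [/\ x \in P2 = false, x \in P3 = false & x \in P4 = false]
   /\ ((x \in [:: last a s1; c; d]) = (x == last a s1)) * ((x \in [:: last b s2; c'; d']) = false).
  move=> xP; split; first by rewrite (ni _ _ _ D12) // (ni _ _ _ D13) // (ni _ _ _ D14).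
  split; rewrite !inE ?(D13 x c) // ?(D14 x d) // ?(D12 x (last b s2)) // ?(D13 x c') // ?(D14 x d') // ?orbF //.
have Q2 x : x \in P2 -> [/\ x \in P1 = false, x \in P3 = false & x \in P4 = false]
   /\ ((x \in [:: last a s1; c; d]) = false) * ((x \in [:: last b s2; c'; d']) = (x == last b s2)).
  move=> xP; split; first by rewrite (ni _ _ _ (sw _ _ D12)) // (ni _ _ _ D23) // (ni _ _ _ D24).
  split; rewrite !inE ?(D23 x c) // ?(D24 x d) // ?(sw _ _ D12 x (last a s1)) // ?(D23 x c') // ?(D24 x d') // ?orbF //.
have Q3 x : x \in P3 -> [/\ x \in P1 = false, x \in P2 = false & x \in P4 = false]
   /\ ((x \in [:: last a s1; c; d]) = (x == c)) * ((x \in [:: last b s2; c'; d']) = (x == c')).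
  move=> xP; split; first by rewrite (ni _ _ _ (sw _ _ D13)) // (ni _ _ _ (sw _ _ D23)) // (ni _ _ _ D34).
  split; rewrite !inE ?(D34 x d) // ?(D34 x d') // ?(sw _ _ D13 x (last a s1)) // ?(sw _ _ D23 x (last b s2)) // ?orbF //.
have Q4 x : x \in P4 -> [/\ x \in P1 = false, x \in P2 = false & x \in P3 = false]
   /\ ((x \in [:: last a s1; c; d]) = (x == d)) * ((x \in [:: last b s2; c'; d']) = (x == d')).
  move=> xP; split; first by rewrite (ni _ _ _ (sw _ _ D14)) // (ni _ _ _ (sw _ _ D24)) // (ni _ _ _ (sw _ _ D34)).
  split; rewrite !inE ?(sw _ _ D34 x c) // ?(sw _ _ D34 x c') // ?(sw _ _ D14 x (last a s1)) // ?(sw _ _ D24 x (last b s2)) //=.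
have sub1 x : x \in P1 -> x \in P1 ++ P2 ++ P3 ++ P4 by rewrite !mem_cat => ->.
have sub2 x : x \in P2 -> x \in P1 ++ P2 ++ P3 ++ P4 by rewrite !mem_cat => ->; rewrite !orbT.
have sub3 x : x \in P3 -> x \in P1 ++ P2 ++ P3 ++ P4 by rewrite !mem_cat => ->; rewrite !orbT.
have sub4 x : x \in P4 -> x \in P1 ++ P2 ++ P3 ++ P4 by rewrite !mem_cat => ->; rewrite !orbT.
have pe (P : seq V) x y : x \in P = false -> path_edge P x y = false.
  by move=> xP; apply: path_edge_notin; rewrite xP.
have same x y w : (x == w) && ((y == w) && (x != y)) = false.
  by case: eqVneq => //= ->; case: eqVneq => //= ->; rewrite eqxx.
have ip0 (P : seq V) x p : P = x :: p -> uniq P -> {in P &, e =2 path_edge P} -> ipath P.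
  by move=> -> uP H; apply/chordless_pathP.
have i1 : ipath P1.
  apply: (ip0 _ a s1) => // x y xP yP; rewrite E ?sub1 // /f /triangle_edge /=.
  have [[x2 x3 x4] X] := Q1 x xP; have [_ Y] := Q1 y yP.
  by rewrite !X !Y (pe P2) // (pe P3) // (pe P4) // same !orbF.
have i2 : ipath P2.
  apply: (ip0 _ b s2) => // x y xP yP; rewrite E ?sub2 // /f /triangle_edge /=.
  have [[x2 x3 x4] X] := Q2 x xP; have [_ Y] := Q2 y yP.
  by rewrite !X !Y (pe P1) // (pe P3) // (pe P4) // same !orbF.
have i3 : ipath P3.
  apply: (ip0 _ c (rcons g c')) => // x y xP yP; rewrite E ?sub3 // /f /triangle_edge /=.
  have [[x2 x3 x4] X] := Q3 x xP; have [_ Y] := Q3 y yP.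
  by rewrite !X !Y (pe P1) // (pe P2) // (pe P4) // !same !orbF.
have i4 : ipath P4.
  apply: (ip0 _ d (rcons h d')) => // x y xP yP; rewrite E ?sub4 // /f /triangle_edge /=.
  have [[x2 x3 x4] X] := Q4 x xP; have [_ Y] := Q4 y yP.
  by rewrite !X !Y (pe P1) // (pe P2) // (pe P3) // !same !orbF.
have pe2 (P : seq V) x y : y \in P = false -> path_edge P x y = false.
  by move=> yP; rewrite path_edge_sym pe.
have J12 : forall x y : V, x \in P1 -> y \in P2 -> far x y.
  move=> x y xP yP; rewrite /anti (D12 x y) //= E ?(sub1 x) ?(sub2 y) // /f /triangle_edge /=.
  have [[x2 x3 x4] X] := Q1 x xP; have [[y1 y3 y4] Y] := Q2 y yP.
  by rewrite !X !Y (pe2 P1) // (pe P2) // (pe P3) // (pe P4) // andbF.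
have J13 : forall x y : V, x \in P1 -> y \in P3 -> e x y = (x == last a s1) && (y == c).
  move=> x y xP yP; rewrite E ?(sub1 x) ?(sub3 y) // /f /triangle_edge /=.
  have [[x2 x3 x4] X] := Q1 x xP; have [[y1 y3 y4] Y] := Q3 y yP.
  by rewrite !X !Y (pe2 P1) // (pe P2) // (pe P3) // (pe P4) // (D13 x y) //= andbT orbF.
have J14 : forall x y : V, x \in P1 -> y \in P4 -> e x y = (x == last a s1) && (y == d).
  move=> x y xP yP; rewrite E ?(sub1 x) ?(sub4 y) // /f /triangle_edge /=.
  have [[x2 x3 x4] X] := Q1 x xP; have [[y1 y3 y4] Y] := Q4 y yP.
  by rewrite !X !Y (pe2 P1) // (pe P2) // (pe P3) // (pe P4) // (D14 x y) //= andbT orbF.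
have J23 : forall x y : V, x \in P2 -> y \in P3 -> e x y = (x == last b s2) && (y == c').
  move=> x y xP yP; rewrite E ?(sub2 x) ?(sub3 y) // /f /triangle_edge /=.
  have [[x2 x3 x4] X] := Q2 x xP; have [[y1 y3 y4] Y] := Q3 y yP.
  by rewrite !X !Y (pe P1) // (pe2 P2) // (pe P3) // (pe P4) // (D23 x y) //= andbT.
have J24 : forall x y : V, x \in P2 -> y \in P4 -> e x y = (x == last b s2) && (y == d').
  move=> x y xP yP; rewrite E ?(sub2 x) ?(sub4 y) // /f /triangle_edge /=.
  have [[x2 x3 x4] X] := Q2 x xP; have [[y1 y3 y4] Y] := Q4 y yP.
  by rewrite !X !Y (pe P1) // (pe2 P2) // (pe P3) // (pe P4) // (D24 x y) //= andbT.
have J34 : forall x y : V, x \in P3 -> y \in P4 -> e x y = (x == c) && (y == d) || (x == c') && (y == d').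
  move=> x y xP yP; rewrite E ?(sub3 x) ?(sub4 y) // /f /triangle_edge /=.
  have [[x2 x3 x4] X] := Q3 x xP; have [[y1 y3 y4] Y] := Q4 y yP.
  by rewrite !X !Y (pe P1) // (pe P2) // (pe2 P3) // (pe P4) // (D34 x y) //= !andbT.
have far1 (x y w w' : V) : (x == y) = false -> e x y = (x == w) && (y == w') ->
    far x y \/ x = w /\ y = w'.
  rewrite /anti => -> ->; case: (boolP ((x == w) && (y == w'))) => [/andP[/eqP-> /eqP->]|_].
    by right.
  by left.
split=> //.
- by rewrite J13 // !eqxx.
- by rewrite J14 // !eqxx.
- by rewrite J34 // !eqxx.
- by rewrite J23 // !eqxx.
- by rewrite J24 // !eqxx.
- by rewrite J34 // !eqxx orbT.
- exact/anti_seqP.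
- by move=> x y xP yP; apply: far1 (J13 x y xP yP); rewrite // D13.
- by move=> x y xP yP; apply: far1 (J14 x y xP yP); rewrite // D14.
- by move=> x y xP yP; apply: far1 (J23 x y xP yP); rewrite // D23.
- by move=> x y xP yP; apply: far1 (J24 x y xP yP); rewrite // D24.
move=> x y xP yP; have J := J34 x y xP yP.
case: (boolP ((x == c) && (y == d))) J => [/andP[/eqP-> /eqP->] _|_]; first by constructor 2.
case: (boolP ((x == c') && (y == d'))) => [/andP[/eqP-> /eqP->] _|_ J]; first by constructor 3.
by constructor 1; rewrite /anti J (D34 x y).
Qed.

Lemma special_in_special a b : special_in [set: V] a b -> special_even_pair e a b.
Proof.
case=> ab nab par nsn; split; first split=> // p.
  case/lastP: p => [|q z]; first by move=> _ /= E; rewrite E eqxx in ab.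
  rewrite last_rcons => /(chordless_pathP e_sym e_irr) ip zE; rewrite zE in ip.
  by rewrite size_rcons /= negbK; apply: par => // x _; rewrite inE.
case=> c [d [s1 [s2 [s3 [s4 [l3 l4 l12 I]]]]]].
case/lastP: s3 l3 I => [|g c'] // _; case/lastP: s4 l4 => [|h d'] // _.
rewrite !last_rcons => /snake_of_induces sn.
by apply: (nsn _ _ _ _ _ _ _ _ sn) => [|x _|x _|x _|x _]; rewrite ?inE //; case: (s1) (s2) l12 => [|? ?] [|? ?].
Qed.

End ClassA.

Theorem theorem1p3 (V : finType) (e : rel V)
  (e_sym : symmetric e) (e_irr : irreflexive e)
  (GA : class_A e)
  (not_cliques : ~ disjoint_union_of_cliques e)
  (T : {set V}) (T_int : interesting e T) :
  exists a b : V,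
    [/\ a \in complete_vertices e T,
        b \in complete_vertices e T &
        special_even_pair e a b].
Proof.
have [T0 con ncl] := T_int.
have [s [cs sT s0]] := connected_anticonn e_sym con T0.
have [[x [y [xC yC xy nxy]]]|no] := classic (exists x y, [/\ x \in complete_vertices e T,
    y \in complete_vertices e T, x != y & ~~ e x y]).
  rewrite !(mem_complete_vertices e_irr _ sT) in xC yC.
  have all_in (z : V) : z \in [set: V] by rewrite inE.
  have [a [b [/andP[_ Ta] /andP[_ Tb] sp]]] := special_in_exists e_sym e_irr GA cs s0
    (fun z _ => all_in z) (all_in x) (all_in y) xC yC xy nxy.
  exists a, b.
  by rewrite !(mem_complete_vertices e_irr _ sT); split=> //; apply: special_in_special sp.
case: ncl => u v uC vC uv; apply/negPn/negP => nuv.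
by apply: no; exists u, v.
Qed.
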